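(* Let $f(z,t)$ be a smooth one-parametric family of conformal mappings onto exteriors $G(t)$ of two rectilinear slits as described in the context. Then the conformal module $m(t)$ of the domains $G(t)$ satisfies the equation $$\dot m(t)=\pi\sum_{j=1}^4\gamma_j(t),$$ where $\gamma_k(t)=\dot A_k(t)/D_k(t)$ and $D_k(t)=f''(z_k(t),t)$, $1\le k\le4$.
   Context: A dot is differentiation with respect to the real parameter $t$ (ranging over an interval), a prime is differentiation with respect to $z$. The conformal module of a ring domain conformally equivalent to the annulus $\{q<|\zeta|<1\}$ is $\frac1{2\pi}\log(q^{-1})$. Weierstrass functions: for each $t$, $\omega_1(t)\equiv1$ and $\omega_2(t)=2m(t)i$ with $m(t)>0$; $\sigma(z)=\sigma(z;1,\omega_2(t))$ and $\zeta(z)=\zeta(z;1,\omega_2(t))=\sigma'(z)/\sigma(z)$ are the Weierstrass functions of the lattice generated by the full periods $1,\omega_2(t)$, and $\eta_k(t)=2\zeta(\omega_k(t)/2)$. The family: $G(t)$ is the exterior (in $\overline{\mathbb C}$) of two disjoint slits (segments), the first on the ray $\{\arg w=\theta\}$, the second on the ray $\{\arg w=\theta+\beta\}$, with $\theta$ and $0<\beta<2\pi$ independent of $t$ (one may take $\theta=0$). For each $t$, $$f(z,t)= c(t)\int_{0}^z e^{\gamma(t)\xi}\frac{\prod_{k=1}^4\sigma(\xi-z_k(t))}{\sigma^2(\xi-z_0(t))\,\sigma^2(\xi-\overline{z_0(t)})}\,d\xi+c_1(t),\qquad c(t)\neq0,$$ where $c,c_1,m$, $x_k$ and $y_0$ are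 smooth functions of $t$, $$z_1=x_1,\quad z_2=x_2,\quad z_3=x_3+im,\quad z_4=x_4-im,\quad z_0=iy_0,$$ with $x_k,y_0$ real, $x_1<x_2<x_1+1$, $x_3<x_4<x_3+1$, $0<y_0<m$, and $$\gamma=\frac{\beta}{\pi}\eta_1,\qquad \sum_{k=1}^4x_k=\frac\beta\pi,\qquad \gamma+\sum_{k=1}^4\zeta(z_0-z_k)-2\zeta(z_0-\overline{z}_0)=0.$$ The function $f(\cdot,t)$ is $1$-periodic and maps the rectangle $\{0<\operatorname{Re}z<1,\ 0<\operatorname{Im}z<m(t)\}$ with identified vertical sides conformally onto $G(t)$ (so $m(t)$ is the conformal module of $G(t)$), the side $\operatorname{Im}z=0$ corresponding to the first slit and $\operatorname{Im}z=m$ to the second; it is extended by reflection to a meromorphic function on $\mathbb C$ satisfying $f(z+1,t)=f(z,t)$, $f(z+\omega_2(t),t)=e^{2i\beta}f(z,t)$. The points $z_k$ are (modulo the lattice) the preimages of the endpoints of the slits, and $A_k(t):=f(z_k(t),t)$ for the extended function. Thus $A_1,A_2,A_3$ are endpoints of the slits, while for $z_4=(x_4+im)-\omega_2$ the value $A_4$ equals $e^{-2i\beta}$ times the corresponding endpoint. One has $f''(z_k(t),t)\neq0$. *)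

(* Defs.v *)
From Stdlib Require Import Reals ZArith List.
From Coquelicot Require Export Coquelicot.
Export ListNotations.
Open Scope R_scope.

(** * Smooth functions on an interval, one-sided at end points *)

Definition interval (J : R -> Prop) : Prop :=
  (forall a b s, J a -> J b -> a <= s <= b -> J s) /\
  (exists a b, J a /\ J b /\ a < b).

(** [is_derive] relative to [J]: at an interior point of [J] this is the usual
    derivative, at an end point belonging to [J] the one-sided one. *)
Definition is_derive_on {V : NormedModule R_AbsRing}
    (J : R -> Prop) (g : R -> V) (t : R) (l : V) : Prop :=
  filterdiff g (within J (locally t)) (fun h => scal h l).

(** [d n] is the [n]-th derivative. *)
Definition smooth_on {V : NormedModule R_AbsRing}
    (J : R -> Prop) (g : R -> V) : Prop :=
  exists d : nat -> R -> V,
    (forall t, J t -> d O t = g t) /\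
    (forall n t, J t -> is_derive_on J (d n) t (d (S n) t)).

(** * Complex exponential, contour integrals *)

Definition Cexp (z : C) : C :=
  (exp (Re z) * cos (Im z), exp (Re z) * sin (Im z)).

Definition polar (r phi : R) : C := (r * cos phi, r * sin phi).

Definition Clim_seq (u : nat -> C) : C :=
  (real (Lim_seq (fun n => Re (u n))), real (Lim_seq (fun n => Im (u n)))).

Definition Cprod (l : list C) : C := fold_right Cmult (RtoC 1) l.

Definition C1_path (p dp : R -> C) : Prop :=
  forall s, 0 <= s <= 1 ->
    is_derive (K := R_AbsRing) (V := C_R_NormedModule) p s (dp s) /\
    continuous (U := C_R_NormedModule) dp s.

Definition path_integral (g : C -> C) (p dp : R -> C) : C :=
  RInt (V := C_R_CompleteNormedModule) (fun s => (g (p s) * dp s)%C) 0 1.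

(** * Weierstrass functions of the lattice generated by [w1], [w2] *)

Definition sigma_factor (l z : C) : C :=
  if Ceq_dec l 0 then z
  else ((1 - z / l) * Cexp (z / l + (z / l) ^ 2 / 2))%C.

Definition Zrange (N : nat) : list Z :=
  map (fun k => (Z.of_nat k - Z.of_nat N)%Z) (seq 0 (2 * N + 1)).

(** The lattice points [i w1 + j w2] with [|i|, |j| <= N]. *)
Definition lattice_box (w1 w2 : C) (N : nat) : list C :=
  map (fun ij : Z * Z => (IZR (fst ij) * w1 + IZR (snd ij) * w2)%C)
      (list_prod (Zrange N) (Zrange N)).

(** The Weierstrass product converges absolutely, so exhausting the lattice by
    boxes is only a choice of summation order. *)
Definition wsigma (w1 w2 z : C) : C :=
  Clim_seq (fun N => Cprod (map (fun l => sigma_factor l z) (lattice_box w1 w2 N))).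

Definition wzeta (w1 w2 z : C) : C :=
  (C_derive (wsigma w1 w2) z / wsigma w1 w2 z)%C.

Definition weta1 (w1 w2 : C) : C := (2 * wzeta w1 w2 (w1 / 2))%C.

(** * Riemann sphere and conformal maps *)

Inductive Chat : Type :=
| Fin (w : C)
| Inf.

Definition fin (w : Chat) : C :=
  match w with Fin u => u | Inf => RtoC 0 end.

(** Acts on finite points, fixes infinity. *)
Definition hmap (g : C -> C) (w : Chat) : Chat :=
  match w with Fin u => Fin (g u) | Inf => Inf end.

Definition hinv (w : Chat) : Chat :=
  match w with
  | Fin u => if Ceq_dec u 0 then Inf else Fin (/ u)%C
  | Inf => Fin (RtoC 0)
  end.

Definition finite_holomorphic_at (F : C -> Chat) (z : C) : Prop :=
  locally z (fun u => F u <> Inf /\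
    ex_derive (K := C_AbsRing) (V := C_NormedModule) (fun v => fin (F v)) u).

(** Holomorphic as a map into the sphere, that is meromorphic (or
    identically infinite) near [z]. *)
Definition holomorphic_at (F : C -> Chat) (z : C) : Prop :=
  finite_holomorphic_at F z \/ finite_holomorphic_at (fun u => hinv (F u)) z.

(** [F] induces a conformal bijection from the quotient of [U] by the
    equivalence relation [E] onto [V]. *)
Definition conformal_mod (E : C -> C -> Prop) (U : C -> Prop)
    (F : C -> Chat) (V : Chat -> Prop) : Prop :=
  (forall z, U z -> holomorphic_at F z) /\
  (forall z z', U z -> U z' -> (F z = F z' <-> E z z')) /\
  (forall w, V w <-> exists z, U z /\ F z = w).

Definition annulus (q : R) (z : C) : Prop := q < Cmod z < 1.

Definition is_conformal_module (G : Chat -> Prop) (M : R) : Prop :=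
  exists (q : R) (F : C -> Chat),
    0 < q < 1 /\ conformal_mod eq (annulus q) F G /\ M = / (2 * PI) * ln (/ q).

Definition hstrip (h : R) (z : C) : Prop := 0 < Im z < h.

(** Modulo this relation [hstrip h] is the rectangle
    [0 < Re z < 1, 0 < Im z < h] with its vertical sides glued. *)
Definition Zshift (z z' : C) : Prop := exists n : Z, z' = (z + IZR n)%C.

(** * Families of maps onto exteriors of two slits *)

(** Closed segment of the ray [arg w = phi] with end points at distances
    [a], [b] (in either order) from the origin. *)
Definition slit (phi a b : R) (w : C) : Prop :=
  exists r, Rmin a b <= r <= Rmax a b /\ w = polar r phi.

(** [sd_x k] and [sd_rad k] are used for [k = 1, 2, 3, 4] only; [sd_rad 1], [sd_rad 2] are
    the moduli of the end points of the first slit, [sd_rad 3], [sd_rad 4] those of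
    the second. *)
Record slit_data := {
  sd_c : R -> C;
  sd_c1 : R -> C;
  sd_m : R -> R;
  sd_x : nat -> R -> R;
  sd_y0 : R -> R;
  sd_rad : nat -> R -> R
}.

Definition slit1 (theta : R) (d : slit_data) (t : R) : C -> Prop :=
  slit theta (sd_rad d 1 t) (sd_rad d 2 t).
Definition slit2 (theta beta : R) (d : slit_data) (t : R) : C -> Prop :=
  slit (theta + beta) (sd_rad d 3 t) (sd_rad d 4 t).

Definition slit_ext (theta beta : R) (d : slit_data) (t : R) (w : Chat)
  : Prop :=
  match w with
  | Fin u => ~ slit1 theta d t u /\ ~ slit2 theta beta d t u
  | Inf => True
  end.

Definition omega2 (d : slit_data) (t : R) : C := (2 * sd_m d t * Ci)%C.
Definition sigma (d : slit_data) (t : R) : C -> C := wsigma 1 (omega2 d t).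
Definition zeta (d : slit_data) (t : R) : C -> C := wzeta 1 (omega2 d t).
Definition gam (beta : R) (d : slit_data) (t : R) : C :=
  (RtoC (beta / PI) * weta1 1 (omega2 d t))%C.

(** Index [0] is the point [z_0] over infinity. *)
Definition zpt (d : slit_data) (k : nat) (t : R) : C :=
  match k with
  | 0 => (Ci * sd_y0 d t)%C
  | 3 => (sd_x d 3 t + Ci * sd_m d t)%C
  | 4 => (sd_x d 4 t - Ci * sd_m d t)%C
  | _ => RtoC (sd_x d k t)
  end.

Definition denom (d : slit_data) (t : R) (xi : C) : C :=
  (sigma d t (xi - zpt d 0 t) ^ 2 * sigma d t (xi - Cconj (zpt d 0 t)) ^ 2)%C.

Definition integrand (beta : R) (d : slit_data) (t : R) (xi : C) : C :=
  (Cexp (gam beta d t * xi)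
   * Cprod (map (fun k => sigma d t (xi - zpt d k t)) [1; 2; 3; 4]%nat)
   / denom d t xi)%C.

(** The values of [f] at [zpt d k t], [1 <= k <= 4], are finite, so [fin] discards nothing. *)
Definition slit_A (d : slit_data) (f : C -> R -> Chat) (k : nat) (t : R) : C :=
  fin (f (zpt d k t) t).

Definition slit_D (d : slit_data) (f : C -> R -> Chat) (k : nat) (t : R) : C :=
  C_derive (C_derive (fun v => fin (f v t))) (zpt d k t).

Record slit_family (J : R -> Prop) (theta beta : R) (d : slit_data)
    (f : C -> R -> Chat) : Prop := {
  sf_interval : interval J;
  sf_beta : 0 < beta < 2 * PI;

  sf_smooth_c : smooth_on (V := C_R_NormedModule) J (sd_c d);
  sf_smooth_c1 : smooth_on (V := C_R_NormedModule) J (sd_c1 d);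
  sf_smooth_m : smooth_on (V := R_NormedModule) J (sd_m d);
  sf_smooth_x : forall k, (1 <= k <= 4)%nat ->
    smooth_on (V := R_NormedModule) J (sd_x d k);
  sf_smooth_y0 : smooth_on (V := R_NormedModule) J (sd_y0 d);

  sf_c : forall t, J t -> sd_c d t <> RtoC 0;
  sf_m : forall t, J t -> 0 < sd_m d t;
  sf_x12 : forall t, J t -> sd_x d 1 t < sd_x d 2 t < sd_x d 1 t + 1;
  sf_x34 : forall t, J t -> sd_x d 3 t < sd_x d 4 t < sd_x d 3 t + 1;
  sf_y0 : forall t, J t -> 0 < sd_y0 d t < sd_m d t;
  sf_sum_x : forall t, J t -> sum_n_m (fun k => sd_x d k t) 1 4 = beta / PI;
  sf_residue : forall t, J t ->
    (gam beta d t + sum_n_m (fun k => zeta d t (zpt d 0 t - zpt d k t)) 1 4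
     - 2 * zeta d t (zpt d 0 t - Cconj (zpt d 0 t)))%C = RtoC 0;

  sf_rad : forall t, J t ->
    (forall k, (1 <= k <= 4)%nat -> 0 < sd_rad d k t) /\
    sd_rad d 1 t <> sd_rad d 2 t /\ sd_rad d 3 t <> sd_rad d 4 t;

  (* the integral does not depend on the path; the path only has to avoid the
     poles of the integrand *)
  sf_formula : forall t u p dp, J t -> C1_path p dp -> p 0 = RtoC 0 -> p 1 = u ->
    (forall s, 0 <= s <= 1 -> denom d t (p s) <> RtoC 0) ->
    f u t = Fin (sd_c d t * path_integral (integrand beta d t) p dp + sd_c1 d t)%C;

  sf_meromorphic : forall t u, J t -> holomorphic_at (fun v => f v t) u;
  sf_conformal : forall t, J t ->
    conformal_mod Zshift (hstrip (sd_m d t)) (fun v => f v t)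
      (slit_ext theta beta d t);
  sf_side1 : forall t w, J t ->
    ((exists s : R, f (RtoC s) t = w) <->
     (exists u, w = Fin u /\ slit1 theta d t u));
  sf_side2 : forall t w, J t ->
    ((exists s : R, f (s + Ci * sd_m d t)%C t = w) <->
     (exists u, w = Fin u /\ slit2 theta beta d t u));

  sf_reflect1 : forall t u, J t ->
    f (Cconj u) t = hmap (fun w => (polar 1 (2 * theta) * Cconj w)%C) (f u t);
  sf_reflect2 : forall t u, J t ->
    f (Cconj u + omega2 d t)%C t =
    hmap (fun w => (polar 1 (2 * (theta + beta)) * Cconj w)%C) (f u t);
  sf_period1 : forall t u, J t -> f (u + 1)%C t = f u t;
  sf_period2 : forall t u, J t ->
    f (u + omega2 d t)%C t = hmap (Cmult (polar 1 (2 * beta))) (f u t);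

  sf_end1 : forall t, J t -> f (zpt d 1 t) t = Fin (polar (sd_rad d 1 t) theta);
  sf_end2 : forall t, J t -> f (zpt d 2 t) t = Fin (polar (sd_rad d 2 t) theta);
  sf_end3 : forall t, J t ->
    f (zpt d 3 t) t = Fin (polar (sd_rad d 3 t) (theta + beta));
  (* the fourth slit end point is attained at [x_4 + i m], not at
     [z_4 = x_4 - i m] *)
  sf_end4 : forall t, J t ->
    f (zpt d 4 t + omega2 d t)%C t = Fin (polar (sd_rad d 4 t) (theta + beta));

  sf_f2 : forall t k, J t -> (1 <= k <= 4)%nat ->
    slit_D d f k t <> RtoC 0
}.

(* Main.v *)
Require Import Defs.
From Stdlib Require Import Reals.
From Coquelicot Require Import Coquelicot.
From Stdlib Require Import Lra Lia Classical ClassicalEpsilon ZArith List Permutation.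
Import ListNotations.
Open Scope R_scope.

(** Put [h = (df/dt) / f'] at a fixed time.  The quotient is 1-periodic, has simple
    poles at the [z_k] with residues [gamma_k], stays bounded at the poles of [f], and
    differentiating [f (z + omega2 t, t) = exp (2 i beta) f (z, t)] in [t] gives
    [h (z + omega2) = h z - 2 i m'].  The integral of [h] over a horizontal segment of
    length 1 is locally constant in its height, jumps by [- 2 pi i] times the sum of
    the residues at each singular height, and decreases by [2 i m'] over a full
    period; hence [m' = pi (gamma_1 + ... + gamma_4)].

    The differentiability of [f] in [t] is obtained from the Weierstrass product:
    [sigma] is a locally uniform limit of finite products with summable Lipschitz
    constants in [z] and in the period, [exp gam] is a quotient of values of [sigma]
    since [f'] is 1-periodic, and [f] is an integral of these functions along paths. *)

(** The residue at [z_k] is [gamma_k] because [f'] vanishes there: differentiating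
    [A_k (t) = f (z_k (t), t)] leaves only [df/dt], while [f'] has a simple zero with slope [D_k].
    At a pole of [f] the derivative [f'] has order two, and a pole moving differentiably with [t]
    lets [df/dt] grow at most to the same order, so nothing is contributed. One vertical period
    meets the singular heights [- y0], [0], [y0], [m]; the point [z_4] enters as [z_4 + omega2].

    The obstacle is regularity in time. Only the parameters are assumed smooth, and the interval of
    times may contain its end points, so differentiability is phrased as inequalities between
    increments at times of a given set. There is also a circle to break: differentiability of [gam]
    in time comes from the period of [f'], hence from [f] being differentiable in [z], and [f]
    itself contains [gam]. It is broken by first letting the set of times be a single point.

    The jump at a line of poles comes from [1 / (x + i y) - 1 / (x - i y)], which is [- 2 i] times a
    Poisson kernel of total mass [pi]. *)

Ltac pose_rmin :=
  repeat match goal with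
  | _ : context [Rmin ?a ?b] |- _ =>
      lazymatch goal with
      | _ : Rmin a b <= a |- _ => fail
      | _ => pose proof (Rmin_l a b); pose proof (Rmin_r a b)
      end
  | |- context [Rmin ?a ?b] =>
      lazymatch goal with
      | _ : Rmin a b <= a |- _ => fail
      | _ => pose proof (Rmin_l a b); pose proof (Rmin_r a b)
      end
  end.

Ltac rmin := pose_rmin; lra.

(** * Complex preliminaries *)

(** This and the next two definitions restate the library notions as inequalities in [Cmod], so that
    estimates can be chained without filters; the equivalences follow below. *)
Definition cderiv (H : C -> C) (w a : C) : Prop :=
  forall eps, 0 < eps -> exists d, 0 < d /\ forall w', Cmod (w' - w) < d ->
    Cmod (H w' - H w - a * (w' - w)) <= eps * Cmod (w' - w).

Definition rcont (f : R -> C) (x : R) : Prop :=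
  forall eps, 0 < eps -> exists d, 0 < d /\ forall y, Rabs (y - x) < d ->
    Cmod (f y - f x) < eps.

Definition rderiv (f : R -> C) (x : R) (l : C) : Prop :=
  forall eps, 0 < eps -> exists d, 0 < d /\ forall y, Rabs (y - x) < d ->
    Cmod (f y - f x - l * RtoC (y - x)) <= eps * Rabs (y - x).

Lemma norm_C_R (z : C) : norm (V := C_R_NormedModule) z = Cmod z.
Proof.
  unfold norm; simpl; unfold prod_norm, norm; simpl; unfold abs; simpl.
  unfold Cmod. rewrite !Rmult_1_r. f_equal.
  rewrite <- !Rabs_mult, !Rabs_right; try reflexivity; nra.
Qed.

Lemma cderiv_is_derive (H : C -> C) (w a : C) :
  cderiv H w a <-> is_derive (K := C_AbsRing) (V := C_NormedModule) H w a.
Proof.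
  assert (E : forall y, (minus (minus (H y) (H w)) (scal (minus y w) a) : C_NormedModule)
            = (H y - H w - a * (y - w))%C).
  { intros y. apply injective_projections; simpl;
      unfold minus, plus, opp, scal; simpl; unfold mult; simpl; ring. }
  split.
  - intros h. split. { apply is_linear_scal_l. }
    intros x Hx.
    apply (is_filter_lim_locally_unique (V := AbsRing_NormedModule C_AbsRing)) in Hx.
    subst x. intros [e he]. destruct (h e he) as [d [hd h']].
    exists (mkposreal d hd). intros y Hy. specialize (h' y Hy).
    rewrite E. exact h'.
  - intros [_ h] e he.
    destruct (h w (fun P HP => HP) (mkposreal e he)) as [[d hd] h'].
    exists d. split; [exact hd |]. intros y Hy.
    specialize (h' y Hy). rewrite E in h'. exact h'.
Qed.

Lemma rcont_continuous (f : R -> C) (x : R) :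
  rcont f x <-> continuous (U := C_R_NormedModule) f x.
Proof.
  split.
  - intros h. apply (filterlim_locally_ball_norm (U := C_R_NormedModule)).
    intros [e he]. destruct (h e he) as [d [hd h']].
    exists (mkposreal d hd). intros y Hy. unfold ball_norm. simpl.
    rewrite norm_C_R. apply h'. exact Hy.
  - intros h e he.
    assert (h2 := proj1 (filterlim_locally_ball_norm (U := C_R_NormedModule) f (f x)) h
                   (mkposreal e he)).
    destruct h2 as [[d hd] h2]. exists d. split; [exact hd |].
    intros y Hy. specialize (h2 y Hy). unfold ball_norm in h2.
    rewrite norm_C_R in h2. exact h2.
Qed.

Lemma rderiv_is_derive (f : R -> C) (x : R) (l : C) :
  rderiv f x l <-> is_derive (K := R_AbsRing) (V := C_R_NormedModule) f x l.
Proof.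
  assert (E : forall y, (minus (minus (f y) (f x)) (scal (minus y x) l) : C_R_NormedModule)
            = (f y - f x - l * RtoC (y - x))%C).
  { intros y. apply injective_projections; simpl;
      unfold minus, plus, opp, scal; simpl; unfold mult; simpl; ring. }
  split.
  - intros h. split. { apply is_linear_scal_l. }
    intros x0 Hx.
    apply (is_filter_lim_locally_unique (V := AbsRing_NormedModule R_AbsRing)) in Hx. subst x0.
    intros [e he]. destruct (h e he) as [d [hd h']].
    exists (mkposreal d hd). intros y Hy.
    specialize (h' y Hy). rewrite <- E, <- norm_C_R in h'. exact h'.
  - intros [_ h] e he.
    destruct (h x (fun P HP => HP) (mkposreal e he)) as [[d hd] h'].
    exists d. split; [exact hd |]. intros y Hy. specialize (h' y Hy).
    rewrite <- E, <- norm_C_R. exact h'.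
Qed.

Lemma is_derive_eps (f : R -> R) (x l : R) :
  is_derive f x l <->
  forall eps, 0 < eps -> exists d, 0 < d /\ forall y, Rabs (y - x) < d ->
    Rabs (f y - f x - l * (y - x)) <= eps * Rabs (y - x).
Proof.
  assert (E : forall y, minus (minus (f y) (f x)) (scal (minus y x) l)
            = f y - f x - l * (y - x)).
  { intros y. unfold minus, plus, opp, scal; simpl; unfold mult; simpl; ring. }
  split.
  - intros [_ h] e he.
    destruct (h x (fun P HP => HP) (mkposreal e he)) as [[d hd] h'].
    exists d. split; [exact hd |]. intros y Hy. rewrite <- E. exact (h' y Hy).
  - intros h. split. { apply is_linear_scal_l. }
    intros x0 Hx.
    apply (is_filter_lim_locally_unique (V := AbsRing_NormedModule R_AbsRing)) in Hx.
    subst x0. intros [e he]. destruct (h e he) as [d [hd h']].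
    exists (mkposreal d hd). intros y Hy. specialize (h' y Hy).
    rewrite <- E in h'. exact h'.
Qed.

Lemma im_le_Cmod (z : C) : Rabs (Im z) <= Cmod z.
Proof. eapply Rle_trans; [apply Rmax_r | apply (Rmax_Cmod z)]. Qed.

Lemma Cmod_le_Re_Im (z : C) : Cmod z <= Rabs (Re z) + Rabs (Im z).
Proof.
  replace z with (RtoC (Re z) + Ci * RtoC (Im z))%C at 1
    by (apply injective_projections; simpl; unfold Re, Im; ring).
  eapply Rle_trans; [apply Cmod_triangle |].
  rewrite Cmod_mult, !Cmod_R, Cmod_Ci. lra.
Qed.

Lemma Cmod_sym (z w : C) : Cmod (z - w) = Cmod (w - z).
Proof. rewrite <- Cmod_opp. f_equal. ring. Qed.

Lemma Cmod_triangle_sub (z w : C) : Cmod z <= Cmod w + Cmod (z - w).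
Proof.
  replace z with (w + (z - w))%C at 1 by ring. apply Cmod_triangle.
Qed.

Lemma Cmod_minus_le (z w : C) : Cmod (z - w) <= Cmod z + Cmod w.
Proof. unfold Cminus. rewrite <- (Cmod_opp w). apply Cmod_triangle. Qed.

Lemma rderiv_Re (f : R -> C) (x : R) (l : C) :
  rderiv f x l -> is_derive (fun y => Re (f y)) x (Re l).
Proof.
  intros h. apply is_derive_eps. intros e he. destruct (h e he) as [d [hd h']].
  exists d. split; [exact hd |]. intros y Hy.
  replace (Re (f y) - Re (f x) - Re l * (y - x))
    with (Re (f y - f x - l * RtoC (y - x))%C) by (simpl; unfold Re; ring).
  eapply Rle_trans; [apply re_le_Cmod | apply h', Hy].
Qed.

Lemma rderiv_Im (f : R -> C) (x : R) (l : C) :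
  rderiv f x l -> is_derive (fun y => Im (f y)) x (Im l).
Proof.
  intros h. apply is_derive_eps. intros e he. destruct (h e he) as [d [hd h']].
  exists d. split; [exact hd |]. intros y Hy.
  replace (Im (f y) - Im (f x) - Im l * (y - x))
    with (Im (f y - f x - l * RtoC (y - x))%C) by (simpl; unfold Im; ring).
  eapply Rle_trans; [apply im_le_Cmod | apply h', Hy].
Qed.

(** The mean value theorem is applied to the real and the imaginary part separately, hence the
    factor 2. *)
Lemma rmean (f df : R -> C) (M : R) :
  (forall x, 0 <= x <= 1 -> rderiv f x (df x)) ->
  (forall x, 0 <= x <= 1 -> Cmod (df x) <= M) ->
  Cmod (f 1 - f 0) <= 2 * M.
Proof.
  intros h hM.
  assert (A : forall (P : C -> R), (forall x, 0 <= x <= 1 ->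
            is_derive (fun y => P (f y)) x (P (df x))) ->
            (forall z, Rabs (P z) <= Cmod z) ->
            Rabs (P (f 1) - P (f 0)) <= M).
  { intros P hP hP2.
    destruct (MVT_gen (fun y => P (f y)) 0 1 (fun y => P (df y))) as [c [hc hc2]].
    - intros x. rewrite Rmin_left, Rmax_right by lra. intros; apply hP; lra.
    - intros x. rewrite Rmin_left, Rmax_right by lra. intros.
      apply continuity_pt_filterlim.
      apply (ex_derive_continuous (V := R_NormedModule) (fun y => P (f y))).
      eexists. apply hP; lra.
    - rewrite Rmin_left, Rmax_right in hc by lra. rewrite hc2.
      rewrite Rminus_0_r, Rmult_1_r.
      eapply Rle_trans; [apply hP2 | apply hM, hc]. }
  eapply Rle_trans; [apply Cmod_le_Re_Im |].
  assert (B1 := A Re (fun x hx => rderiv_Re _ _ _ (h x hx)) re_le_Cmod).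
  assert (B2 := A Im (fun x hx => rderiv_Im _ _ _ (h x hx)) im_le_Cmod).
  replace (Re (f 1 - f 0)%C) with (Re (f 1) - Re (f 0)) by reflexivity.
  replace (Im (f 1 - f 0)%C) with (Im (f 1) - Im (f 0)) by reflexivity.
  lra.
Qed.

Definition segpt (u v : C) (x : R) : C := (u + RtoC x * (v - u))%C.

Lemma cderiv_segment (H : C -> C) (u v a : C) (x : R) :
  cderiv H (segpt u v x) a ->
  rderiv (fun y => H (segpt u v y)) x (a * (v - u)).
Proof.
  intros h e he.
  set (K := Cmod (v - u) + 1).
  assert (hK : 0 < K) by (unfold K; generalize (Cmod_ge_0 (v - u)); lra).
  destruct (h (e / K) (Rdiv_lt_0_compat _ _ he hK)) as [d [hd h']].
  exists (d / K). split. { apply Rdiv_lt_0_compat; lra. }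
  intros y Hy.
  assert (E : (segpt u v y - segpt u v x = RtoC (y - x) * (v - u))%C).
  { unfold segpt. rewrite RtoC_minus. ring. }
  assert (B : Cmod (segpt u v y - segpt u v x) <= K * Rabs (y - x)).
  { rewrite E, Cmod_mult, Cmod_R. unfold K.
    generalize (Rabs_pos (y - x)). nra. }
  assert (B2 : Cmod (segpt u v y - segpt u v x) < d).
  { eapply Rle_lt_trans; [apply B |].
    apply (Rmult_lt_compat_l K) in Hy; [| exact hK].
    replace (K * (d / K)) with d in Hy by (field; lra). exact Hy. }
  specialize (h' _ B2). rewrite E in h' at 1.
  replace (a * (v - u) * RtoC (y - x))%C with (a * (RtoC (y - x) * (v - u)))%C by ring.
  eapply Rle_trans; [exact h' |].
  apply (Rmult_le_compat_l (e / K)) in B; [| apply Rlt_le, Rdiv_lt_0_compat; lra].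
  replace (e / K * (K * Rabs (y - x))) with (e * Rabs (y - x)) in B by (field; lra).
  exact B.
Qed.

Lemma segpt_0 u v : segpt u v 0 = u.
Proof. unfold segpt. ring. Qed.

Lemma segpt_1 u v : segpt u v 1 = v.
Proof. unfold segpt. ring. Qed.

Lemma segpt_ball (u v w : C) (d x : R) : 0 <= x <= 1 ->
  Cmod (u - w) < d -> Cmod (v - w) < d -> Cmod (segpt u v x - w) < d.
Proof.
  intros hx hu hv.
  replace (segpt u v x - w)%C with (RtoC (1 - x) * (u - w) + RtoC x * (v - w))%C
    by (unfold segpt; rewrite RtoC_minus; ring).
  eapply Rle_lt_trans; [apply Cmod_triangle |].
  rewrite !Cmod_mult, !Cmod_R, !Rabs_right by lra.
  destruct (Req_dec x 0); [subst; lra | nra].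
Qed.

Lemma cmean (H H' : C -> C) (u v : C) (M : R) :
  (forall x, 0 <= x <= 1 -> cderiv H (segpt u v x) (H' (segpt u v x))) ->
  (forall x, 0 <= x <= 1 -> Cmod (H' (segpt u v x)) <= M) ->
  Cmod (H v - H u) <= 2 * M * Cmod (v - u).
Proof.
  intros h hM.
  rewrite <- (segpt_1 u v) at 1. rewrite <- (segpt_0 u v) at 2.
  rewrite Rmult_assoc.
  apply (rmean (fun y => H (segpt u v y)) (fun y => (H' (segpt u v y) * (v - u))%C)).
  - intros x hx. apply cderiv_segment, h, hx.
  - intros x hx. rewrite Cmod_mult. apply Rmult_le_compat_r; [apply Cmod_ge_0 | apply hM, hx].
Qed.

(** * Strict derivatives *)

Definition cstrict (H : C -> C) (w a : C) : Prop :=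
  forall eps, 0 < eps -> exists d, 0 < d /\ forall w1 w2,
    Cmod (w1 - w) < d -> Cmod (w2 - w) < d ->
    Cmod (H w2 - H w1 - a * (w2 - w1)) <= eps * Cmod (w2 - w1).

(* Comparing two points [z1], [z2] near [z], but [s] only with [t]: this is what
   differentiation under the integral sign along moving paths needs, and it is
   stable under composition. *)
Definition sdiff (D : R -> Prop) (G : C -> R -> C) (z : C) (t : R) (a b : C) : Prop :=
  forall eps, 0 < eps -> exists d, 0 < d /\ forall z1 z2 s,
    Cmod (z1 - z) < d -> Cmod (z2 - z) < d -> D s -> Rabs (s - t) < d ->
    Cmod (G z2 s - G z1 t - a * (z2 - z1) - b * RtoC (s - t))
      <= eps * (Cmod (z2 - z1) + Rabs (s - t)).

(** Three choices of [D] occur: the interval [J], giving one-sided derivatives at its end points;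
    [fun _ => True], for an unrestricted real variable; and a single point, which freezes time and
    turns a joint statement into one about [z] alone. *)
Definition pderiv (D : R -> Prop) (mu : R -> C) (t : R) (b : C) : Prop :=
  forall eps, 0 < eps -> exists d, 0 < d /\ forall s, D s -> Rabs (s - t) < d ->
    Cmod (mu s - mu t - b * RtoC (s - t)) <= eps * Rabs (s - t).

Lemma cderiv_sub_linear (H : C -> C) (w a c : C) :
  cderiv H w a -> cderiv (fun v => (H v - c * v)%C) w (a - c)%C.
Proof.
  intros h e he. destruct (h e he) as [d [hd h']]. exists d. split; [exact hd |].
  intros y hy.
  replace (H y - c * y - (H w - c * w) - (a - c) * (y - w))%C
    with (H y - H w - a * (y - w))%C by ring.
  apply h', hy.
Qed.

(** The mean value inequality is applied to [H v - H' w * v], whose derivative is small near [w]. *)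
Lemma cstrict_of_cderiv (H H' : C -> C) (w : C) (r : R) : 0 < r ->
  (forall v, Cmod (v - w) < r -> cderiv H v (H' v)) ->
  (forall eps, 0 < eps -> exists d, 0 < d /\
     forall v, Cmod (v - w) < d -> Cmod (H' v - H' w) <= eps) ->
  cstrict H w (H' w).
Proof.
  intros hr h hc e he.
  destruct (hc (e / 2)) as [d [hd h']]; [lra |].
  exists (Rmin r d). split. { now apply Rmin_glb_lt. }
  intros w1 w2 h1 h2.
  replace (H w2 - H w1 - H' w * (w2 - w1))%C
    with ((H w2 - H' w * w2) - (H w1 - H' w * w1))%C by ring.
  replace e with (2 * (e / 2)) by field.
  assert (S : forall x, 0 <= x <= 1 -> Cmod (segpt w1 w2 x - w) < Rmin r d)
    by (intros; apply segpt_ball; assumption).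
  apply (cmean (fun v => (H v - H' w * v)%C) (fun v => (H' v - H' w)%C)).
  - intros x hx. apply cderiv_sub_linear, h.
    eapply Rlt_le_trans; [apply S, hx | apply Rmin_l].
  - intros x hx. apply h'.
    eapply Rlt_le_trans; [apply S, hx | apply Rmin_r].
Qed.

Lemma cstrict_cderiv (H : C -> C) (w a : C) : cstrict H w a -> cderiv H w a.
Proof.
  intros h e he. destruct (h e he) as [d [hd h']]. exists d. split; [exact hd |].
  intros y hy. apply h'; [| exact hy].
  replace (w - w)%C with (RtoC 0) by ring. rewrite Cmod_0. exact hd.
Qed.

Lemma Cmod_self (z : C) : Cmod (z - z) = 0.
Proof. replace (z - z)%C with (RtoC 0) by ring. apply Cmod_0. Qed.

Lemma sdiff_pderiv D G z t a b : sdiff D G z t a b -> pderiv D (G z) t b.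
Proof.
  intros h e he. destruct (h e he) as [d [hd h']]. exists d. split; [exact hd |].
  intros s hs hst. specialize (h' z z s).
  rewrite Cmod_self in h'. specialize (h' hd hd hs hst).
  replace (G z s - G z t - b * RtoC (s - t))%C
    with (G z s - G z t - a * (z - z) - b * RtoC (s - t))%C by ring.
  lra.
Qed.

Lemma sdiff_of_pderiv D mu z t b : pderiv D mu t b -> sdiff D (fun _ s => mu s) z t 0 b.
Proof.
  intros h e he. destruct (h e he) as [d [hd h']]. exists d. split; [exact hd |].
  intros z1 z2 s _ _ hs hst. specialize (h' s hs hst).
  replace (mu s - mu t - 0 * (z2 - z1) - b * RtoC (s - t))%C
    with (mu s - mu t - b * RtoC (s - t))%C by ring.
  generalize (Cmod_ge_0 (z2 - z1)). nra.
Qed.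

Lemma sdiff_cstrict (D : R -> Prop) G z t a b :
  D t -> sdiff D G z t a b -> cstrict (fun v => G v t) z a.
Proof.
  intros hD h e he. destruct (h e he) as [d [hd h']]. exists d. split; [exact hd |].
  intros w1 w2 h1 h2. specialize (h' w1 w2 t h1 h2 hD).
  rewrite Rminus_eq_0, Rabs_R0 in h'. specialize (h' hd).
  replace (G w2 t - G w1 t - a * (w2 - w1))%C
    with (G w2 t - G w1 t - a * (w2 - w1) - b * 0)%C by ring.
  lra.
Qed.

Lemma sdiff_of_cstrict D H z t a : cstrict H z a -> sdiff D (fun v _ => H v) z t a 0.
Proof.
  intros h e he. destruct (h e he) as [d [hd h']]. exists d. split; [exact hd |].
  intros z1 z2 s h1 h2 hs hst. specialize (h' z1 z2 h1 h2).
  replace (H z2 - H z1 - a * (z2 - z1) - 0 * RtoC (s - t))%C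
    with (H z2 - H z1 - a * (z2 - z1))%C by ring.
  generalize (Rabs_pos (s - t)). nra.
Qed.

Lemma pderiv_incl (D D' : R -> Prop) mu t b :
  (forall s, D' s -> D s) -> pderiv D mu t b -> pderiv D' mu t b.
Proof.
  intros hD h e he. destruct (h e he) as [d [hd h']]. exists d. split; [exact hd |].
  intros. apply h'; auto.
Qed.

Lemma sdiff_const D c z t : sdiff D (fun _ _ => c) z t 0 0.
Proof.
  intros e he. exists 1. split; [lra |]. intros.
  replace (c - c - 0 * (z2 - z1) - 0 * RtoC (s - t))%C with (RtoC 0) by ring.
  rewrite Cmod_0.
  generalize (Cmod_ge_0 (z2 - z1)), (Rabs_pos (s - t)). nra.
Qed.

Lemma sdiff_id D z t : sdiff D (fun v _ => v) z t 1 0.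
Proof.
  intros e he. exists 1. split; [lra |]. intros.
  replace (z2 - z1 - 1 * (z2 - z1) - 0 * RtoC (s - t))%C with (RtoC 0) by ring.
  rewrite Cmod_0.
  generalize (Cmod_ge_0 (z2 - z1)), (Rabs_pos (s - t)). nra.
Qed.

Lemma sdiff_plus D F G z t a b a' b' :
  sdiff D F z t a b -> sdiff D G z t a' b' ->
  sdiff D (fun v s => (F v s + G v s)%C) z t (a + a') (b + b').
Proof.
  intros h g e he.
  destruct (h (e / 2)) as [d [hd h']]; [lra |].
  destruct (g (e / 2)) as [d' [hd' g']]; [lra |].
  exists (Rmin d d'). split. { now apply Rmin_glb_lt. }
  intros z1 z2 s h1 h2 hs h3.
  pose_rmin.
  specialize (h' z1 z2 s ltac:(lra) ltac:(lra) hs ltac:(lra)).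
  specialize (g' z1 z2 s ltac:(lra) ltac:(lra) hs ltac:(lra)).
  replace (F z2 s + G z2 s - (F z1 t + G z1 t) - (a + a') * (z2 - z1)
           - (b + b') * RtoC (s - t))%C
    with ((F z2 s - F z1 t - a * (z2 - z1) - b * RtoC (s - t))
          + (G z2 s - G z1 t - a' * (z2 - z1) - b' * RtoC (s - t)))%C by ring.
  eapply Rle_trans; [apply Cmod_triangle | lra].
Qed.

Lemma sdiff_lip D G z t a b : sdiff D G z t a b ->
  exists d K, 0 < d /\ 0 < K /\ forall z1 z2 s,
    Cmod (z1 - z) < d -> Cmod (z2 - z) < d -> D s -> Rabs (s - t) < d ->
    Cmod (G z2 s - G z1 t) <= K * (Cmod (z2 - z1) + Rabs (s - t)).
Proof.
  intros h. destruct (h 1 Rlt_0_1) as [d [hd h']].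
  exists d, (1 + Cmod a + Cmod b). split; [exact hd |]. split.
  { generalize (Cmod_ge_0 a), (Cmod_ge_0 b). lra. }
  intros z1 z2 s h1 h2 hs h3. specialize (h' z1 z2 s h1 h2 hs h3).
  replace (G z2 s - G z1 t)%C
    with ((G z2 s - G z1 t - a * (z2 - z1) - b * RtoC (s - t))
          + (a * (z2 - z1) + b * RtoC (s - t)))%C by ring.
  eapply Rle_trans; [apply Cmod_triangle |].
  assert (T := Cmod_triangle (a * (z2 - z1)) (b * RtoC (s - t))).
  rewrite !Cmod_mult, Cmod_R in T.
  assert (P1 := Cmod_ge_0 a). assert (P2 := Cmod_ge_0 b).
  assert (P3 := Cmod_ge_0 (z2 - z1)). assert (P4 := Rabs_pos (s - t)).
  nra.
Qed.

Lemma sdiff_cont D G z t a b : sdiff D G z t a b ->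
  forall eps, 0 < eps -> exists d, 0 < d /\ forall z1 s,
    Cmod (z1 - z) < d -> D s -> Rabs (s - t) < d -> Cmod (G z1 s - G z t) < eps.
Proof.
  intros h e he. destruct (sdiff_lip _ _ _ _ _ _ h) as [d [K [hd [hK h']]]].
  assert (hq : 0 < e / (2 * K)) by (apply Rdiv_lt_0_compat; lra).
  exists (Rmin d (e / (2 * K))). split. { now apply Rmin_glb_lt. }
  intros z1 s h1 hs h3.
  pose_rmin.
  eapply Rle_lt_trans. { apply h'; try assumption; try lra. rewrite Cmod_self. lra. }
  assert (Q : K * (e / (2 * K)) = e / 2) by (field; lra).
  nra.
Qed.

(** Both arguments of the outer function move. The intended case is the reduced sigma function at
    [z - Z s] with half period [sd_m s], where the outer parameter is itself a function of time. *)
Lemma sdiff_comp (D D' : R -> Prop) H (mu : R -> R) G w m z t a b a' b' m' :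
  D t -> (forall s, D s -> D' (mu s)) -> G z t = w -> mu t = m ->
  sdiff D' H w m a b -> sdiff D G z t a' b' ->
  pderiv D (fun s => RtoC (mu s)) t (RtoC m') ->
  sdiff D (fun v s => H (G v s) (mu s)) z t (a * a') (a * b' + b * RtoC m').
Proof.
  intros hDt hDD hw hmt hH hG hm e he.
  destruct (sdiff_lip _ _ _ _ _ _ hG) as [d1 [K [hd1 [hK L]]]].
  destruct (sdiff_lip _ _ 0 _ _ _ (sdiff_of_pderiv _ _ 0 _ _ hm)) as [d2 [K2 [hd2 [hK2 L2]]]].
  assert (P1 := Cmod_ge_0 a). assert (P2 := Cmod_ge_0 b).
  set (A := 1 + Cmod a + Cmod b + K + K2).
  assert (hA : 0 < A) by (unfold A; lra).
  assert (he1 : 0 < e / (3 * A)) by (apply Rdiv_lt_0_compat; lra).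
  destruct (hG _ he1) as [d3 [hd3 G3]].
  destruct (hm _ he1) as [d4 [hd4 M4]].
  destruct (hH _ he1) as [d5 [hd5 H5]].
  assert (hd6 : 0 < d5 / (2 * A)) by (apply Rdiv_lt_0_compat; lra).
  set (d := Rmin (Rmin d1 d2) (Rmin (Rmin d3 d4) (d5 / (2 * A)))).
  assert (B : d <= d1 /\ d <= d2 /\ d <= d3 /\ d <= d4 /\ d <= d5 / (2 * A)).
  { unfold d. repeat split; rmin. }
  exists d. split. { unfold d. repeat apply Rmin_glb_lt; assumption. }
  destruct B as (B1 & B2 & B3 & B4 & B5).
  assert (Q5 : A * (d5 / (2 * A)) = d5 / 2) by (field; lra).
  intros z1 z2 s h1 h2 hs h3.
  assert (Lz : forall v s', Cmod (v - z) < d -> D s' -> Rabs (s' - t) < d ->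
               Cmod (G v s' - w) < d5).
  { intros v s' hv hs' hst. rewrite <- hw. eapply Rle_lt_trans.
    { apply L; try lra. rewrite Cmod_self; lra. exact hs'. }
    assert (hKA : K <= A) by (unfold A; lra).
    assert (N := Cmod_ge_0 (v - z)). assert (N' := Rabs_pos (s' - t)).
    apply Rle_lt_trans with (A * (Cmod (v - z) + Rabs (s' - t))); [nra |].
    apply Rlt_le_trans with (A * (2 * (d5 / (2 * A)))); [nra | lra]. }
  assert (hd0 : 0 < d) by (unfold d; repeat apply Rmin_glb_lt; assumption).
  assert (hm5 : Rabs (mu s - m) < d5 /\ Rabs (mu s - m) <= K2 * Rabs (s - t)).
  { specialize (L2 0%C 0%C s). rewrite Cmod_self in L2.
    specialize (L2 hd2 hd2 hs ltac:(lra)).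
    rewrite <- RtoC_minus, Cmod_R, Rplus_0_l, hmt in L2. split; [| exact L2].
    assert (hKA : K2 <= A) by (unfold A; lra).
    assert (N' := Rabs_pos (s - t)).
    apply Rle_lt_trans with (A * Rabs (s - t)); [nra |].
    apply Rlt_le_trans with (A * (d5 / (2 * A))); [nra | lra]. }
  destruct hm5 as [hm5 hm6].
  assert (E1 := H5 (G z1 t) (G z2 s) (mu s)
    (Lz z1 t h1 hDt ltac:(rewrite Rminus_eq_0, Rabs_R0; exact hd0))
    (Lz z2 s h2 hs h3) (hDD s hs) hm5).
  assert (E2 := G3 z1 z2 s ltac:(lra) ltac:(lra) hs ltac:(lra)).
  assert (E3 := M4 s hs ltac:(lra)).
  assert (E4 := L z1 z2 s ltac:(lra) ltac:(lra) hs ltac:(lra)).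
  rewrite hmt in E3 |- *.
  rewrite <- RtoC_minus in E3.
  assert (Pz := Cmod_ge_0 (z2 - z1)). assert (Ps := Rabs_pos (s - t)).
  set (u := Cmod (z2 - z1) + Rabs (s - t)) in *.
  set (e1 := e / (3 * A)) in *.
  replace (H (G z2 s) (mu s) - H (G z1 t) m - a * a' * (z2 - z1)
           - (a * b' + b * RtoC m') * RtoC (s - t))%C
    with ((H (G z2 s) (mu s) - H (G z1 t) m - a * (G z2 s - G z1 t) - b * RtoC (mu s - m))
          + (a * (G z2 s - G z1 t - a' * (z2 - z1) - b' * RtoC (s - t))
             + b * (RtoC (mu s - m) - RtoC m' * RtoC (s - t))))%C by ring.
  eapply Rle_trans; [apply Cmod_triangle |].
  assert (T := Cmod_triangle (a * (G z2 s - G z1 t - a' * (z2 - z1) - b' * RtoC (s - t)))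
     (b * (RtoC (mu s - m) - RtoC m' * RtoC (s - t)))).
  rewrite !Cmod_mult in T.
  assert (hu : 0 <= u) by (unfold u; lra).
  assert (X1 : Cmod (G z2 s - G z1 t) + Rabs (mu s - m) <= A * u).
  { assert (Rabs (s - t) <= u) by (unfold u; lra). unfold A. nra. }
  assert (X3 : Cmod b * Cmod (RtoC (mu s - m) - RtoC m' * RtoC (s - t)) <= A * (e1 * u)).
  { assert (Rabs (s - t) <= u) by (unfold u; lra).
    assert (Cmod b <= A) by (unfold A; lra).
    apply Rmult_le_compat; try apply Cmod_ge_0; try lra.
    eapply Rle_trans; [apply E3 |]. nra. }
  assert (X2 : Cmod a * Cmod (G z2 s - G z1 t - a' * (z2 - z1) - b' * RtoC (s - t))
               <= A * (e1 * u)).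
  { assert (Cmod a <= A) by (unfold A; lra).
    apply Rmult_le_compat; try apply Cmod_ge_0; lra. }
  assert (X4 : e1 * (Cmod (G z2 s - G z1 t) + Rabs (mu s - m)) <= A * (e1 * u)) by nra.
  assert (Q : A * (e1 * u) = e * u / 3) by (unfold e1; field; lra).
  lra.
Qed.

Lemma sdiff_comp_outer (D : R -> Prop) H G z t a a' b' :
  D t -> cstrict H (G z t) a -> sdiff D G z t a' b' ->
  sdiff D (fun v s => H (G v s)) z t (a * a') (a * b').
Proof.
  intros hD hH hG.
  replace (a * b')%C with (a * b' + 0 * RtoC 0)%C by ring.
  apply (sdiff_comp D (fun _ => True) (fun v _ => H v) (fun _ => 0) G (G z t) 0);
    try easy.
  - now apply sdiff_of_cstrict.
  - intros e he. exists 1. split; [lra |]. intros s _ _.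
    replace (RtoC 0 - RtoC 0 - RtoC 0 * RtoC (s - t))%C with (RtoC 0) by ring.
    rewrite Cmod_0. generalize (Rabs_pos (s - t)). nra.
Qed.

Lemma sdiff_eq D G z t a b a' b' :
  sdiff D G z t a b -> a = a' -> b = b' -> sdiff D G z t a' b'.
Proof. now intros h <- <-. Qed.

Lemma sdiff_ext D F G z t a b r : 0 < r -> D t ->
  (forall v s, Cmod (v - z) < r -> D s -> Rabs (s - t) < r -> F v s = G v s) ->
  sdiff D F z t a b -> sdiff D G z t a b.
Proof.
  intros hr hD hE h e he. destruct (h e he) as [d [hd h']].
  exists (Rmin d r). split. { now apply Rmin_glb_lt. }
  pose_rmin.
  intros z1 z2 s h1 h2 hs h3. rewrite <- !hE; try lra; try assumption.
  - apply h'; try lra; assumption.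
  - rewrite Rminus_eq_0, Rabs_R0. exact hr.
Qed.

Lemma cstrict_scal c w : cstrict (fun v => (c * v)%C) w c.
Proof.
  intros e he. exists 1. split; [lra |]. intros.
  replace (c * w2 - c * w1 - c * (w2 - w1))%C with (RtoC 0) by ring.
  rewrite Cmod_0. generalize (Cmod_ge_0 (w2 - w1)). nra.
Qed.

Lemma cstrict_square w : cstrict (fun v => (v * v)%C) w (2 * w)%C.
Proof.
  intros e he. exists (e / 2). split; [lra |]. intros.
  replace (w2 * w2 - w1 * w1 - 2 * w * (w2 - w1))%C
    with (((w2 - w) + (w1 - w)) * (w2 - w1))%C by ring.
  rewrite Cmod_mult. apply Rmult_le_compat_r; [apply Cmod_ge_0 |].
  eapply Rle_trans; [apply Cmod_triangle | lra].
Qed.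

Lemma cstrict_inv (w : C) : w <> 0%C -> cstrict Cinv w (- / (w * w))%C.
Proof.
  intros hw.
  assert (hm : 0 < Cmod w) by (apply Cmod_gt_0; exact hw).
  assert (hB : forall v, Cmod (v - w) < Cmod w / 2 -> Cmod w / 2 <= Cmod v).
  { intros v hv. assert (T := Cmod_triangle_sub w v). rewrite Cmod_sym in T. lra. }
  assert (hB2 : forall v, Cmod (v - w) < Cmod w / 2 -> v <> 0%C).
  { intros v hv. apply Cmod_gt_0. specialize (hB v hv). lra. }
  intros e he.
  set (m := Cmod w) in *.
  (* If both points are within [d] of [w], the numerator below is at most [3 * m * d] and the
     denominator at least [m ^ 4 / 4], so [d] of size [e * m ^ 3 / 16] suffices. *)
  assert (hq : 0 < e * (m * m * m / 16))
    by (assert (0 < m * m * m) by (repeat apply Rmult_lt_0_compat; lra);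
        apply Rmult_lt_0_compat; lra).
  exists (Rmin (m / 2) (e * (m * m * m / 16))). split.
  { apply Rmin_glb_lt; lra. }
  pose_rmin.
  intros w1 w2 h1 h2.
  assert (n1 := hB2 w1 ltac:(lra)). assert (n2 := hB2 w2 ltac:(lra)).
  assert (b1 := hB w1 ltac:(lra)). assert (b2 := hB w2 ltac:(lra)).
  replace (/ w2 - / w1 - - / (w * w) * (w2 - w1))%C
    with (((w2 - w) * w1 + w * (w1 - w)) / (w * w * w1 * w2) * (w2 - w1))%C
    by (field; auto).
  rewrite Cmod_mult. apply Rmult_le_compat_r; [apply Cmod_ge_0 |].
  rewrite Cmod_div by (repeat apply Cmult_neq_0; auto).
  rewrite !Cmod_mult. fold m.
  assert (T := Cmod_triangle ((w2 - w) * w1) (w * (w1 - w))).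
  rewrite !Cmod_mult in T. fold m in T.
  assert (T1 := Cmod_triangle_sub w1 w). fold m in T1.
  assert (p1 := Cmod_ge_0 (w1 - w)). assert (p2 := Cmod_ge_0 (w2 - w)).
  set (c1 := Cmod w1) in *. set (c2 := Cmod w2) in *.
  assert (hden : m * m * (m / 2) * (m / 2) <= m * m * c1 * c2).
  { apply Rmult_le_compat; nra. }
  apply Rle_div_l; [nra |].
  eapply Rle_trans; [apply T |].
  apply Rle_trans with (e * (m * m * m / 16) * (2 * m) + m * (e * (m * m * m / 16))).
  - apply Rplus_le_compat; [apply Rmult_le_compat; lra | apply Rmult_le_compat_l; lra].
  - apply Rle_trans with (e * (m * m * (m / 2) * (m / 2))).
    + assert (0 <= e * (m * m * m) * m) by (apply Rmult_le_pos; [|lra]; apply Rmult_le_pos; nra).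
      lra.
    + apply Rmult_le_compat_l; lra.
Qed.

Lemma sdiff_scal (D : R -> Prop) c G z t a b : D t -> sdiff D G z t a b ->
  sdiff D (fun v s => (c * G v s)%C) z t (c * a) (c * b).
Proof.
  intros hD h. apply (sdiff_comp_outer D (fun v => (c * v)%C)); auto.
  apply cstrict_scal.
Qed.

Lemma sdiff_minus (D : R -> Prop) F G z t a b a' b' : D t ->
  sdiff D F z t a b -> sdiff D G z t a' b' ->
  sdiff D (fun v s => (F v s - G v s)%C) z t (a - a') (b - b').
Proof.
  intros hD h g.
  assert (X := sdiff_plus _ _ _ _ _ _ _ _ _ h (sdiff_scal D (-(1))%C _ _ _ _ _ hD g)).
  refine (sdiff_ext D _ _ z t _ _ 1 Rlt_0_1 hD _ (sdiff_eq _ _ _ _ _ _ _ _ X _ _));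
    intros; ring.
Qed.

(** Polarization, [F G = ((F + G)^2 - (F - G)^2) / 4], reduces the product rule to the chain rule
    with the square as outer function. *)
Lemma sdiff_mult (D : R -> Prop) F G z t a b a' b' : D t ->
  sdiff D F z t a b -> sdiff D G z t a' b' ->
  sdiff D (fun v s => (F v s * G v s)%C) z t (a * G z t + F z t * a') (b * G z t + F z t * b').
Proof.
  intros hD h g.
  assert (P := sdiff_comp_outer D _ _ _ _ _ _ _ hD (cstrict_square _)
     (sdiff_plus _ _ _ _ _ _ _ _ _ h g)).
  assert (M := sdiff_comp_outer D _ _ _ _ _ _ _ hD (cstrict_square _)
     (sdiff_minus _ _ _ _ _ _ _ _ _ hD h g)).
  assert (X := sdiff_scal D (/ 4)%C _ _ _ _ _ hD (sdiff_minus _ _ _ _ _ _ _ _ _ hD P M)).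
  cbv beta in X.
  refine (sdiff_ext D _ _ z t _ _ 1 Rlt_0_1 hD _ (sdiff_eq _ _ _ _ _ _ _ _ X _ _));
    intros; field.
Qed.

Lemma sdiff_inv (D : R -> Prop) (G : C -> R -> C) z t a b : D t -> G z t <> 0%C ->
  sdiff D G z t a b ->
  sdiff D (fun v s => (/ G v s)%C) z t (- a / (G z t * G z t)) (- b / (G z t * G z t)).
Proof.
  intros hD h0 h.
  eapply sdiff_eq.
  - apply (sdiff_comp_outer D Cinv); eauto. apply cstrict_inv, h0.
  - field. exact h0.
  - field. exact h0.
Qed.

Lemma sdiff_nonzero D (G : C -> R -> C) z t a b : sdiff D G z t a b -> G z t <> 0%C ->
  exists d, 0 < d /\ forall z1 s, Cmod (z1 - z) < d -> D s -> Rabs (s - t) < d ->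
    Cmod (G z t) / 2 < Cmod (G z1 s).
Proof.
  intros h h0. assert (hm : 0 < Cmod (G z t)) by (apply Cmod_gt_0; exact h0).
  destruct (sdiff_cont _ _ _ _ _ _ h (Cmod (G z t) / 2)) as [d [hd h']]; [lra |].
  exists d. split; [exact hd |]. intros z1 s h1 hs h3. specialize (h' z1 s h1 hs h3).
  assert (T := Cmod_triangle_sub (G z t) (G z1 s)). rewrite Cmod_sym in T. lra.
Qed.

Lemma pderiv_linear D (c0 c1 : C) t : pderiv D (fun s => (c0 + c1 * RtoC s)%C) t c1.
Proof.
  intros e he. exists 1. split; [lra |]. intros s _ _.
  replace (c0 + c1 * RtoC s - (c0 + c1 * RtoC t) - c1 * RtoC (s - t))%C with (RtoC 0)
    by (rewrite RtoC_minus; ring).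
  rewrite Cmod_0. generalize (Rabs_pos (s - t)). nra.
Qed.

(** * The complex exponential *)

Lemma Cexp_plus z w : Cexp (z + w) = (Cexp z * Cexp w)%C.
Proof.
  unfold Cexp. destruct z as [x y], w as [u v]. unfold Re, Im; simpl.
  rewrite exp_plus, cos_plus, sin_plus.
  apply injective_projections; simpl; ring.
Qed.

Lemma Cexp_0 : Cexp 0 = 1%C.
Proof. unfold Cexp, Re, Im; simpl. rewrite exp_0, cos_0, sin_0. unfold RtoC. f_equal; ring. Qed.

Lemma Cmod_Cexp z : Cmod (Cexp z) = exp (Re z).
Proof.
  unfold Cmod, Cexp; simpl.
  replace (_ + _) with (exp (Re z) * exp (Re z)).
  - apply sqrt_square, Rlt_le, exp_pos.
  - rewrite !Rmult_1_r. set (e := exp (Re z)).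
    replace (e * cos (Im z) * (e * cos (Im z)) + e * sin (Im z) * (e * sin (Im z)))
      with (e * e * (Rsqr (sin (Im z)) + Rsqr (cos (Im z)))) by (unfold Rsqr; ring).
    rewrite sin2_cos2. ring.
Qed.

Lemma Cexp_neq_0 z : Cexp z <> 0%C.
Proof. apply Cmod_gt_0. rewrite Cmod_Cexp. apply exp_pos. Qed.

Lemma Cexp_minus z w : Cexp (z - w) = (Cexp z / Cexp w)%C.
Proof.
  replace z with ((z - w) + w)%C at 2 by ring. rewrite Cexp_plus.
  field. apply Cexp_neq_0.
Qed.

Lemma Cexp_cderiv_0 : cderiv Cexp 0 1.
Proof.
  intros e he.
  assert (H1 : is_derive exp 0 1) by (auto_derive; [auto | rewrite exp_0; ring]).
  assert (H2 : is_derive cos 0 0) by (auto_derive; [auto | rewrite sin_0; ring]).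
  assert (H3 : is_derive sin 0 1) by (auto_derive; [auto | rewrite cos_0; ring]).
  set (q := Rmin (e / 20) 1).
  assert (hq : 0 < q) by (apply Rmin_glb_lt; lra).
  assert (hq1 : q <= 1) by apply Rmin_r.
  assert (hq2 : q <= e / 20) by apply Rmin_l.
  destruct (proj1 (is_derive_eps _ _ _) H1 q hq) as [d1 [h1 E1]].
  destruct (proj1 (is_derive_eps _ _ _) H2 q hq) as [d2 [h2 E2]].
  destruct (proj1 (is_derive_eps _ _ _) H3 q hq) as [d3 [h3 E3]].
  set (d := Rmin (Rmin d1 d2) (Rmin d3 (q / 4))).
  assert (B : d <= d1 /\ d <= d2 /\ d <= d3 /\ d <= q / 4).
  { unfold d. repeat split; rmin. }
  exists d. split. { unfold d. repeat apply Rmin_glb_lt; lra. }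
  intros [x y]. replace ((x, y) - 0)%C with (x, y) by (apply injective_projections; simpl; ring).
  intros hxy.
  assert (hx := re_le_Cmod (x, y)). assert (hy := im_le_Cmod (x, y)).
  unfold Re, Im in hx, hy; simpl in hx, hy.
  set (c := Cmod (x, y)) in *.
  specialize (E1 x). specialize (E2 y). specialize (E3 y).
  rewrite !Rminus_0_r in *. rewrite exp_0 in E1. rewrite cos_0 in E2. rewrite sin_0 in E3.
  specialize (E1 ltac:(lra)). specialize (E2 ltac:(lra)). specialize (E3 ltac:(lra)).
  rewrite Cexp_0.
  eapply Rle_trans; [apply Cmod_le_Re_Im |].
  unfold Cexp, Re, Im; simpl.
  replace (exp x * cos y + - (1) + - (1 * x - 0 * y))
    with ((exp x - 1 - 1 * x) + exp x * (cos y - 1)) by ring.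
  replace (exp x * sin y + - 0 + - (1 * y + 0 * x))
    with (exp x * (sin y - 0 - 1 * y) + (exp x - 1) * y) by ring.
  assert (p1 := Rabs_pos x). assert (p2 := Rabs_pos y).
  assert (hE : Rabs (exp x - 1) <= 2 * Rabs x).
  { replace (exp x - 1) with ((exp x - 1 - 1 * x) + x) by ring.
    eapply Rle_trans; [apply Rabs_triang |]. nra. }
  assert (hE2 : Rabs (exp x) <= 2).
  { replace (exp x) with ((exp x - 1) + 1) by ring.
    eapply Rle_trans; [apply Rabs_triang |]. rewrite Rabs_R1. lra. }
  assert (hc1 : Rabs (cos y - 1) <= q * Rabs y).
  { replace (cos y - 1) with (cos y - 1 - 0 * y) by ring. exact E2. }
  assert (hc : 0 <= c) by apply Cmod_ge_0.
  assert (X1 : Rabs (exp x - 1 - 1 * x + exp x * (cos y - 1)) <= q * c + 2 * (q * c)).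
  { eapply Rle_trans; [apply Rabs_triang |]. rewrite Rabs_mult.
    apply Rplus_le_compat; [nra |].
    apply Rmult_le_compat; try apply Rabs_pos; [lra | nra]. }
  assert (X2 : Rabs (exp x * (sin y - 0 - 1 * y) + (exp x - 1) * y) <= 2 * (q * c) + q * c).
  { eapply Rle_trans; [apply Rabs_triang |]. rewrite !Rabs_mult.
    apply Rplus_le_compat.
    - apply Rmult_le_compat; try apply Rabs_pos; [lra | nra].
    - apply Rmult_le_compat; try apply Rabs_pos; lra. }
  nra.
Qed.

Lemma Cexp_cderiv w : cderiv Cexp w (Cexp w).
Proof.
  intros e he.
  assert (hm : 0 < Cmod (Cexp w)) by (apply Cmod_gt_0, Cexp_neq_0).
  destruct (Cexp_cderiv_0 (e / Cmod (Cexp w))) as [d [hd h]].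
  { now apply Rdiv_lt_0_compat. }
  exists d. split; [exact hd |]. intros w' hw.
  specialize (h (w' - w)%C). rewrite Cexp_0 in h.
  replace (w' - w - 0)%C with (w' - w)%C in h by ring. specialize (h hw).
  replace (Cexp w') with (Cexp w * Cexp (w' - w))%C
    by (rewrite <- Cexp_plus; f_equal; ring).
  replace (Cexp w * Cexp (w' - w) - Cexp w - Cexp w * (w' - w))%C
    with (Cexp w * (Cexp (w' - w) - 1 - 1 * (w' - w)))%C by ring.
  rewrite Cmod_mult. apply (Rmult_le_compat_l (Cmod (Cexp w))) in h; [| lra].
  replace (e * Cmod (w' - w))
    with (Cmod (Cexp w) * (e / Cmod (Cexp w) * Cmod (w' - w))) by (field; lra).
  exact h.
Qed.

Lemma cderiv_cont H w a : cderiv H w a ->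
  forall eps, 0 < eps -> exists d, 0 < d /\
    forall v, Cmod (v - w) < d -> Cmod (H v - H w) <= eps.
Proof.
  intros h e he. destruct (h 1 Rlt_0_1) as [d [hd h']].
  assert (P := Cmod_ge_0 a).
  assert (hq : 0 < e / (1 + Cmod a)) by (apply Rdiv_lt_0_compat; lra).
  exists (Rmin d (e / (1 + Cmod a))). split. { now apply Rmin_glb_lt. }
  pose_rmin.
  intros v hv. specialize (h' v ltac:(lra)).
  replace (H v - H w)%C with ((H v - H w - a * (v - w)) + a * (v - w))%C by ring.
  eapply Rle_trans; [apply Cmod_triangle |]. rewrite Cmod_mult.
  assert (Q : (1 + Cmod a) * (e / (1 + Cmod a)) = e) by (field; lra).
  nra.
Qed.

Lemma Cexp_cstrict w : cstrict Cexp w (Cexp w).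
Proof.
  apply (cstrict_of_cderiv Cexp Cexp w 1); [lra | |].
  - intros. apply Cexp_cderiv.
  - apply (cderiv_cont Cexp w (Cexp w)), Cexp_cderiv.
Qed.

(* Differentiability of a local logarithm, without choosing a branch. *)
Lemma Cexp_log_estimate eps : 0 < eps -> exists d, 0 < d /\
  forall a0 a, Cmod (a - a0) < d ->
    Cmod (a - a0 - (Cexp a - Cexp a0) / Cexp a0)
      <= eps * Cmod ((Cexp a - Cexp a0) / Cexp a0).
Proof.
  intros he.
  set (q := Rmin (eps / 2) (1 / 2)).
  assert (hq : 0 < q) by (apply Rmin_glb_lt; lra).
  assert (hq1 : q <= eps / 2) by apply Rmin_l.
  assert (hq2 : q <= 1 / 2) by apply Rmin_r.
  destruct (Cexp_cderiv_0 q hq) as [d [hd h]].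
  exists d. split; [exact hd |]. intros a0 a ha.
  specialize (h (a - a0)%C). rewrite Cexp_0 in h.
  replace (a - a0 - 0)%C with (a - a0)%C in h by ring. specialize (h ha).
  replace ((Cexp a - Cexp a0) / Cexp a0)%C with (Cexp (a - a0) - 1)%C
    by (rewrite Cexp_minus; field; apply Cexp_neq_0).
  set (E := (Cexp (a - a0) - 1)%C) in *.
  set (dl := (a - a0)%C) in *.
  replace (E - 1 * dl)%C with (E - dl)%C in h by ring.
  rewrite Cmod_sym.
  assert (T := Cmod_triangle_sub dl E). rewrite Cmod_sym in T.
  generalize (Cmod_ge_0 dl), (Cmod_ge_0 E). intros.
  assert (Cmod dl <= 2 * Cmod E) by nra. nra.
Qed.

(** The angle is [acos] of the normalized real part, with the sign of the imaginary part. It is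
    confined to a compact interval so that continuity in the angle gives bounds on whole circles. *)
Lemma polar_exists_pi (z : C) : exists phi, - PI <= phi <= PI /\ z = polar (Cmod z) phi.
Proof.
  assert (hpi := PI_RGT_0).
  destruct (Ceq_dec z 0) as [-> | h0].
  { exists 0. split; [lra |]. rewrite Cmod_0. unfold polar, RtoC. f_equal; ring. }
  assert (hm : 0 < Cmod z) by (apply Cmod_gt_0; exact h0).
  assert (h2 := Cmod2_alt z).
  set (c := Re z / Cmod z).
  assert (hc : -1 <= c <= 1).
  { assert (h := re_le_Cmod z). apply Rabs_le_between in h. unfold c.
    split; [apply Rle_div_r | apply Rle_div_l]; lra. }
  assert (E : Rsqr (Im z / Cmod z) = 1 - c * c).
  { unfold c, Rsqr. field_simplify; [| lra | lra].
    replace (Im z ^ 2) with (Cmod z ^ 2 - Re z ^ 2) by lra. field. lra. }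
  assert (S : sin (acos c) = Rabs (Im z) / Cmod z).
  { rewrite sin_acos by exact hc. unfold Rsqr. rewrite <- E, sqrt_Rsqr_abs.
    unfold Rdiv. rewrite Rabs_mult. f_equal. apply Rabs_right.
    apply Rle_ge, Rlt_le, Rinv_0_lt_compat, hm. }
  destruct (Rle_dec 0 (Im z)) as [p | n].
  - assert (B := acos_bound c). exists (acos c). split; [lra |]. unfold polar. rewrite cos_acos by exact hc. rewrite S.
    rewrite Rabs_right by lra.
    apply injective_projections; simpl; unfold c, Re, Im; field; lra.
  - assert (B := acos_bound c). exists (- acos c). split; [lra |]. unfold polar. rewrite cos_neg, sin_neg, cos_acos by exact hc.
    rewrite S. rewrite Rabs_left by lra.
    apply injective_projections; simpl; unfold c, Re, Im; field; lra.
Qed.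

Lemma Cexp_surj (z : C) : z <> 0%C -> exists w, Cexp w = z.
Proof.
  intros h0. assert (hm : 0 < Cmod z) by (apply Cmod_gt_0; exact h0).
  destruct (polar_exists_pi z) as [phi [_ hphi]].
  exists (ln (Cmod z), phi). rewrite hphi at 2. unfold Cexp, polar, Re, Im; simpl.
  now rewrite exp_ln.
Qed.

(** * Limits of strictly differentiable functions *)

(** Real and imaginary parts are Cauchy with rate [K / INR N], and the two errors add up. Since
    [Clim_seq] is total, convergence has to be established before its value means anything. *)
Lemma Clim_seq_estimate (Q : nat -> C) (K : R) :
  (forall N M, (1 <= N <= M)%nat -> Cmod (Q M - Q N) <= K / INR N) ->
  forall N, (1 <= N)%nat -> Cmod (Clim_seq Q - Q N) <= 2 * K / INR N.
Proof.
  intros h.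
  assert (hK : 0 <= K).
  { specialize (h 1%nat 1%nat ltac:(lia)). rewrite Cmod_self in h. simpl in h. lra. }
  assert (A : forall P : C -> R, (forall z, Rabs (P z) <= Cmod z) ->
     (forall z w, P (z - w)%C = P z - P w) ->
     forall N, (1 <= N)%nat -> Rabs (real (Lim_seq (fun n => P (Q n))) - P (Q N)) <= K / INR N).
  { intros P hP hP2 N hN.
    assert (E : ex_finite_lim_seq (fun n => P (Q n))).
    { apply ex_lim_seq_cauchy_corr. intros [e he].
      destruct (archimed_cor1 (e / (2 * K + 1))) as [n0 [hn0 hn1]].
      { apply Rdiv_lt_0_compat; lra. }
      exists n0. simpl.
      assert (hi : 0 < INR n0) by (apply lt_0_INR; exact hn1).
      assert (hb : K / INR n0 < e / 2).
      { unfold Rdiv at 1. apply Rle_lt_trans with (K * (e / (2 * K + 1))).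
        - apply Rmult_le_compat_l; lra.
        - replace (K * (e / (2 * K + 1))) with (e / 2 * (2 * K / (2 * K + 1))) by (field; lra).
          assert (2 * K / (2 * K + 1) < 1) by (apply Rlt_div_l; lra). nra. }
      intros n m hn hm. rewrite <- hP2.
      eapply Rle_lt_trans; [apply hP |].
      replace (Q n - Q m)%C with ((Q n - Q n0) - (Q m - Q n0))%C by ring.
      eapply Rle_lt_trans; [apply Cmod_minus_le |].
      assert (X := h n0 n ltac:(lia)). assert (Y := h n0 m ltac:(lia)). lra. }
    assert (L : is_lim_seq (fun n => P (Q n)) (real (Lim_seq (fun n => P (Q n))))).
    { apply Lim_seq_correct'. exact E. }
    set (l := real _) in *.
    assert (L2 : is_lim_seq (fun n => Rabs (P (Q n) - P (Q N))) (Rabs (l - P (Q N)))).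
    { apply (is_lim_seq_abs _ (l - P (Q N))).
      apply is_lim_seq_minus'; [exact L | apply is_lim_seq_const]. }
    apply (is_lim_seq_le_loc (fun n => Rabs (P (Q n) - P (Q N))) (fun _ => K / INR N)
             (Rabs (l - P (Q N))) (K / INR N)).
    - exists N. intros n hn. rewrite <- hP2. eapply Rle_trans; [apply hP |].
      apply h. lia.
    - exact L2.
    - apply is_lim_seq_const. }
  intros N hN.
  eapply Rle_trans; [apply Cmod_le_Re_Im |].
  assert (B1 := A Re re_le_Cmod ltac:(reflexivity) N hN).
  assert (B2 := A Im im_le_Cmod ltac:(reflexivity) N hN).
  replace (Re (Clim_seq Q - Q N)) with (real (Lim_seq (fun n => Re (Q n))) - Re (Q N))
    by reflexivity.
  replace (Im (Clim_seq Q - Q N)) with (real (Lim_seq (fun n => Im (Q n))) - Im (Q N))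
    by reflexivity.
  unfold Rdiv in *. lra.
Qed.

Lemma Clim_seq_unique (Q : nat -> C) (l : C) :
  (forall eps, 0 < eps -> exists N, forall n, (N <= n)%nat -> Cmod (Q n - l) < eps) ->
  Clim_seq Q = l.
Proof.
  intros h.
  assert (A : forall P : C -> R, (forall z, Rabs (P z) <= Cmod z) ->
     (forall z w, P (z - w)%C = P z - P w) -> real (Lim_seq (fun n => P (Q n))) = P l).
  { intros P hP hP2.
    assert (L : is_lim_seq (fun n => P (Q n)) (P l)).
    { apply is_lim_seq_spec. intros [e he]. destruct (h e he) as [N hN].
      exists N. intros n hn. rewrite <- hP2. eapply Rle_lt_trans; [apply hP | apply hN, hn]. }
    apply is_lim_seq_unique in L. now rewrite L. }
  unfold Clim_seq. rewrite (A Re re_le_Cmod ltac:(reflexivity)).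
  rewrite (A Im im_le_Cmod ltac:(reflexivity)). now destruct l.
Qed.

(** Under this condition a derivative relative to [D] at [t] is unique. *)
Definition accum (D : R -> Prop) (t : R) : Prop :=
  forall d, 0 < d -> exists s, D s /\ s <> t /\ Rabs (s - t) < d.

(** A Lipschitz constant of [F - G] at the base point bounds its derivatives: test it with an
    increment of [z] alone, then with an increment of time alone, the latter supplied by [accum]. *)
Lemma sdiff_deriv_close (D : R -> Prop) F G z t a b a' b' K r :
  D t -> accum D t -> 0 < r ->
  sdiff D F z t a b -> sdiff D G z t a' b' ->
  (forall z1 s, Cmod (z1 - z) < r -> D s -> Rabs (s - t) < r ->
    Cmod ((F z1 s - G z1 s) - (F z t - G z t))
      <= K * (Cmod (z1 - z) + Rabs (s - t))) ->
  Cmod (a - a') <= K /\ Cmod (b - b') <= K.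
Proof.
  intros hD hac hr hF hG hK.
  assert (S := sdiff_minus _ _ _ _ _ _ _ _ _ hD hF hG).
  split; apply le_epsilon; intros e he; destruct (S e he) as [d [hd S']];
    set (q := Rmin d r) in *;
    assert (hq : 0 < q) by (apply Rmin_glb_lt; assumption);
    assert (q1 : q <= d) by apply Rmin_l; assert (q2 : q <= r) by apply Rmin_r.
  - set (z1 := (z + RtoC (q / 2))%C).
    assert (E : (z1 - z)%C = RtoC (q / 2)) by (unfold z1; ring).
    assert (E2 : Cmod (z1 - z) = q / 2) by (rewrite E, Cmod_R; apply Rabs_right; lra).
    specialize (S' z z1 t). specialize (hK z1 t).
    rewrite Cmod_self, Rminus_eq_0, Rabs_R0, E2 in *.
    specialize (S' hd ltac:(lra) hD hd). specialize (hK ltac:(lra) hD hr).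
    apply Rmult_le_reg_r with (q / 2); [lra |].
    replace (Cmod (a - a') * (q / 2)) with (Cmod ((a - a') * (z1 - z)))
      by (rewrite Cmod_mult, E2; ring).
    replace ((a - a') * (z1 - z))%C with
      ((F z1 t - G z1 t - (F z t - G z t)) -
       (F z1 t - G z1 t - (F z t - G z t) - (a - a') * (z1 - z) - (b - b') * 0))%C by ring.
    eapply Rle_trans; [apply Cmod_minus_le |]. lra.
  - destruct (hac q hq) as [s [hs [hne hst]]].
    specialize (S' z z s). specialize (hK z s).
    rewrite Cmod_self in *.
    specialize (S' hd hd hs ltac:(lra)). specialize (hK hr hs ltac:(lra)).
    assert (hp : 0 < Rabs (s - t)) by (apply Rabs_pos_lt; lra).
    apply Rmult_le_reg_r with (Rabs (s - t)); [lra |].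
    replace (Cmod (b - b') * Rabs (s - t)) with (Cmod ((b - b') * RtoC (s - t)))
      by (rewrite Cmod_mult, Cmod_R; ring).
    replace ((b - b') * RtoC (s - t))%C with
      ((F z s - G z s - (F z t - G z t)) -
       (F z s - G z s - (F z t - G z t) - (a - a') * (z - z) - (b - b') * RtoC (s - t)))%C by ring.
    eapply Rle_trans; [apply Cmod_minus_le |]. lra.
Qed.

Definition sdiffable D F z t : Prop := exists a b, sdiff D F z t a b.

(** The remainders [S - Q N] have Lipschitz constants [K / INR N]. This alone makes the derivatives
    of the [Q N] a Cauchy sequence, by [sdiff_deriv_close], and identifies its limit as the
    derivative of [S]. *)
Lemma sdiffable_limit (D : R -> Prop) (Q : nat -> C -> R -> C) S z t K r :
  D t -> accum D t -> 0 < r ->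
  (forall N, sdiffable D (Q N) z t) ->
  (forall N z1 z2 s1 s2, (1 <= N)%nat -> Cmod (z1 - z) < r -> Cmod (z2 - z) < r ->
     D s1 -> D s2 -> Rabs (s1 - t) < r -> Rabs (s2 - t) < r ->
     Cmod ((S z2 s2 - Q N z2 s2) - (S z1 s1 - Q N z1 s1))
       <= K / INR N * (Cmod (z2 - z1) + Rabs (s2 - s1))) ->
  sdiffable D S z t.
Proof.
  intros hD hac hr hQ hL.
  assert (hc : exists ab : nat -> C * C, forall N, sdiff D (Q N) z t (fst (ab N)) (snd (ab N))).
  { exists (fun N => epsilon (inhabits (RtoC 0, RtoC 0))
                    (fun ab => sdiff D (Q N) z t (fst ab) (snd ab))).
    intros N. apply epsilon_spec. destruct (hQ N) as [a [b h]]. now exists (a, b). }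
  destruct hc as [ab hab].
  assert (hK : 0 <= K).
  { specialize (hL 1%nat z (z + RtoC (r / 2))%C t t (le_n _)).
    assert (E : (z + RtoC (r / 2) - z)%C = RtoC (r / 2)) by ring.
    rewrite Cmod_self, E, Cmod_R, Rminus_eq_0, Rabs_R0, Rabs_right in hL by lra.
    specialize (hL hr ltac:(lra) hD hD hr hr).
    assert (X := Cmod_ge_0 (S (z + RtoC (r / 2)) t - Q 1%nat (z + RtoC (r / 2)) t
                  - (S z t - Q 1%nat z t))%C).
    simpl in hL. nra. }
  assert (hcl : forall N M, (1 <= N <= M)%nat ->
     Cmod (fst (ab M) - fst (ab N)) <= 2 * K / INR N /\
     Cmod (snd (ab M) - snd (ab N)) <= 2 * K / INR N).
  { intros N M hNM.
    assert (hN : 0 < INR N) by (apply lt_0_INR; lia).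
    assert (hMN : INR N <= INR M) by (apply le_INR; lia).
    apply (sdiff_deriv_close D (Q M) (Q N) z t _ _ _ _ _ r hD hac hr (hab M) (hab N)).
    intros z1 s h1 hs h3.
    assert (X := hL N z z1 t s ltac:(lia)). assert (Y := hL M z z1 t s ltac:(lia)).
    rewrite Cmod_self, Rminus_eq_0, Rabs_R0 in X, Y.
    specialize (X hr h1 hD hs hr h3). specialize (Y hr h1 hD hs hr h3).
    replace (Q M z1 s - Q N z1 s - (Q M z t - Q N z t))%C
      with ((S z1 s - Q N z1 s - (S z t - Q N z t)) - (S z1 s - Q M z1 s - (S z t - Q M z t)))%C
      by ring.
    eapply Rle_trans; [apply Cmod_minus_le |].
    assert (hi : K / INR M <= K / INR N).
    { unfold Rdiv. apply Rmult_le_compat_l; [exact hK | apply Rinv_le_contravar; lra]. }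
    assert (P := Cmod_ge_0 (z1 - z)). assert (P' := Rabs_pos (s - t)).
    replace (2 * K / INR N) with (K / INR N + K / INR N) by (field; lra). nra. }
  set (a := Clim_seq (fun N => fst (ab N))).
  set (b := Clim_seq (fun N => snd (ab N))).
  assert (ha := Clim_seq_estimate (fun N => fst (ab N)) (2 * K) (fun N M h => proj1 (hcl N M h))).
  assert (hb := Clim_seq_estimate (fun N => snd (ab N)) (2 * K) (fun N M h => proj2 (hcl N M h))).
  fold a in ha. fold b in hb.
  exists a, b. intros e he.
  destruct (archimed_cor1 (e / (18 * K + 1))) as [N [hN hN1]].
  { apply Rdiv_lt_0_compat; lra. }
  assert (hi : 0 < INR N) by (apply lt_0_INR; exact hN1).
  (* One unit of [K / INR N] comes from the Lipschitz remainder and four from each of the two limits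
     of derivatives. *)
  assert (hKN : 9 * (K / INR N) <= e / 2).
  { unfold Rdiv at 1. apply Rle_trans with (9 * (K * (e / (18 * K + 1)))).
    - apply Rmult_le_compat_l; [lra |]. apply Rmult_le_compat_l; lra.
    - replace (9 * (K * (e / (18 * K + 1)))) with (e / 2 * (18 * K / (18 * K + 1))) by (field; lra).
      assert (18 * K / (18 * K + 1) < 1) by (apply Rlt_div_l; lra). nra. }
  destruct (hab N (e / 2)) as [d [hd h]]; [lra |].
  exists (Rmin d r). split. { now apply Rmin_glb_lt. }
  pose_rmin.
  intros z1 z2 s h1 h2 hs h3.
  specialize (h z1 z2 s ltac:(lra) ltac:(lra) hs ltac:(lra)).
  assert (X := hL N z1 z2 t s hN1 ltac:(lra) ltac:(lra) hD hs).
  rewrite Rminus_eq_0, Rabs_R0 in X. specialize (X hr ltac:(lra)).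
  specialize (ha N hN1). specialize (hb N hN1).
  replace (S z2 s - S z1 t - a * (z2 - z1) - b * RtoC (s - t))%C
    with ((S z2 s - Q N z2 s - (S z1 t - Q N z1 t))
          + (Q N z2 s - Q N z1 t - fst (ab N) * (z2 - z1) - snd (ab N) * RtoC (s - t))
          - ((a - fst (ab N)) * (z2 - z1) + (b - snd (ab N)) * RtoC (s - t)))%C by ring.
  eapply Rle_trans; [apply Cmod_minus_le |].
  assert (T1 := Cmod_triangle (S z2 s - Q N z2 s - (S z1 t - Q N z1 t))
    (Q N z2 s - Q N z1 t - fst (ab N) * (z2 - z1) - snd (ab N) * RtoC (s - t))).
  assert (T2 := Cmod_triangle ((a - fst (ab N)) * (z2 - z1)) ((b - snd (ab N)) * RtoC (s - t))).
  rewrite !Cmod_mult, Cmod_R in T2.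
  assert (P := Cmod_ge_0 (z2 - z1)). assert (P' := Rabs_pos (s - t)).
  replace (2 * (2 * K) / INR N) with (4 * (K / INR N)) in ha, hb by (field; lra).
  set (k := K / INR N) in *. nra.
Qed.

(** * The Weierstrass product *)

(* Shaped so that the bounds [v] add up under products. *)
Definition sig_bound (Dom : C -> R -> Prop) (v : R) (F : C -> R -> C) : Prop :=
  0 <= v /\ (forall z m, Dom z m -> Cmod (F z m) <= exp v) /\
  (forall z1 z2 m1 m2, Dom z1 m1 -> Dom z2 m2 ->
     Cmod (F z2 m2 - F z1 m1) <= v * exp v * (Cmod (z2 - z1) + Rabs (m2 - m1))).

Lemma exp_le_mono x y : x <= y -> exp x <= exp y.
Proof. intros [h | ->]; [left; now apply exp_increasing | lra]. Qed.

Lemma exp_ge_1 x : 0 <= x -> 1 <= exp x.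
Proof. intros h. rewrite <- exp_0. now apply exp_le_mono. Qed.

Lemma sig_bound_mono Dom v v' F : v <= v' -> sig_bound Dom v F -> sig_bound Dom v' F.
Proof.
  intros hv [h0 [h1 h2]]. assert (hE := exp_le_mono _ _ hv).
  split; [lra |]. split.
  - intros z m h. eapply Rle_trans; [apply h1, h | exact hE].
  - intros. eapply Rle_trans; [apply h2; assumption |].
    apply Rmult_le_compat_r.
    + generalize (Cmod_ge_0 (z2 - z1)), (Rabs_pos (m2 - m1)); lra.
    + apply Rmult_le_compat; try lra. left; apply exp_pos.
Qed.

Lemma sig_bound_mult Dom v v' F G : sig_bound Dom v F -> sig_bound Dom v' G ->
  sig_bound Dom (v + v') (fun z m => (F z m * G z m)%C).
Proof.
  intros [h0 [h1 h2]] [g0 [g1 g2]]. unfold sig_bound. rewrite exp_plus.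
  split; [lra |]. split.
  - intros z m h. rewrite Cmod_mult. apply Rmult_le_compat; try apply Cmod_ge_0; auto.
  - intros z1 z2 m1 m2 hp1 hp2.
    replace (F z2 m2 * G z2 m2 - F z1 m1 * G z1 m1)%C
      with ((F z2 m2 - F z1 m1) * G z2 m2 + F z1 m1 * (G z2 m2 - G z1 m1))%C by ring.
    eapply Rle_trans; [apply Cmod_triangle |]. rewrite !Cmod_mult.
    specialize (h2 z1 z2 m1 m2 hp1 hp2). specialize (g2 z1 z2 m1 m2 hp1 hp2).
    assert (P : 0 <= Cmod (z2 - z1) + Rabs (m2 - m1))
      by (generalize (Cmod_ge_0 (z2 - z1)), (Rabs_pos (m2 - m1)); lra).
    set (u := Cmod (z2 - z1) + Rabs (m2 - m1)) in *.
    assert (A := exp_pos v). assert (A' := exp_pos v').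
    apply Rle_trans with (v * exp v * u * exp v' + exp v * (v' * exp v' * u)).
    + apply Rplus_le_compat; apply Rmult_le_compat; try apply Cmod_ge_0; auto.
    + apply Req_le. ring.
Qed.

Lemma sig_bound_list Dom q (l : list (C -> R -> C)) : 0 <= q ->
  (forall F, In F l -> sig_bound Dom q F) ->
  sig_bound Dom (INR (length l) * q) (fun z m => Cprod (map (fun F => F z m) l)).
Proof.
  intros hq. induction l as [| F l IH]; intros h.
  - cbn [length map Cprod fold_right INR]. rewrite Rmult_0_l. split; [lra |]. split.
    + intros. unfold Cprod. simpl. rewrite Cmod_1, exp_0. lra.
    + intros. unfold Cprod. simpl. rewrite Cmod_self.
      generalize (Cmod_ge_0 (z2 - z1)), (Rabs_pos (m2 - m1)). nra.
  - cbn [length]. rewrite S_INR.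
    replace ((INR (length l) + 1) * q) with (q + INR (length l) * q) by ring.
    apply (sig_bound_mult Dom q _ F (fun z m => Cprod (map (fun G => G z m) l))).
    + apply h. now left.
    + apply IH. intros G hG. apply h. now right.
Qed.

(** * Square shells of the lattice and their primary factors *)

Definition ell (m : R) (ij : Z * Z) : C :=
  (IZR (fst ij) * 1 + IZR (snd ij) * (2 * m * Ci))%C.

(** The Weierstrass primary factor of genus 2. *)
Definition efac (w : C) : C := ((1 - w) * Cexp (w + w ^ 2 / 2))%C.

(** Boundary of the index box of half-width [N]: two full sides, then two sides without corners, so
    that for [N >= 1] each of the [8 N] points is listed once. Products over boxes become products
    over shells. *)
Definition ring_idx (N : nat) : list (Z * Z) :=
  let a := (- Z.of_nat N)%Z in let b := Z.of_nat N in
  map (fun j => (a, j)) (Zrange N) ++ map (fun j => (b, j)) (Zrange N) ++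
  map (fun i => (i, a)) (Zrange (N - 1)) ++ map (fun i => (i, b)) (Zrange (N - 1)).

Lemma Zrange_S N :
  Zrange (S N) = (- Z.of_nat (S N))%Z :: Zrange N ++ [Z.of_nat (S N)].
Proof.
  unfold Zrange. replace (2 * S N + 1)%nat with (S (2 * N + 1 + 1)) by lia.
  cbn [seq map]. f_equal.
  rewrite seq_app, map_app, <- seq_shift, map_map. cbn [seq map]. f_equal.
  - apply map_ext. intros. lia.
  - f_equal. lia.
Qed.

Lemma in_Zrange N i : In i (Zrange N) -> (Z.abs i <= Z.of_nat N)%Z.
Proof.
  unfold Zrange. rewrite in_map_iff. intros [k [<- hk]]. apply in_seq in hk. lia.
Qed.

Lemma length_Zrange N : length (Zrange N) = (2 * N + 1)%nat.
Proof. unfold Zrange. now rewrite length_map, length_seq. Qed.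

Lemma list_prod_cons_r {A B} (l : list A) (y : B) l' :
  Permutation (list_prod l (y :: l')) (map (fun x => (x, y)) l ++ list_prod l l').
Proof.
  induction l as [| x l IH]; [reflexivity |].
  cbn [list_prod map app]. constructor.
  rewrite IH, !app_assoc. apply Permutation_app_tail, Permutation_app_comm.
Qed.

Lemma list_prod_app_l {A B} (l1 l2 : list A) (l' : list B) :
  list_prod (l1 ++ l2) l' = list_prod l1 l' ++ list_prod l2 l'.
Proof.
  induction l1; [reflexivity |]. cbn. now rewrite IHl1, app_assoc.
Qed.

Lemma list_prod_perm_r {A B} (l : list A) (l1 l2 : list B) :
  Permutation l1 l2 -> Permutation (list_prod l l1) (list_prod l l2).
Proof.
  intros h. induction l; [reflexivity |]. cbn. apply Permutation_app; [| assumption].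
  now apply Permutation_map.
Qed.

Lemma box_ring N :
  Permutation (list_prod (Zrange (S N)) (Zrange (S N)))
    (list_prod (Zrange N) (Zrange N) ++ ring_idx (S N)).
Proof.
  unfold ring_idx. replace (S N - 1)%nat with N by lia.
  set (a := (- Z.of_nat (S N))%Z). set (b := Z.of_nat (S N)).
  set (L := Zrange (S N)).
  unfold L at 1. rewrite Zrange_S. fold a b.
  cbn [list_prod]. rewrite list_prod_app_l. cbn [list_prod]. rewrite app_nil_r.
  fold a b.
  assert (E : Permutation (list_prod (Zrange N) L)
    (map (fun i => (i, a)) (Zrange N) ++ map (fun i => (i, b)) (Zrange N)
       ++ list_prod (Zrange N) (Zrange N))).
  { transitivity (list_prod (Zrange N) (a :: b :: Zrange N)).
    - apply list_prod_perm_r. unfold L. rewrite Zrange_S. fold a b. constructor.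
      rewrite Permutation_app_comm. reflexivity.
    - rewrite list_prod_cons_r. apply Permutation_app_head. apply list_prod_cons_r. }
  rewrite E.
  set (A1 := map (fun j => (a, j)) L). set (A2 := map (fun j => (b, j)) L).
  set (A3 := map (fun i => (i, a)) (Zrange N)). set (A4 := map (fun i => (i, b)) (Zrange N)).
  set (X := list_prod (Zrange N) (Zrange N)).
  transitivity ((A1 ++ A3 ++ A4 ++ A2) ++ X).
  - rewrite <- !app_assoc. do 3 apply Permutation_app_head. apply Permutation_app_comm.
  - rewrite Permutation_app_comm. apply Permutation_app_head.
    apply Permutation_app_head. rewrite (Permutation_app_comm A2).
    rewrite <- app_assoc. reflexivity.
Qed.

Lemma in_ring_idx N ij : In ij (ring_idx N) ->
  (Z.abs (fst ij) = Z.of_nat N \/ Z.abs (snd ij) = Z.of_nat N) /\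
  (Z.abs (snd ij) <= Z.of_nat N)%Z.
Proof.
  unfold ring_idx. rewrite !in_app_iff, !in_map_iff.
  intros [[j [<- h]] | [[j [<- h]] | [[j [<- h]] | [j [<- h]]]]]; apply in_Zrange in h;
    cbn [fst snd]; lia.
Qed.

Lemma length_ring_idx N : (1 <= N)%nat -> length (ring_idx N) = (8 * N)%nat.
Proof.
  intros h. unfold ring_idx. rewrite !length_app, !length_map, !length_Zrange. lia.
Qed.

Lemma Re_ell m ij : Re (ell m ij) = IZR (fst ij).
Proof. unfold ell, Re; simpl. ring. Qed.

Lemma Im_ell m ij : Im (ell m ij) = IZR (snd ij) * (2 * m).
Proof. unfold ell, Im; simpl. ring. Qed.

(** On a shell one of the two indices has absolute value [N]; it is read off the real part or the
    imaginary part. *)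
Lemma ell_lower lo m N ij : 0 < lo -> lo <= m -> In ij (ring_idx N) ->
  Rmin 1 (2 * lo) * INR N <= Cmod (ell m ij).
Proof.
  intros hlo hm h. apply in_ring_idx in h. destruct h as [h _].
  assert (k1 := Rmin_l 1 (2 * lo)). assert (k2 := Rmin_r 1 (2 * lo)).
  assert (hN := pos_INR N).
  destruct h as [h | h].
  - eapply Rle_trans; [| apply re_le_Cmod]. rewrite Re_ell, <- abs_IZR, h, <- INR_IZR_INZ. nra.
  - eapply Rle_trans; [| apply im_le_Cmod].
    rewrite Im_ell, Rabs_mult, <- abs_IZR, h, <- INR_IZR_INZ, Rabs_right by lra. nra.
Qed.

Lemma ell_diff m1 m2 N ij : In ij (ring_idx N) ->
  Cmod (ell m2 ij - ell m1 ij) <= 2 * INR N * Rabs (m2 - m1).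
Proof.
  intros h. apply in_ring_idx in h. destruct h as [_ h].
  replace (ell m2 ij - ell m1 ij)%C with (RtoC (IZR (snd ij)) * (RtoC 2 * RtoC (m2 - m1) * Ci))%C
    by (unfold ell; rewrite RtoC_minus; ring).
  rewrite !Cmod_mult, !Cmod_R, Cmod_Ci, <- abs_IZR, (Rabs_right 2) by lra.
  apply IZR_le in h. rewrite <- INR_IZR_INZ in h.
  generalize (Rabs_pos (m2 - m1)). nra.
Qed.

(** The cancellation [(1 - w) (1 + w) - 1 = - w ^ 2] makes the derivative vanish to second order at
    0, which is what makes the product over the lattice converge. *)
Lemma efac_cstrict w : cstrict efac w (- (w ^ 2) * Cexp (w + w ^ 2 / 2)).
Proof.
  assert (T : (fun _ : R => True) 0) by easy.
  assert (I := sdiff_id (fun _ => True) w 0).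
  assert (Q := sdiff_mult (fun _ => True) _ _ _ _ _ _ _ _ T I I). cbv beta in Q.
  assert (A := sdiff_plus _ _ _ _ _ _ _ _ _ I
     (sdiff_scal (fun _ => True) (/ 2)%C _ _ _ _ _ T Q)).
  assert (X := sdiff_comp_outer (fun _ => True) Cexp _ _ _ _ _ _ T (Cexp_cstrict _) A).
  assert (M := sdiff_minus (fun _ => True) _ _ _ _ _ _ _ _ T
     (sdiff_const (fun _ => True) 1%C w 0) I).
  assert (Y := sdiff_mult (fun _ => True) _ _ _ _ _ _ _ _ T M X). cbv beta in Y.
  apply (sdiff_cstrict (fun _ => True) (fun v _ => efac v) w 0 _ 0); [easy |].
  assert (E : forall v : C, (v + / 2 * (v * v) = v + v ^ 2 / 2)%C) by (intros; simpl; field).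
  refine (sdiff_ext _ _ _ w 0 _ _ 1 Rlt_0_1 T _ (sdiff_eq _ _ _ _ _ _ _ _ Y _ _)).
  - intros v s _ _ _. cbv beta. unfold efac. rewrite E. reflexivity.
  - rewrite E. simpl. field.
  - ring.
Qed.

(** The Lipschitz constant is quadratic in [B]; it is applied with [B] of order [1 / N] on the shell
    [N]. *)
Lemma efac_lip B w1 w2 : 0 <= B -> Cmod w1 <= B -> Cmod w2 <= B ->
  Cmod (efac w2 - efac w1) <= 2 * (B ^ 2 * exp (B + B ^ 2)) * Cmod (w2 - w1).
Proof.
  intros hB h1 h2.
  apply (cmean efac (fun w => (- (w ^ 2) * Cexp (w + w ^ 2 / 2))%C)).
  - intros. apply cstrict_cderiv, efac_cstrict.
  - intros x hx.
    assert (hs : Cmod (segpt w1 w2 x) <= B).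
    { replace (segpt w1 w2 x) with (RtoC (1 - x) * w1 + RtoC x * w2)%C
        by (unfold segpt; rewrite RtoC_minus; ring).
      eapply Rle_trans; [apply Cmod_triangle |].
      rewrite !Cmod_mult, !Cmod_R, !Rabs_right by lra. nra. }
    set (w := segpt w1 w2 x) in *.
    rewrite Cmod_mult, Cmod_opp, Cmod_pow, Cmod_Cexp.
    assert (p := Cmod_ge_0 w).
    apply Rmult_le_compat.
    + apply pow_le, Cmod_ge_0.
    + left. apply exp_pos.
    + apply pow_incr. lra.
    + apply exp_le_mono.
      eapply Rle_trans; [apply Rle_abs |]. eapply Rle_trans; [apply re_le_Cmod |].
      eapply Rle_trans; [apply Cmod_triangle |].
      unfold Cdiv. rewrite Cmod_mult, Cmod_pow.
      assert (hinv : Cmod (/ 2) <= 1).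
      { rewrite Cmod_inv by (intros h; apply RtoC_inj in h; lra).
        rewrite Cmod_R, Rabs_right by lra. lra. }
      assert (q := Cmod_ge_0 (/ 2)).
      assert (Cmod w ^ 2 <= B ^ 2) by (apply pow_incr; lra).
      assert (0 <= Cmod w ^ 2) by (apply pow_le; lra). nra.
Qed.

Definition ring_factor (N : nat) (z : C) (m : R) : C :=
  Cprod (map (fun ij => efac (z / ell m ij)) (ring_idx N)).

Definition sig_dom (R0 lo hi : R) (z : C) (m : R) : Prop := Cmod z <= R0 /\ lo <= m <= hi.

Lemma efac_0 : efac 0 = 1%C.
Proof.
  unfold efac. replace (0 + 0 ^ 2 / 2)%C with (RtoC 0) by (simpl; field). rewrite Cexp_0. ring.
Qed.

(** On the shell [N] the quotient [z / ell] is of size [1 / N] with Lipschitz constant of order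
    [1 / N]. The quadratic behaviour of [efac] turns this into order [N ^ -3] per factor, and the
    [8 N] factors give the summable order [N ^ -2]. *)
Lemma ring_factor_bound (R0 lo hi : R) : 0 <= R0 -> 0 < lo -> lo <= hi ->
  exists K, 0 < K /\ forall N, (1 <= N)%nat ->
    sig_bound (sig_dom R0 lo hi) (K / INR N ^ 2) (ring_factor N).
Proof.
  intros hR hlo hhi.
  set (k := Rmin 1 (2 * lo)).
  assert (hk : 0 < k) by (apply Rmin_glb_lt; lra).
  (* On the shell [n], [B / n] bounds [z / ell] and [A / n] is its Lipschitz constant in [z] and [m]
     together. *)
  set (A := (1 + 2 * R0 / k) / k). set (B := R0 / k).
  assert (hA : 0 < A).
  { unfold A. assert (0 <= 2 * R0 / k) by (apply Rle_div_r; lra).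
    apply Rdiv_lt_0_compat; lra. }
  assert (hB : 0 <= B) by (unfold B; apply Rle_div_r; lra).
  set (C0 := 2 * (B ^ 2 * exp (B + B ^ 2)) * A).
  assert (hC0 : 0 <= C0).
  { unfold C0. apply Rmult_le_pos; [| lra]. apply Rmult_le_pos; [lra |].
    apply Rmult_le_pos; [apply pow_le, hB | left; apply exp_pos]. }
  (* [q / n ^ 3] has to dominate both the Lipschitz constant [C0 / n ^ 3] of a factor and its
     distance from [efac 0 = 1], at most [C0 * R0 / n ^ 3]. *)
  set (q := C0 * (1 + R0)).
  assert (hq : 0 <= q) by (unfold q; apply Rmult_le_pos; lra).
  exists (8 * q + 1). split; [lra |]. intros N hN.
  assert (hN1 : 1 <= INR N) by (change 1 with (INR 1); apply le_INR, hN).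
  set (n := INR N) in *.
  assert (hn3 : 0 < n ^ 3) by (apply pow_lt; lra).
  assert (hn2 : 0 < n ^ 2) by (apply pow_lt; lra).
  apply sig_bound_mono with (INR (length (map (fun ij (z : C) m => efac (z / ell m ij)) (ring_idx N)))
      * (q / n ^ 3)).
  { rewrite length_map, length_ring_idx, mult_INR by exact hN. fold n.
    replace (INR 8 * n * (q / n ^ 3)) with (8 * q / n ^ 2) by (simpl; field; lra).
    apply Rmult_le_compat_r; [left; apply Rinv_0_lt_compat, hn2 | lra]. }
  assert (E : forall z m, ring_factor N z m
    = Cprod (map (fun F => F z m) (map (fun ij (z : C) m => efac (z / ell m ij)) (ring_idx N)))).
  { intros. unfold ring_factor. now rewrite map_map. }
  assert (hqn : 0 <= q / n ^ 3) by (apply Rle_div_r; lra).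
  assert (X : sig_bound (sig_dom R0 lo hi)
    (INR (length (map (fun ij (z : C) m => efac (z / ell m ij)) (ring_idx N))) * (q / n ^ 3))
    (fun z m => Cprod (map (fun F => F z m) (map (fun ij (z : C) m => efac (z / ell m ij)) (ring_idx N))))).
  { apply sig_bound_list; [exact hqn |]. intros F hF. apply in_map_iff in hF.
    destruct hF as [ij [<- hij]].
    assert (L : forall z1 z2 m1 m2, sig_dom R0 lo hi z1 m1 -> sig_dom R0 lo hi z2 m2 ->
      Cmod (efac (z2 / ell m2 ij) - efac (z1 / ell m1 ij))
        <= C0 / n ^ 3 * (Cmod (z2 - z1) + Rabs (m2 - m1))).
    { intros z1 z2 m1 m2 [a1 a2] [b1 b2].
      assert (l1 := ell_lower lo m1 N ij hlo (proj1 a2) hij).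
      assert (l2 := ell_lower lo m2 N ij hlo (proj1 b2) hij).
      fold k n in l1, l2.
      assert (hkn : 0 < k * n) by (apply Rmult_lt_0_compat; lra).
      assert (n1 : ell m1 ij <> 0%C) by (apply Cmod_gt_0; lra).
      assert (n2 : ell m2 ij <> 0%C) by (apply Cmod_gt_0; lra).
      assert (hBn : 0 <= B / n) by (apply Rle_div_r; lra).
      assert (W : forall z m, Cmod z <= R0 -> k * n <= Cmod (ell m ij) -> ell m ij <> 0%C ->
                  Cmod (z / ell m ij) <= B / n).
      { intros z m u1 u2 u3. rewrite Cmod_div by exact u3.
        replace (B / n) with (R0 / (k * n)) by (unfold B; field; lra).
        apply Rmult_le_compat; try apply Cmod_ge_0; try lra.
        - left. apply Rinv_0_lt_compat. lra.
        - apply Rinv_le_contravar; lra. }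
      eapply Rle_trans; [apply (efac_lip (B / n)); auto |].
      assert (hd : Cmod (z2 / ell m2 ij - z1 / ell m1 ij)
                   <= A / n * (Cmod (z2 - z1) + Rabs (m2 - m1))).
      { replace (z2 / ell m2 ij - z1 / ell m1 ij)%C
          with ((z2 - z1) / ell m2 ij - z1 * (ell m2 ij - ell m1 ij) / (ell m1 ij * ell m2 ij))%C
          by (field; auto).
        eapply Rle_trans; [apply Cmod_minus_le |].
        rewrite !Cmod_div, !Cmod_mult by auto using Cmult_neq_0.
        assert (hdl := ell_diff m1 m2 N ij hij). fold n in hdl.
        assert (p := Cmod_ge_0 (z2 - z1)). assert (p' := Rabs_pos (m2 - m1)).
        assert (x1 : Cmod (z2 - z1) / Cmod (ell m2 ij) <= Cmod (z2 - z1) / (k * n)).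
        { apply Rmult_le_compat_l; [lra | apply Rinv_le_contravar; lra]. }
        assert (x2 : Cmod z1 * Cmod (ell m2 ij - ell m1 ij) / (Cmod (ell m1 ij) * Cmod (ell m2 ij))
                  <= R0 * (2 * n * Rabs (m2 - m1)) / ((k * n) * (k * n))).
        { apply Rmult_le_compat.
          - apply Rmult_le_pos; apply Cmod_ge_0.
          - left. apply Rinv_0_lt_compat. apply Rmult_lt_0_compat; lra.
          - apply Rmult_le_compat; try apply Cmod_ge_0; assumption.
          - apply Rinv_le_contravar; [apply Rmult_lt_0_compat; lra |].
            apply Rmult_le_compat; lra. }
        replace (R0 * (2 * n * Rabs (m2 - m1)) / ((k * n) * (k * n)))
          with (2 * R0 / k / (k * n) * Rabs (m2 - m1)) in x2 by (field; lra).
        replace (A / n) with (1 / (k * n) + 2 * R0 / k / (k * n)) by (unfold A; field; lra).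
        replace (Cmod (z2 - z1) / (k * n)) with (1 / (k * n) * Cmod (z2 - z1)) in x1
          by (field; lra).
        assert (0 <= 1 / (k * n)) by (apply Rle_div_r; lra).
        assert (0 <= 2 * R0 / k / (k * n)).
        { apply Rle_div_r; [lra |]. rewrite Rmult_0_l. apply Rle_div_r; lra. }
        nra. }
      assert (hexp : exp (B / n + (B / n) ^ 2) <= exp (B + B ^ 2)).
      { apply exp_le_mono.
        assert (B / n <= B) by (apply Rle_div_l; nra).
        assert ((B / n) ^ 2 <= B ^ 2) by (apply pow_incr; lra). lra. }
      apply Rle_trans with (2 * ((B / n) ^ 2 * exp (B + B ^ 2)) *
          (A / n * (Cmod (z2 - z1) + Rabs (m2 - m1)))).
      - apply Rmult_le_compat; try apply Cmod_ge_0.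
        + apply Rmult_le_pos; [lra |]. apply Rmult_le_pos; [apply pow_le, hBn | left; apply exp_pos].
        + apply Rmult_le_compat_l; [lra |]. apply Rmult_le_compat_l; [apply pow_le, hBn | exact hexp].
        + exact hd.
      - apply Req_le. unfold C0. field. lra. }
    assert (hC3 : 0 <= C0 / n ^ 3) by (apply Rle_div_r; lra).
    assert (hC3q : C0 / n ^ 3 <= q / n ^ 3).
    { apply Rmult_le_compat_r; [left; apply Rinv_0_lt_compat, hn3 |]. unfold q. nra. }
    split; [exact hqn |]. split.
    - intros z m hz.
      assert (Y := L 0%C z m m). unfold sig_dom in Y, hz. rewrite Cmod_0 in Y.
      specialize (Y ltac:(tauto) ltac:(tauto)).
      replace (0 / ell m ij)%C with (RtoC 0) in Y by (unfold Cdiv; ring).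
      rewrite efac_0, Rminus_eq_0, Rabs_R0 in Y.
      replace (z - 0)%C with z in Y by ring.
      assert (Z := Cmod_triangle_sub (efac (z / ell m ij)) 1). rewrite Cmod_1 in Z.
      eapply Rle_trans; [apply Z |].
      eapply Rle_trans; [| apply exp_ineq1_le].
      assert (q / n ^ 3 = C0 / n ^ 3 * (1 + R0)) by (unfold q; field; lra).
      nra.
    - intros z1 z2 m1 m2 d1 d2. eapply Rle_trans; [apply L; assumption |].
      apply Rmult_le_compat_r.
      + generalize (Cmod_ge_0 (z2 - z1)), (Rabs_pos (m2 - m1)); lra.
      + assert (U := exp_ge_1 _ hqn). nra. }
  destruct X as [X0 [X1 X2]]. split; [exact X0 |]. split.
  - intros. rewrite E. now apply X1.
  - intros. rewrite !E. now apply X2.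
Qed.

(** * Convergence of the product over shells, with rates *)

Fixpoint ring_prod (N : nat) (z : C) (m : R) : C :=
  match N with
  | O => RtoC 1
  | S n => (ring_prod n z m * ring_factor (S n) z m)%C
  end.

(* [sigma (z) / z], with no singularity at the origin. *)
Definition sig_red (z : C) (m : R) : C := Clim_seq (fun N => ring_prod N z m).

(** Makes every sum of shell bounds telescope, which yields explicit tails of order [1 / N]. *)
Lemma inv_sq_telescope n : 1 <= n -> 1 / (n + 1) ^ 2 <= 1 / n - 1 / (n + 1).
Proof.
  intros h. replace (1 / n - 1 / (n + 1)) with (1 / (n * (n + 1))) by (field; lra).
  unfold Rdiv. apply Rmult_le_compat_l; [lra |]. apply Rinv_le_contravar; nra.
Qed.

Lemma ring_factor_0 N m : ring_factor N 0 m = 1%C.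
Proof.
  unfold ring_factor. induction (ring_idx N) as [| ij l IH]; [reflexivity |].
  cbn [map Cprod fold_right]. unfold Cprod in IH. rewrite IH.
  replace (0 / ell m ij)%C with (RtoC 0) by (unfold Cdiv; ring).
  rewrite efac_0. ring.
Qed.

Lemma ring_prod_0 N m : ring_prod N 0 m = 1%C.
Proof. induction N; [reflexivity |]. cbn [ring_prod]. rewrite IHN, ring_factor_0. ring. Qed.

Section Bounds.

Variables R0 lo hi K : R.
Hypothesis hR : 0 <= R0.
Hypothesis hK : 0 < K.
Hypothesis hb : forall N, (1 <= N)%nat ->
  sig_bound (sig_dom R0 lo hi) (K / INR N ^ 2) (ring_factor N).

(** The exponents of the shell bounds add up; the induction carries the sharper [2 * K - K / INR N]
    for which the telescoping closes. *)
Lemma ring_prod_bound N : sig_bound (sig_dom R0 lo hi) (2 * K) (ring_prod N).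
Proof.
  assert (A : forall N, (1 <= N)%nat ->
    sig_bound (sig_dom R0 lo hi) (2 * K - K / INR N) (ring_prod N)).
  { clear N. intros N. induction N as [| N IH]; [lia |]. intros _.
    cbn [ring_prod]. destruct N as [| N].
    - apply sig_bound_mono with (0 + K / INR 1 ^ 2). { simpl. lra. }
      apply sig_bound_mult; [| apply hb; lia].
      split; [lra |]. cbn [ring_prod]. split.
      + intros. rewrite Cmod_1, exp_0. lra.
      + intros. rewrite Cmod_self.
        generalize (Cmod_ge_0 (z2 - z1)), (Rabs_pos (m2 - m1)). nra.
    - specialize (IH ltac:(lia)).
      eapply sig_bound_mono; [| apply sig_bound_mult; [exact IH | apply hb; lia]].
      rewrite (S_INR (S N)). set (n := INR (S N)).
      assert (hn : 1 <= n) by (change 1 with (INR 1); apply le_INR; lia).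
      assert (X := inv_sq_telescope n hn).
      replace (K / (n + 1) ^ 2) with (K * (1 / (n + 1) ^ 2)) by (field; lra).
      replace (K / n) with (K * (1 / n)) by (field; lra).
      replace (K / (n + 1)) with (K * (1 / (n + 1))) by (field; lra). nra. }
  destruct N as [| N].
  - split; [lra |]. cbn [ring_prod]. split.
    + intros. rewrite Cmod_1. apply exp_ge_1. lra.
    + intros. rewrite Cmod_self. apply Rmult_le_pos.
      * apply Rmult_le_pos; [lra | left; apply exp_pos].
      * generalize (Cmod_ge_0 (z2 - z1)), (Rabs_pos (m2 - m1)). lra.
  - eapply sig_bound_mono; [| apply A; lia].
    assert (0 < INR (S N)) by (apply lt_0_INR; lia).
    assert (0 <= K / INR (S N)) by (apply Rle_div_r; lra). lra.
Qed.

(** The bound on one shell in the telescoping form [d], ready for induction on the number of shells.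
    The distance from 1 follows from the Lipschitz bound, as the factor equals 1 at [z = 0]. *)
Lemma ring_factor_step n : (1 <= n)%nat ->
  let d := K * (1 / INR n - 1 / INR (S n)) in
  0 <= d /\
  (forall z m, sig_dom R0 lo hi z m -> Cmod (ring_factor (S n) z m - 1) <= d * exp K * R0) /\
  (forall z1 z2 m1 m2, sig_dom R0 lo hi z1 m1 -> sig_dom R0 lo hi z2 m2 ->
    Cmod (ring_factor (S n) z2 m2 - ring_factor (S n) z1 m1)
      <= d * exp K * (Cmod (z2 - z1) + Rabs (m2 - m1))).
Proof.
  intros hn d.
  destruct (hb (S n) ltac:(lia)) as [e0 [e1 e2]].
  set (q := K / INR (S n) ^ 2) in *.
  assert (h1 : 1 <= INR n) by (change 1 with (INR 1); apply le_INR; lia).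
  assert (hq : q <= d).
  { unfold q, d. rewrite S_INR.
    replace (K / (INR n + 1) ^ 2) with (K * (1 / (INR n + 1) ^ 2)) by (field; lra).
    apply Rmult_le_compat_l; [lra | apply inv_sq_telescope, h1]. }
  assert (hqK : q <= K).
  { unfold q. rewrite S_INR. apply Rle_div_l; [nra |]. nra. }
  assert (L : forall z1 z2 m1 m2, sig_dom R0 lo hi z1 m1 -> sig_dom R0 lo hi z2 m2 ->
    Cmod (ring_factor (S n) z2 m2 - ring_factor (S n) z1 m1)
      <= d * exp K * (Cmod (z2 - z1) + Rabs (m2 - m1))).
  { intros. eapply Rle_trans; [apply e2; assumption |].
    apply Rmult_le_compat_r.
    - generalize (Cmod_ge_0 (z2 - z1)), (Rabs_pos (m2 - m1)). lra.
    - apply Rmult_le_compat; try lra; [left; apply exp_pos | now apply exp_le_mono]. }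
  split; [lra |]. split; [| exact L].
  intros z m hz. assert (X := L 0%C z m m). unfold sig_dom in X, hz. rewrite Cmod_0 in X.
  specialize (X ltac:(tauto) ltac:(tauto)).
  rewrite ring_factor_0, Rminus_eq_0, Rabs_R0 in X.
  replace (z - 0)%C with z in X by ring.
  eapply Rle_trans; [apply X |].
  assert (0 <= d * exp K) by (apply Rmult_le_pos; [lra | left; apply exp_pos]). nra.
Qed.

(** Adding one shell changes the tail by [(q2 - q1) (r2 - 1) + q1 (r2 - r1)], and [T] collects the
    constants of these two terms. The estimate has the shape that [sdiffable_limit] asks for. *)
Lemma ring_prod_tail : exists K2, 0 <= K2 /\
  forall N M z1 z2 m1 m2, (1 <= N <= M)%nat ->
    sig_dom R0 lo hi z1 m1 -> sig_dom R0 lo hi z2 m2 ->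
    Cmod ((ring_prod M z2 m2 - ring_prod N z2 m2) - (ring_prod M z1 m1 - ring_prod N z1 m1))
      <= K2 / INR N * (Cmod (z2 - z1) + Rabs (m2 - m1)).
Proof.
  set (E := exp (2 * K)). set (E1 := exp K).
  assert (hE : 0 < E) by apply exp_pos. assert (hE1 : 0 < E1) by apply exp_pos.
  set (T := 2 * K * E * (E1 * R0) + E * E1).
  assert (hT : 0 <= T).
  { unfold T. assert (0 <= E * E1) by nra. assert (0 <= E1 * R0) by nra.
    assert (0 <= 2 * K * E * (E1 * R0)) by (apply Rmult_le_pos; nra). lra. }
  assert (A : forall N z1 z2 m1 m2, (1 <= N)%nat ->
    sig_dom R0 lo hi z1 m1 -> sig_dom R0 lo hi z2 m2 -> forall j,
    Cmod ((ring_prod (j + N) z2 m2 - ring_prod N z2 m2) - (ring_prod (j + N) z1 m1 - ring_prod N z1 m1))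
      <= K * T * (1 / INR N - 1 / INR (j + N)) * (Cmod (z2 - z1) + Rabs (m2 - m1))).
  { intros N z1 z2 m1 m2 hN d1 d2 j.
    assert (P : 0 <= Cmod (z2 - z1) + Rabs (m2 - m1))
      by (generalize (Cmod_ge_0 (z2 - z1)), (Rabs_pos (m2 - m1)); lra).
    set (u := Cmod (z2 - z1) + Rabs (m2 - m1)) in *.
    induction j as [| j IH].
    - cbn [Nat.add]. replace (_ - _ - _)%C with (RtoC 0) by ring. rewrite Cmod_0, Rminus_eq_0. lra.
    - cbn [Nat.add ring_prod]. set (n := (j + N)%nat) in *.
      destruct (ring_factor_step n ltac:(lia)) as [s0 [s1 s2]].
      set (d := K * (1 / INR n - 1 / INR (S n))) in *. fold E1 in s1, s2.
      destruct (ring_prod_bound n) as [_ [b1 b2]]. fold E in b1, b2.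
      set (q1 := ring_prod n z1 m1) in *. set (q2 := ring_prod n z2 m2) in *.
      set (r1 := ring_factor (S n) z1 m1) in *. set (r2 := ring_factor (S n) z2 m2) in *.
      set (p1 := ring_prod N z1 m1) in *. set (p2 := ring_prod N z2 m2) in *.
      replace (q2 * r2 - p2 - (q1 * r1 - p1))%C
        with ((q2 - p2 - (q1 - p1)) + ((q2 - q1) * (r2 - 1) + q1 * (r2 - r1)))%C by ring.
      eapply Rle_trans; [apply Cmod_triangle |].
      assert (X := Cmod_triangle ((q2 - q1) * (r2 - 1)) (q1 * (r2 - r1))).
      rewrite !Cmod_mult in X.
      assert (X1 : Cmod (q2 - q1) * Cmod (r2 - 1) <= (2 * K * E * u) * (d * E1 * R0)).
      { apply Rmult_le_compat; try apply Cmod_ge_0; [now apply b2 | now apply s1]. }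
      assert (X2 : Cmod q1 * Cmod (r2 - r1) <= E * (d * E1 * u)).
      { apply Rmult_le_compat; try apply Cmod_ge_0; [now apply b1 | now apply s2]. }
      replace (K * T * (1 / INR N - 1 / INR (S n)) * u)
        with (K * T * (1 / INR N - 1 / INR n) * u + d * T * u)
        by (unfold d; ring).
      replace (d * T * u) with ((2 * K * E * u) * (d * E1 * R0) + E * (d * E1 * u))
        by (unfold T; ring).
      lra. }
  exists (K * T). split; [nra |].
  intros N M z1 z2 m1 m2 hNM d1 d2.
  specialize (A N z1 z2 m1 m2 ltac:(lia) d1 d2 (M - N)%nat).
  replace (M - N + N)%nat with M in A by lia.
  eapply Rle_trans; [exact A |].
  apply Rmult_le_compat_r.
  { generalize (Cmod_ge_0 (z2 - z1)), (Rabs_pos (m2 - m1)). lra. }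
  assert (0 < INR N) by (apply lt_0_INR; lia).
  assert (0 < INR M) by (apply lt_0_INR; lia).
  assert (0 <= 1 / INR M) by (apply Rle_div_r; lra).
  replace (K * T / INR N) with (K * T * (1 / INR N)) by (field; lra).
  apply Rmult_le_compat_l; nra.
Qed.

(** Excludes divergence of the product to 0: by [(1 - x) (1 - y) >= 1 - x - y], the later shells
    shrink the modulus by at most a factor one minus the sum of their distances from 1, and that sum
    is at most 1/2 once [N] is large. *)
Lemma ring_prod_lower N M z m : (1 <= N <= M)%nat -> sig_dom R0 lo hi z m ->
  K * exp K * R0 / INR N <= 1 / 2 ->
  Cmod (ring_prod N z m) / 2 <= Cmod (ring_prod M z m).
Proof.
  intros hNM hz hs.
  assert (hi0 : 0 < INR N) by (apply lt_0_INR; lia).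
  set (K3 := K * exp K * R0) in *.
  assert (hK3 : 0 <= K3).
  { unfold K3. apply Rmult_le_pos; [| exact hR]. apply Rmult_le_pos; [lra | left; apply exp_pos]. }
  assert (P := Cmod_ge_0 (ring_prod N z m)).
  assert (A : forall j, Cmod (ring_prod N z m) * (1 - K3 * (1 / INR N - 1 / INR (j + N)))
       <= Cmod (ring_prod (j + N) z m)).
  { induction j as [| j IH].
    - cbn [Nat.add]. rewrite Rminus_eq_0. lra.
    - cbn [Nat.add ring_prod]. set (n := (j + N)%nat) in *.
      destruct (ring_factor_step n ltac:(lia)) as [s0 [s1 _]].
      specialize (s1 z m hz). rewrite Cmod_mult.
      set (d := 1 / INR n - 1 / INR (S n)) in *.
      replace (K * d * exp K * R0) with (K3 * d) in s1 by (unfold K3; ring).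
      assert (hd : 0 <= d) by nra.
      assert (hn0 : INR N <= INR n) by (apply le_INR; lia).
      assert (hn1 : INR n <= INR (S n)) by (apply le_INR; lia).
      assert (hinv : 0 <= 1 / INR (S n)) by (apply Rle_div_r; lra).
      assert (hinv2 : 1 / INR n <= 1 / INR N).
      { unfold Rdiv. apply Rmult_le_compat_l; [lra | apply Rinv_le_contravar; lra]. }
      assert (hs' : K3 * (1 / INR N) <= 1 / 2)
        by (replace (K3 * (1 / INR N)) with (K3 / INR N) by (field; lra); exact hs).
      assert (T := Cmod_triangle_sub 1 (ring_factor (S n) z m)).
      rewrite Cmod_1, Cmod_sym in T.
      replace (1 / INR N - 1 / INR (S n)) with ((1 / INR N - 1 / INR n) + d) by (unfold d; ring).
      set (A := 1 / INR N - 1 / INR n) in *.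
      assert (hA : 0 <= A) by (unfold A; lra).
      assert (hd2 : d <= 1 / INR N) by (unfold d; lra).
      assert (hA2 : A <= 1 / INR N).
      { assert (0 <= 1 / INR n) by (apply Rle_div_r; lra). unfold A. lra. }
      assert (0 <= K3 * A) by nra. assert (0 <= K3 * d) by nra.
      assert (K3 * A <= 1 / 2) by nra. assert (K3 * d <= 1 / 2) by nra.
      apply Rle_trans with ((Cmod (ring_prod N z m) * (1 - K3 * A)) * (1 - K3 * d)).
      + assert (0 <= Cmod (ring_prod N z m) * ((K3 * A) * (K3 * d))) by (apply Rmult_le_pos; [exact P | apply Rmult_le_pos; assumption]).
        nra.
      + apply Rmult_le_compat; try lra. apply Rmult_le_pos; lra. }
  specialize (A (M - N)%nat). replace (M - N + N)%nat with M in A by lia.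
  eapply Rle_trans; [| exact A].
  assert (0 < INR M) by (apply lt_0_INR; lia).
  assert (0 <= 1 / INR M) by (apply Rle_div_r; lra).
  assert (K3 * (1 / INR N - 1 / INR M) <= 1 / 2).
  { eapply Rle_trans; [| exact hs]. replace (K3 / INR N) with (K3 * (1 / INR N)) by (field; lra).
    apply Rmult_le_compat_l; lra. }
  nra.
Qed.

(** The limit of [ring_prod_tail] as the larger index grows. Comparison with the value 1 at [z = 0]
    turns the Lipschitz estimate into convergence. *)
Lemma sig_red_tail : exists K2, 0 <= K2 /\
  (forall N z m, (1 <= N)%nat -> sig_dom R0 lo hi z m ->
     Cmod (sig_red z m - ring_prod N z m) <= K2 / INR N) /\
  forall N z1 z2 m1 m2, (1 <= N)%nat ->
    sig_dom R0 lo hi z1 m1 -> sig_dom R0 lo hi z2 m2 ->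
    Cmod ((sig_red z2 m2 - ring_prod N z2 m2) - (sig_red z1 m1 - ring_prod N z1 m1))
      <= K2 / INR N * (Cmod (z2 - z1) + Rabs (m2 - m1)).
Proof.
  destruct ring_prod_tail as [K2 [h0 h]].
  assert (A : forall z m, sig_dom R0 lo hi z m -> forall N, (1 <= N)%nat ->
     Cmod (sig_red z m - ring_prod N z m) <= 2 * (K2 * R0) / INR N).
  { intros z m hz. apply Clim_seq_estimate. intros N M hNM.
    assert (X := h N M 0%C z m m hNM). unfold sig_dom in X, hz. rewrite Cmod_0 in X.
    specialize (X ltac:(tauto) ltac:(tauto)).
    rewrite !ring_prod_0, Rminus_eq_0, Rabs_R0 in X.
    replace (z - 0)%C with z in X by ring.
    replace (ring_prod M z m - ring_prod N z m - (1 - 1))%C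
      with (ring_prod M z m - ring_prod N z m)%C in X by ring.
    eapply Rle_trans; [apply X |].
    assert (0 < INR N) by (apply lt_0_INR; lia).
    assert (0 <= K2 / INR N) by (apply Rle_div_r; lra).
    replace (K2 * R0 / INR N) with (K2 / INR N * R0) by (field; lra). nra. }
  set (K3 := 2 * (K2 * R0)) in *.
  assert (hK3 : 0 <= K3) by (unfold K3; nra).
  exists (K2 + K3). split; [lra |]. split.
  { intros N z m hN hz. eapply Rle_trans; [apply A; assumption |].
    assert (0 < INR N) by (apply lt_0_INR; lia).
    apply Rmult_le_compat_r; [left; now apply Rinv_0_lt_compat | lra]. }
  intros N z1 z2 m1 m2 hN d1 d2.
  assert (hi0 : 0 < INR N) by (apply lt_0_INR; lia).
  assert (P : 0 <= Cmod (z2 - z1) + Rabs (m2 - m1))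
    by (generalize (Cmod_ge_0 (z2 - z1)), (Rabs_pos (m2 - m1)); lra).
  apply Rle_trans with (K2 / INR N * (Cmod (z2 - z1) + Rabs (m2 - m1))).
  2:{ apply Rmult_le_compat_r; [exact P |].
      apply Rmult_le_compat_r; [left; now apply Rinv_0_lt_compat | lra]. }
  (* A far index [M] is inserted. The part between [N] and [M] obeys the Lipschitz bound; the
     remainder beyond [M] is merely small, so it is absorbed in [e]. *)
  apply le_epsilon. intros e he.
  destruct (archimed_cor1 (e / (2 * K3 + 1))) as [n0 [hn0 hn1]].
  { apply Rdiv_lt_0_compat; lra. }
  set (M := Nat.max n0 N).
  assert (hn0' : 0 < INR n0) by (apply lt_0_INR; exact hn1).
  assert (hM : INR n0 <= INR M) by (apply le_INR; lia).
  assert (hsmall : K3 / INR M <= e / 2).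
  { apply Rle_trans with (K3 * (e / (2 * K3 + 1))).
    - apply Rmult_le_compat_l; [exact hK3 |].
      apply Rle_trans with (/ INR n0); [apply Rinv_le_contravar; lra | lra].
    - replace (K3 * (e / (2 * K3 + 1))) with (e / 2 * (2 * K3 / (2 * K3 + 1))) by (field; lra).
      assert (2 * K3 / (2 * K3 + 1) < 1) by (apply Rlt_div_l; lra). nra. }
  assert (X := h N M z1 z2 m1 m2 ltac:(lia) d1 d2).
  assert (Y1 := A z1 m1 d1 M ltac:(lia)). assert (Y2 := A z2 m2 d2 M ltac:(lia)).
  replace (sig_red z2 m2 - ring_prod N z2 m2 - (sig_red z1 m1 - ring_prod N z1 m1))%C
    with (((ring_prod M z2 m2 - ring_prod N z2 m2) - (ring_prod M z1 m1 - ring_prod N z1 m1))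
          + ((sig_red z2 m2 - ring_prod M z2 m2) - (sig_red z1 m1 - ring_prod M z1 m1)))%C by ring.
  eapply Rle_trans; [apply Cmod_triangle |].
  assert (W := Cmod_minus_le (sig_red z2 m2 - ring_prod M z2 m2) (sig_red z1 m1 - ring_prod M z1 m1)).
  lra.
Qed.

End Bounds.

Lemma ring_factor_sdiffable (D : R -> Prop) N z m : (1 <= N)%nat -> D m -> 0 < m ->
  sdiffable D (ring_factor N) z m.
Proof.
  intros hN hD hm. unfold ring_factor.
  assert (A : forall l, (forall ij, In ij l -> ell m ij <> 0%C) ->
    sdiffable D (fun z m => Cprod (map (fun ij => efac (z / ell m ij)) l)) z m).
  { induction l as [| ij l IH]; intros h.
    - exists 0%C, 0%C. exact (sdiff_const D 1%C z m).
    - destruct IH as [a [b IH]]. { intros; apply h; now right. }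
      assert (L : sdiff D (fun _ s => ell s ij) z m 0 (RtoC (IZR (snd ij)) * (2 * Ci))).
      { apply sdiff_of_pderiv.
        assert (X := pderiv_linear D (IZR (fst ij) * 1)%C (RtoC (IZR (snd ij)) * (2 * Ci))%C m).
        intros e he. destruct (X e he) as [d [hd X']]. exists d. split; [exact hd |].
        intros s hs hst. specialize (X' s hs hst).
        replace (ell s ij - ell m ij)%C with
          (IZR (fst ij) * 1 + RtoC (IZR (snd ij)) * (2 * Ci) * RtoC s -
            (IZR (fst ij) * 1 + RtoC (IZR (snd ij)) * (2 * Ci) * RtoC m))%C by (unfold ell; ring).
        exact X'. }
      assert (I := sdiff_inv D (fun _ s => ell s ij) z m _ _ hD (h ij (or_introl eq_refl)) L).
      assert (M := sdiff_mult D _ _ _ _ _ _ _ _ hD (sdiff_id D z m) I). cbv beta in M.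
      assert (Ef := sdiff_comp_outer D efac _ _ _ _ _ _ hD (efac_cstrict _) M).
      eexists. eexists. exact (sdiff_mult D _ _ _ _ _ _ _ _ hD Ef IH). }
  apply A. intros ij hij. apply Cmod_gt_0.
  assert (X := ell_lower m m N ij hm (Rle_refl m) hij).
  assert (0 < Rmin 1 (2 * m)) by (apply Rmin_glb_lt; lra).
  assert (0 < INR N) by (apply lt_0_INR; lia). nra.
Qed.

Lemma ring_prod_sdiffable (D : R -> Prop) N z m : D m -> 0 < m ->
  sdiffable D (ring_prod N) z m.
Proof.
  intros hD hm. induction N as [| N [a [b IH]]].
  - exists 0%C, 0%C. exact (sdiff_const D 1%C z m).
  - destruct (ring_factor_sdiffable D (S N) z m ltac:(lia) hD hm) as [a' [b' h]].
    eexists. eexists. exact (sdiff_mult D _ _ _ _ _ _ _ _ hD IH h).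
Qed.

(** The uniform bounds are taken on [Cmod <= Cmod z + 1] and [[m / 2, 2 * m]], a neighbourhood of
    [(z, m)] away from degenerate lattices. *)
Theorem sig_red_sdiffable z m : 0 < m -> sdiffable (fun _ => True) sig_red z m.
Proof.
  intros hm.
  set (R0 := Cmod z + 1). assert (hR : 0 <= R0) by (unfold R0; generalize (Cmod_ge_0 z); lra).
  destruct (ring_factor_bound R0 (m / 2) (2 * m)) as [K [hK hb]]; try lra.
  destruct (sig_red_tail R0 (m / 2) (2 * m) K hR hK hb) as [K2 [hK2 [_ hL]]].
  set (r := Rmin 1 (m / 2)). assert (hr : 0 < r) by (apply Rmin_glb_lt; lra).
  assert (r1 : r <= 1) by (unfold r; rmin). assert (r2 : r <= m / 2) by apply Rmin_r.
  apply (sdiffable_limit (fun _ => True) ring_prod sig_red z m K2 r); try easy.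
  - intros d hd. exists (m + d / 2). split; [easy |]. split; [lra |].
    replace (m + d / 2 - m) with (d / 2) by ring. rewrite Rabs_right; lra.
  - intros N. apply ring_prod_sdiffable; easy.
  - intros N z1 z2 s1 s2 hN h1 h2 _ _ h3 h4. apply hL; [exact hN | |].
    + apply Rabs_lt_between in h3. split; [| lra].
      assert (T := Cmod_triangle_sub z1 z). unfold R0. lra.
    + apply Rabs_lt_between in h4. split; [| lra].
      assert (T := Cmod_triangle_sub z2 z). unfold R0. lra.
Qed.

(** * Zeros of the product and its identification with the Weierstrass sigma function *)

Definition in_lattice (m : R) (z : C) : Prop :=
  exists i j : Z, z = (RtoC (IZR i) + RtoC (IZR j) * (2 * RtoC m * Ci))%C.

Lemma in_lattice_ell m ij : in_lattice m (ell m ij).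
Proof. exists (fst ij), (snd ij). unfold ell. ring. Qed.

Lemma sig_red_nonzero (z : C) (m : R) : 0 < m -> (z = 0%C \/ ~ in_lattice m z) -> sig_red z m <> 0%C.
Proof.
  intros hm hz.
  set (R0 := Cmod z). assert (hR : 0 <= R0) by apply Cmod_ge_0.
  destruct (ring_factor_bound R0 m m) as [K [hK hb]]; try lra.
  destruct (sig_red_tail R0 m m K hR hK hb) as [K2 [hK2 [hL _]]].
  assert (hd : sig_dom R0 m m z m) by (split; unfold R0; lra).
  assert (nz : forall N, ring_prod N z m <> 0%C).
  { destruct hz as [-> | hz].
    { intros N. rewrite ring_prod_0. intros h. apply RtoC_inj in h. lra. }
    induction N as [| N IH]. { intros h. apply RtoC_inj in h. lra. }
    cbn [ring_prod]. apply Cmult_neq_0; [exact IH |].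
    unfold ring_factor.
    assert (A : forall ij, In ij (ring_idx (S N)) -> ell m ij <> 0%C).
    { intros ij hij. apply Cmod_gt_0.
      assert (X := ell_lower m m (S N) ij hm (Rle_refl m) hij).
      assert (0 < Rmin 1 (2 * m)) by (apply Rmin_glb_lt; lra).
      assert (0 < INR (S N)) by (apply lt_0_INR; lia). nra. }
    revert A. induction (ring_idx (S N)) as [| ij l IHl]; intros A.
    { intros h. apply RtoC_inj in h. lra. }
    cbn [map Cprod fold_right]. apply Cmult_neq_0.
    - assert (h0 := A ij (or_introl eq_refl)). unfold efac. apply Cmult_neq_0; [| apply Cexp_neq_0].
      intros h. apply hz. replace z with (ell m ij). { apply in_lattice_ell. }
      replace z with ((1 - (1 - z / ell m ij)) * ell m ij)%C by (field; exact h0).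
      rewrite h. ring.
    - apply IHl. intros. apply A. now right. }
  set (K3 := K * exp K * R0).
  assert (hK3 : 0 <= K3).
  { unfold K3. apply Rmult_le_pos; [| exact hR]. apply Rmult_le_pos; [lra | left; apply exp_pos]. }
  destruct (archimed_cor1 (1 / (2 * K3 + 1))) as [N [hN hN1]].
  { apply Rdiv_lt_0_compat; lra. }
  assert (hi : 0 < INR N) by (apply lt_0_INR; exact hN1).
  assert (hs : K3 / INR N <= 1 / 2).
  { apply Rle_trans with (K3 * (1 / (2 * K3 + 1))).
    - apply Rmult_le_compat_l; lra.
    - replace (K3 * (1 / (2 * K3 + 1))) with (1 / 2 * (2 * K3 / (2 * K3 + 1))) by (field; lra).
      assert (2 * K3 / (2 * K3 + 1) < 1) by (apply Rlt_div_l; lra). lra. }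
  assert (low := fun M hM => ring_prod_lower R0 m m K hR hK hb N M z m hM hd hs).
  intros h0.
  assert (hp : 0 < Cmod (ring_prod N z m)) by (apply Cmod_gt_0, nz).
  destruct (archimed_cor1 (Cmod (ring_prod N z m) / 2 / (K2 + 1))) as [n0 [hn0 hn1]].
  { apply Rdiv_lt_0_compat; lra. }
  set (M := Nat.max n0 N).
  assert (X := hL M z m ltac:(lia) hd). specialize (low M ltac:(lia)).
  rewrite h0 in X. replace (0 - ring_prod M z m)%C with (- ring_prod M z m)%C in X by ring.
  rewrite Cmod_opp in X.
  assert (hn0' : 0 < INR n0) by (apply lt_0_INR; exact hn1).
  assert (hM : INR n0 <= INR M) by (apply le_INR; lia).
  assert (K2 / INR M < Cmod (ring_prod N z m) / 2).
  { apply Rle_lt_trans with (K2 * / INR n0).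
    - apply Rmult_le_compat_l; [exact hK2 | apply Rinv_le_contravar; lra].
    - apply Rlt_le_trans with ((K2 + 1) * / INR n0).
      + apply Rmult_lt_compat_r; [now apply Rinv_0_lt_compat | lra].
      + replace (Cmod (ring_prod N z m) / 2)
          with ((K2 + 1) * (Cmod (ring_prod N z m) / 2 / (K2 + 1))) by (field; lra).
        apply Rmult_le_compat_l; lra. }
  lra.
Qed.

Lemma Cprod_app l1 l2 : Cprod (l1 ++ l2) = (Cprod l1 * Cprod l2)%C.
Proof.
  induction l1 as [| x l IH]; cbn [app Cprod fold_right] in *.
  - unfold Cprod; simpl. ring.
  - unfold Cprod in *. cbn. rewrite IH. ring.
Qed.

Lemma Cprod_perm l1 l2 : Permutation l1 l2 -> Cprod l1 = Cprod l2.
Proof.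
  unfold Cprod. induction 1; cbn; try congruence. ring.
Qed.

(** Only the order of the factors changes. The factor [z] is the one of the lattice point 0, which
    is the whole box for [N = 0]. *)
Lemma box_prod z m N : 0 < m ->
  Cprod (map (fun l => sigma_factor l z) (lattice_box 1 (2 * m * Ci) N))
  = (z * ring_prod N z m)%C.
Proof.
  intros hm. unfold lattice_box. rewrite map_map.
  change (fun x => sigma_factor (IZR (fst x) * 1 + IZR (snd x) * (2 * m * Ci))%C z)
    with (fun x => sigma_factor (ell m x) z).
  induction N as [| N IH].
  - cbn [Zrange seq Nat.mul Nat.add map list_prod app Cprod fold_right ring_prod].
    unfold sigma_factor. destruct (Ceq_dec _ _) as [e | n]; [ring |].
    exfalso. apply n. unfold ell. simpl. ring.
  - rewrite (Cprod_perm _ _ (Permutation_map _ (box_ring N))), map_app, Cprod_app, IH.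
    cbn [ring_prod]. unfold ring_factor.
    replace (map (fun x => sigma_factor (ell m x) z) (ring_idx (S N)))
      with (map (fun ij => efac (z / ell m ij)) (ring_idx (S N))); [ring |].
    apply map_ext_in. intros ij hij. unfold sigma_factor.
    destruct (Ceq_dec _ _) as [e | n]; [| reflexivity].
    (* Points of a positive shell are nonzero, so [sigma_factor] is the primary factor there. *)
    exfalso. assert (X := ell_lower m m (S N) ij hm (Rle_refl m) hij).
    rewrite e, Cmod_0 in X.
    assert (0 < Rmin 1 (2 * m)) by (apply Rmin_glb_lt; lra).
    assert (0 < INR (S N)) by (apply lt_0_INR; lia). nra.
Qed.

Theorem wsigma_eq z m : 0 < m -> wsigma 1 (2 * m * Ci) z = (z * sig_red z m)%C.
Proof.
  intros hm. unfold wsigma. apply Clim_seq_unique. intros e he.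
  set (R0 := Cmod z). assert (hR : 0 <= R0) by apply Cmod_ge_0.
  destruct (ring_factor_bound R0 m m) as [K [hK hb]]; try lra.
  destruct (sig_red_tail R0 m m K hR hK hb) as [K2 [hK2 [hL _]]].
  assert (hd : sig_dom R0 m m z m) by (split; unfold R0; lra).
  destruct (archimed_cor1 (e / (R0 * K2 + 1))) as [n0 [hn0 hn1]].
  { apply Rdiv_lt_0_compat; nra. }
  assert (hn0' : 0 < INR n0) by (apply lt_0_INR; exact hn1).
  exists n0. intros n hn. rewrite box_prod by exact hm.
  replace (z * ring_prod n z m - z * sig_red z m)%C
    with (- (z * (sig_red z m - ring_prod n z m)))%C by ring.
  rewrite Cmod_opp, Cmod_mult. fold R0.
  assert (X := hL n z m ltac:(lia) hd).
  assert (hM : INR n0 <= INR n) by (apply le_INR; lia).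
  apply Rle_lt_trans with (R0 * (K2 * / INR n0)).
  - apply Rmult_le_compat_l; [exact hR |]. eapply Rle_trans; [exact X |].
    apply Rmult_le_compat_l; [exact hK2 | apply Rinv_le_contravar; lra].
  - apply Rlt_le_trans with ((R0 * K2 + 1) * / INR n0).
    + assert (0 < / INR n0) by now apply Rinv_0_lt_compat. nra.
    + apply Rle_trans with ((R0 * K2 + 1) * (e / (R0 * K2 + 1))).
      * apply Rmult_le_compat_l; [nra | lra].
      * apply Req_le. field. nra.
Qed.

(** * Reality of sigma on the real axis *)

Lemma Cexp_conj w : Cconj (Cexp w) = Cexp (Cconj w).
Proof. unfold Cexp, Cconj, Re, Im; simpl. rewrite cos_neg, sin_neg. f_equal. ring. Qed.

Lemma efac_conj w : Cconj (efac w) = efac (Cconj w).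
Proof.
  unfold efac. rewrite Cmult_conj, Cexp_conj. f_equal.
  - apply injective_projections; simpl; ring.
  - f_equal. rewrite Cplus_conj. f_equal. unfold Cdiv. rewrite Cmult_conj, Cpow_conj.
    f_equal. rewrite Cinv_conj by (intros h; apply RtoC_inj in h; lra).
    f_equal. apply injective_projections; simpl; ring.
Qed.

Lemma Zrange_opp N : Permutation (map Z.opp (Zrange N)) (Zrange N).
Proof.
  induction N as [| N IH]; [reflexivity |].
  rewrite Zrange_S. cbn [map]. rewrite map_app. cbn [map]. rewrite Z.opp_involutive.
  rewrite IH.
  transitivity ([Z.of_nat (S N)] ++ Zrange N ++ [(- Z.of_nat (S N))%Z]); [reflexivity |].
  rewrite Permutation_app_comm, <- app_assoc.
  rewrite (Permutation_app_comm (Zrange N)). cbn [app].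
  constructor. apply Permutation_cons_append.
Qed.

Lemma ring_idx_flip N :
  Permutation (map (fun ij => (fst ij, (- snd ij)%Z)) (ring_idx N)) (ring_idx N).
Proof.
  unfold ring_idx. rewrite !map_app, !map_map. cbn [fst snd].
  rewrite Z.opp_involutive.
  rewrite <- (map_map Z.opp (fun j => ((- Z.of_nat N)%Z, j)) (Zrange N)).
  rewrite <- (map_map Z.opp (fun j => (Z.of_nat N, j)) (Zrange N)).
  rewrite Zrange_opp. do 2 apply Permutation_app_head. apply Permutation_app_comm.
Qed.

(** Conjugation sends the lattice point with indices [(i, j)] to the one with [(i, - j)], which
    permutes every shell. *)
Lemma ring_factor_real N x m : Cconj (ring_factor N (RtoC x) m) = ring_factor N (RtoC x) m.
Proof.
  transitivity (Cprod (map (fun ij => efac (RtoC x / ell m ij))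
    (map (fun ij => (fst ij, (- snd ij)%Z)) (ring_idx N)))).
  - unfold ring_factor. rewrite map_map.
    induction (ring_idx N) as [| ij l IH].
    + apply injective_projections; simpl; ring.
    + cbn [map Cprod fold_right]. unfold Cprod in IH. rewrite Cmult_conj, IH, efac_conj.
      f_equal. f_equal. unfold Cdiv. rewrite Cmult_conj. f_equal.
      * apply injective_projections; simpl; ring.
      * replace (ell m (fst ij, (- snd ij)%Z)) with (Cconj (ell m ij)).
        (* Where [ell m ij] vanishes, the default value of [/ 0] commutes with conjugation too. *)
        -- destruct (Ceq_dec (ell m ij) 0) as [-> | n]; [| now rewrite Cinv_conj].
           apply injective_projections; simpl; unfold Rdiv; ring.
        -- unfold ell. cbn [fst snd]. rewrite opp_IZR.
           apply injective_projections; simpl; ring.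
  - unfold ring_factor. apply Cprod_perm, Permutation_map, ring_idx_flip.
Qed.

(* By invariance of the lattice under conjugation. *)
Lemma sig_red_real x m : Im (sig_red (RtoC x) m) = 0.
Proof.
  assert (A : forall N, Cconj (ring_prod N (RtoC x) m) = ring_prod N (RtoC x) m).
  { induction N as [| N IH].
    - apply injective_projections; simpl; ring.
    - cbn [ring_prod]. now rewrite Cmult_conj, IH, ring_factor_real. }
  unfold sig_red, Clim_seq. cbn [Im snd].
  rewrite (Lim_seq_ext _ (fun _ => 0)), Lim_seq_const; [reflexivity |].
  intros N. assert (X := f_equal Im (A N)). unfold Cconj, Im in *. simpl in X. lra.
Qed.

(** * Integrals along moving paths *)

(** Compactness in gauge form: a local radius, chosen at every point and allowed to shrink, can be
    replaced by a single radius on the whole interval. *)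
Lemma uniform_gauge (a b : R) (Q : R -> R -> Prop) :
  (forall x0, a <= x0 <= b -> exists d, 0 < d /\
     forall x, a <= x <= b -> Rabs (x - x0) < d -> Q x d) ->
  (forall x d d', Q x d -> 0 < d' <= d -> Q x d') ->
  exists d, 0 < d /\ forall x, a <= x <= b -> Q x d.
Proof.
  intros h hm.
  assert (hc : exists g : R -> posreal, forall x0, a <= x0 <= b ->
     forall x, a <= x <= b -> Rabs (x - x0) < g x0 -> Q x (g x0)).
  { exists (fun x0 => epsilon (inhabits (mkposreal 1 Rlt_0_1))
       (fun d : posreal => forall x, a <= x <= b -> Rabs (x - x0) < d -> Q x d)).
    intros x0 hx0. apply epsilon_spec. destruct (h x0 hx0) as [d [hd hQ]].
    now exists (mkposreal d hd). }
  destruct hc as [g hg].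
  destruct (compactness_value_1d a b g) as [d hd].
  exists d. split; [apply cond_pos |]. intros x hx.
  (* The compactness lemma concludes a double negation: some [x0] has [x] in its gauge ball and a
     gauge of at least [d]. *)
  destruct (NNPP _ (hd x hx)) as [x0 [hx0 [h1 h2]]].
  apply hm with (g x0); [now apply hg |]. split; [apply cond_pos | exact h2].
Qed.

Definition ccont (F : C -> C) (w : C) : Prop :=
  forall eps, 0 < eps -> exists d, 0 < d /\
    forall v, Cmod (v - w) < d -> Cmod (F v - F w) <= eps.

Lemma rcont_comp F p x : ccont F (p x) -> rcont p x -> rcont (fun y => F (p y)) x.
Proof.
  intros hF hp e he. destruct (hF (e / 2)) as [d [hd h]]; [lra |].
  destruct (hp d hd) as [d' [hd' h']]. exists d'. split; [exact hd' |].
  intros y hy. specialize (h _ (h' y hy)). lra.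
Qed.

Lemma rcont_plus f g x : rcont f x -> rcont g x -> rcont (fun y => f y + g y)%C x.
Proof.
  intros hf hg e he. destruct (hf (e / 2)) as [d [hd h]]; [lra |].
  destruct (hg (e / 2)) as [d' [hd' h']]; [lra |].
  exists (Rmin d d'). split; [now apply Rmin_glb_lt |]. intros y hy.
  pose_rmin.
  specialize (h y ltac:(lra)). specialize (h' y ltac:(lra)).
  replace (f y + g y - (f x + g x))%C with ((f y - f x) + (g y - g x))%C by ring.
  eapply Rle_lt_trans; [apply Cmod_triangle | lra].
Qed.

Lemma rcont_mult f g x : rcont f x -> rcont g x -> rcont (fun y => f y * g y)%C x.
Proof.
  intros hf hg e he.
  set (A := 1 + Cmod (f x) + Cmod (g x)).
  assert (p1 := Cmod_ge_0 (f x)). assert (p2 := Cmod_ge_0 (g x)).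
  assert (hA : 0 < A) by (unfold A; lra).
  set (q := Rmin 1 (e / (3 * A))).
  assert (hq : 0 < q) by (apply Rmin_glb_lt; [lra | apply Rdiv_lt_0_compat; lra]).
  assert (q1 : q <= 1) by apply Rmin_l. assert (q2 : q <= e / (3 * A)) by apply Rmin_r.
  destruct (hf q hq) as [d [hd h]]. destruct (hg q hq) as [d' [hd' h']].
  exists (Rmin d d'). split; [now apply Rmin_glb_lt |]. intros y hy.
  pose_rmin.
  specialize (h y ltac:(lra)). specialize (h' y ltac:(lra)).
  replace (f y * g y - f x * g x)%C
    with ((f y - f x) * (g y - g x) + (f x * (g y - g x) + g x * (f y - f x)))%C by ring.
  assert (T1 := Cmod_triangle ((f y - f x) * (g y - g x))
    (f x * (g y - g x) + g x * (f y - f x))).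
  assert (T2 := Cmod_triangle (f x * (g y - g x)) (g x * (f y - f x))).
  rewrite !Cmod_mult in T1. rewrite !Cmod_mult in T2.
  assert (P1 := Cmod_ge_0 (f y - f x)). assert (P2 := Cmod_ge_0 (g y - g x)).
  assert (A * q <= e / 3).
  { apply Rle_trans with (A * (e / (3 * A))); [nra | apply Req_le; field; lra]. }
  assert (Cmod (f y - f x) * Cmod (g y - g x) <= 1 * q) by nra.
  assert (Cmod (f x) * Cmod (g y - g x) <= Cmod (f x) * q) by nra.
  assert (Cmod (g x) * Cmod (f y - f x) <= Cmod (g x) * q) by nra.
  unfold A in *. nra.
Qed.

Lemma rcont_const c x : rcont (fun _ => c) x.
Proof. intros e he. exists 1. split; [lra |]. intros. now rewrite Cmod_self. Qed.

Lemma rcont_RtoC x : rcont (fun y => RtoC y) x.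
Proof.
  intros e he. exists e. split; [exact he |]. intros y hy. now rewrite <- RtoC_minus, Cmod_R.
Qed.

Lemma rcont_ext f g x : (forall y, f y = g y) -> rcont f x -> rcont g x.
Proof.
  intros E h e he. destruct (h e he) as [d [hd h']]. exists d. split; [exact hd |].
  intros. rewrite <- !E. now apply h'.
Qed.

Lemma rderiv_rcont f x l : rderiv f x l -> rcont f x.
Proof.
  intros h. apply rcont_continuous.
  apply (ex_derive_continuous (K := R_AbsRing) (V := C_R_NormedModule)).
  exists l. now apply rderiv_is_derive.
Qed.

Lemma rderiv_pderiv f x l : rderiv f x l <-> pderiv (fun _ => True) f x l.
Proof.
  split; intros h e he; destruct (h e he) as [d [hd h']]; exists d; auto.
Qed.

Lemma ex_RInt_rcont (f : R -> C) a b : a <= b -> (forall x, a <= x <= b -> rcont f x) ->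
  ex_RInt (V := C_R_NormedModule) f a b.
Proof.
  intros hab h. apply (ex_RInt_continuous (V := C_R_CompleteNormedModule)).
  intros z. rewrite Rmin_left, Rmax_right by exact hab. intros hz.
  apply rcont_continuous, h, hz.
Qed.

Definition CRInt (f : R -> C) (a b : R) : C := RInt (V := C_R_CompleteNormedModule) f a b.

Lemma is_RInt_CRInt f a b : a <= b -> (forall x, a <= x <= b -> rcont f x) ->
  is_RInt (V := C_R_NormedModule) f a b (CRInt f a b).
Proof.
  intros. apply (RInt_correct (V := C_R_CompleteNormedModule)). now apply ex_RInt_rcont.
Qed.

Lemma is_RInt_bound (f : R -> C) a b l M : a <= b ->
  (forall x, a <= x <= b -> Cmod (f x) <= M) ->
  is_RInt (V := C_R_NormedModule) f a b l -> Cmod l <= (b - a) * M.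
Proof.
  intros hab h hl. rewrite <- norm_C_R.
  apply (norm_RInt_le_const (V := C_R_NormedModule) f a b l M); auto.
  intros. rewrite norm_C_R. auto.
Qed.

Lemma rcont_bounded (f : R -> C) a b : (forall x, a <= x <= b -> rcont f x) ->
  exists M, 0 <= M /\ forall x, a <= x <= b -> Cmod (f x) <= M.
Proof.
  intros h. destruct (bounded_continuity (V := C_R_NormedModule) f a b) as [M hM].
  { intros x hx. apply rcont_continuous, h, hx. }
  exists (Rabs M). split; [apply Rabs_pos |]. intros x hx. specialize (hM x hx).
  rewrite norm_C_R in hM. generalize (Rle_abs M). lra.
Qed.

(** A short increment starting at [v] is compared with [a w] by strictness at [w], and with [a v] by
    differentiability at [v]. *)
Lemma cstrict_deriv_cont (F a : C -> C) w r : 0 < r -> cstrict F w (a w) ->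
  (forall v, Cmod (v - w) < r -> cderiv F v (a v)) -> ccont a w.
Proof.
  intros hr hw hv e he. destruct (hw (e / 2)) as [d [hd h]]; [lra |].
  exists (Rmin r (d / 2)). split. { apply Rmin_glb_lt; lra. }
  pose_rmin.
  intros v hvw. destruct (hv v ltac:(lra) (e / 2)) as [d2 [hd2 h2]]; [lra |].
  set (q := Rmin (d / 2) (d2 / 2)).
  assert (hq : 0 < q) by (apply Rmin_glb_lt; lra).
  assert (q1 : q <= d / 2) by apply Rmin_l. assert (q2 : q <= d2 / 2) by apply Rmin_r.
  set (v' := (v + RtoC q)%C).
  assert (E : (v' - v)%C = RtoC q) by (unfold v'; ring).
  assert (E2 : Cmod (v' - v) = q) by (rewrite E, Cmod_R; apply Rabs_right; lra).
  specialize (h2 v' ltac:(lra)).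
  assert (hv' : Cmod (v' - w) < d).
  { replace (v' - w)%C with ((v - w) + (v' - v))%C by ring.
    eapply Rle_lt_trans; [apply Cmod_triangle | lra]. }
  specialize (h v v' ltac:(lra) hv').
  apply Rmult_le_reg_r with q; [lra |].
  replace (Cmod (a v - a w) * q) with (Cmod ((a v - a w) * (v' - v)))
    by (rewrite Cmod_mult, E2; ring).
  replace ((a v - a w) * (v' - v))%C
    with ((F v' - F v - a w * (v' - v)) - (F v' - F v - a v * (v' - v)))%C by ring.
  eapply Rle_trans; [apply Cmod_minus_le |]. rewrite E2 in *. lra.
Qed.

Lemma is_RInt_Cminus (f g : R -> C) a b (l1 l2 : C) :
  is_RInt (V := C_R_NormedModule) f a b l1 -> is_RInt (V := C_R_NormedModule) g a b l2 ->
  is_RInt (V := C_R_NormedModule) (fun x => f x - g x)%C a b (l1 - l2)%C.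
Proof. intros h1 h2. exact (is_RInt_minus (V := C_R_NormedModule) f g a b l1 l2 h1 h2). Qed.

Lemma scal_C_R (r : R) (z : C) : scal (V := C_R_NormedModule) r z = (RtoC r * z)%C.
Proof. apply injective_projections; unfold scal; simpl; unfold scal, mult; simpl; unfold mult; simpl; ring. Qed.

Lemma is_RInt_Cscal (f : R -> C) (r : R) a b (l : C) :
  is_RInt (V := C_R_NormedModule) f a b l ->
  is_RInt (V := C_R_NormedModule) (fun x => RtoC r * f x)%C a b (RtoC r * l)%C.
Proof.
  intros h. rewrite <- scal_C_R.
  apply (is_RInt_ext (V := C_R_NormedModule) (fun x => scal r (f x))).
  - intros. apply scal_C_R.
  - now apply (is_RInt_scal (V := C_R_NormedModule)).
Qed.

Section PathVariation.

Variables (D : R -> Prop) (t : R) (G : C -> R -> C) (a b : C -> C).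
Variable Om : C -> R -> Prop.
Variables p dp : R -> C.
Variables e k : R.
Hypothesis hD : D t.
Hypothesis hk : 0 <= k <= 1.
Hypothesis he0 : 0 <= e.
Hypothesis hek : e + k <= 1.
Hypothesis hp : C1_path p dp.
Hypothesis hO : forall x, 0 <= x <= 1 -> exists r, 0 < r /\ forall xi s,
  Cmod (xi - p x) < r -> D s -> Rabs (s - t) < r -> Om xi s.
Hypothesis hC : forall xi s, D s -> Om xi s -> ccont (fun z => G z s) xi.
Hypothesis hS : forall xi, Om xi t -> sdiff D G xi t (a xi) (b xi).
Hypothesis hb : forall xi, Om xi t -> ccont b xi.

Lemma path_rcont x : 0 <= x <= 1 -> rcont p x.
Proof.
  intros hx. apply (rderiv_rcont p x (dp x)). apply rderiv_is_derive. now apply hp.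
Qed.

Lemma dpath_rcont x : 0 <= x <= 1 -> rcont dp x.
Proof. intros hx. apply rcont_continuous. now apply hp. Qed.

Lemma phi_bound x : 0 <= x <= 1 -> 0 <= e + k * x <= 1.
Proof. intros. nra. Qed.

Lemma path_near_open : exists d, 0 < d /\ forall x v s, 0 <= x <= 1 -> Cmod v < d ->
  D s -> Rabs (s - t) < d -> Om (p x + v * RtoC (e + k * x))%C s.
Proof.
  destruct (uniform_gauge 0 1 (fun x d => forall xi s,
     Cmod (xi - p x) < d -> D s -> Rabs (s - t) < d -> Om xi s)) as [d [hd h]].
  - intros x0 hx0. destruct (hO x0 hx0) as [r [hr h]].
    destruct (path_rcont x0 hx0 (r / 2)) as [d' [hd' h']]; [lra |].
    exists (Rmin (r / 2) d'). split. { apply Rmin_glb_lt; lra. }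
    pose_rmin.
    intros x hx hxx xi s h1 hs h2. apply h; try assumption; try lra.
    specialize (h' x ltac:(lra)).
    replace (xi - p x0)%C with ((xi - p x) + (p x - p x0))%C by ring.
    eapply Rle_lt_trans; [apply Cmod_triangle | lra].
  - intros x d d' h hd xi s h1 hs h2. apply h; try assumption; lra.
  - exists d. split; [exact hd |]. intros x v s hx hv hs hst.
    apply (h x hx); try assumption.
    replace (p x + v * RtoC (e + k * x) - p x)%C with (v * RtoC (e + k * x))%C by ring.
    rewrite Cmod_mult, Cmod_R. assert (P := phi_bound x hx). rewrite Rabs_right by lra.
    generalize (Cmod_ge_0 v). nra.
Qed.

Lemma Om_path x : 0 <= x <= 1 -> Om (p x) t.
Proof.
  intros hx. destruct (hO x hx) as [r [hr h]]. apply h; [| exact hD |].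
  - rewrite Cmod_self. exact hr.
  - rewrite Rminus_eq_0, Rabs_R0. exact hr.
Qed.

Lemma a_cont x : 0 <= x <= 1 -> ccont a (p x).
Proof.
  intros hx. destruct (hO x hx) as [r [hr h]].
  apply (cstrict_deriv_cont (fun z => G z t) a (p x) r hr).
  - eapply sdiff_cstrict; [exact hD | apply hS, Om_path, hx].
  - intros v hv. eapply cstrict_cderiv, sdiff_cstrict; [exact hD | apply hS].
    apply h; [exact hv | exact hD |]. now rewrite Rminus_eq_0, Rabs_R0.
Qed.

(** Strictness matters here: the expansion at [p x0] may be based at the nearby point [p x], and
    replacing the coefficients at [p x0] by those at [p x] costs only their continuity. A common
    radius then exists by compactness. *)
Lemma path_uniform_sdiff eps : 0 < eps -> exists d, 0 < d /\ forall x, 0 <= x <= 1 ->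
  forall xi s, Cmod (xi - p x) < d -> D s -> Rabs (s - t) < d ->
  Cmod (G xi s - G (p x) t - a (p x) * (xi - p x) - b (p x) * RtoC (s - t))
    <= eps * (Cmod (xi - p x) + Rabs (s - t)).
Proof.
  intros heps.
  apply (uniform_gauge 0 1 (fun x d => forall xi s, Cmod (xi - p x) < d -> D s ->
    Rabs (s - t) < d ->
    Cmod (G xi s - G (p x) t - a (p x) * (xi - p x) - b (p x) * RtoC (s - t))
    <= eps * (Cmod (xi - p x) + Rabs (s - t)))).
  - intros x0 hx0.
    destruct (hS (p x0) (Om_path x0 hx0) (eps / 3)) as [d0 [hd0 S]]; [lra |].
    destruct (path_rcont x0 hx0 (d0 / 2)) as [d1 [hd1 h1]]; [lra |].
    destruct (rcont_comp a p x0 (a_cont x0 hx0) (path_rcont x0 hx0) (eps / 3))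
      as [d2 [hd2 h2]]; [lra |].
    destruct (rcont_comp b p x0 (hb _ (Om_path x0 hx0)) (path_rcont x0 hx0) (eps / 3))
      as [d3 [hd3 h3]]; [lra |].
    set (d := Rmin (Rmin (d0 / 2) d1) (Rmin d2 d3)).
    assert (B : d <= d0 / 2 /\ d <= d1 /\ d <= d2 /\ d <= d3).
    { unfold d. repeat split; rmin. }
    exists d. split. { unfold d. repeat apply Rmin_glb_lt; lra. }
    destruct B as (B0 & B1 & B2 & B3).
    intros x hx hxx xi s hxi hs hst.
    specialize (h1 x ltac:(lra)). specialize (h2 x ltac:(lra)). specialize (h3 x ltac:(lra)).
    assert (hxi0 : Cmod (xi - p x0) < d0).
    { replace (xi - p x0)%C with ((xi - p x) + (p x - p x0))%C by ring.
      eapply Rle_lt_trans; [apply Cmod_triangle | lra]. }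
    specialize (S (p x) xi s ltac:(lra) hxi0 hs ltac:(lra)).
    replace (G xi s - G (p x) t - a (p x) * (xi - p x) - b (p x) * RtoC (s - t))%C
      with ((G xi s - G (p x) t - a (p x0) * (xi - p x) - b (p x0) * RtoC (s - t))
            - ((a (p x) - a (p x0)) * (xi - p x) + (b (p x) - b (p x0)) * RtoC (s - t)))%C by ring.
    eapply Rle_trans; [apply Cmod_minus_le |].
    assert (T := Cmod_triangle ((a (p x) - a (p x0)) * (xi - p x))
                   ((b (p x) - b (p x0)) * RtoC (s - t))).
    rewrite !Cmod_mult, Cmod_R in T.
    generalize (Cmod_ge_0 (xi - p x)), (Rabs_pos (s - t)). intros. nra.
  - intros x d d' h hd xi s h1 hs h2. apply h; try assumption; lra.
Qed.

(** First variation of a path integral when the path is displaced by [v * (e + k x)] and time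
    changes as well. Two cases are used: [e = 0, k = 1] keeps the starting point and moves the end
    point, [e = 1, k = 0] translates the whole path. The derivative in [v] involves only the end
    points because the corresponding integrand is exact. *)
Theorem path_variation eps : 0 < eps -> exists d, 0 < d /\
  forall v s, Cmod v < d -> D s -> Rabs (s - t) < d ->
  Cmod (path_integral (fun xi => G xi s) (fun x => p x + v * RtoC (e + k * x))%C
          (fun x => dp x + v * RtoC k)%C
        - path_integral (fun xi => G xi t) p dp
        - v * (G (p 1) t * RtoC (e + k) - G (p 0) t * RtoC e)
        - RtoC (s - t) * CRInt (fun x => b (p x) * dp x)%C 0 1)
    <= eps * (Cmod v + Rabs (s - t)).
Proof.
  intros heps.
  assert (ca : forall x, 0 <= x <= 1 -> rcont (fun x => a (p x)) x)
    by (intros; apply rcont_comp; [apply a_cont | apply path_rcont]; assumption).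
  assert (cb : forall x, 0 <= x <= 1 -> rcont (fun x => b (p x)) x)
    by (intros; apply rcont_comp; [apply hb, Om_path | apply path_rcont]; assumption).
  destruct (rcont_bounded dp 0 1 dpath_rcont) as [M1 [hM1 hdp]].
  destruct (rcont_bounded _ 0 1 ca) as [M2 [hM2 ha]].
  destruct (rcont_bounded _ 0 1 cb) as [M3 [hM3 hbb]].
  set (M := M1 + M2 + M3 + 1).
  set (q := Rmin 1 (eps / (2 * M))).
  assert (hM : 0 < M) by (unfold M; lra).
  assert (hq : 0 < q) by (apply Rmin_glb_lt; [lra | apply Rdiv_lt_0_compat; lra]).
  assert (q1 : q <= 1) by apply Rmin_l. assert (q2 : q <= eps / (2 * M)) by apply Rmin_r.
  assert (qM : q * M <= eps / 2).
  { apply Rle_trans with (eps / (2 * M) * M); [nra | apply Req_le; field; lra]. }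
  destruct (path_uniform_sdiff q hq) as [d1 [hd1 U]].
  destruct path_near_open as [d2 [hd2 O]].
  exists (Rmin q (Rmin d1 d2)). split. { apply Rmin_glb_lt; [exact hq | now apply Rmin_glb_lt]. }
  pose_rmin.
  pose_rmin.
  intros v s hv hs hst.
  assert (pv := Cmod_ge_0 v). assert (ps := Rabs_pos (s - t)).
  assert (I1 : is_RInt (V := C_R_NormedModule)
     (fun x => G (p x + v * RtoC (e + k * x)) s * (dp x + v * RtoC k))%C 0 1
     (path_integral (fun xi => G xi s) (fun x => p x + v * RtoC (e + k * x))%C
          (fun x => dp x + v * RtoC k)%C)).
  { apply is_RInt_CRInt; [lra |]. intros x hx. apply rcont_mult.
    - apply (rcont_comp (fun z => G z s) (fun x => p x + v * RtoC (e + k * x))%C).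
      + apply hC; [exact hs |]. apply O; try assumption; lra.
      + apply rcont_plus; [apply path_rcont, hx |].
        apply rcont_mult; [apply rcont_const |].
        apply (rcont_ext (fun y => RtoC e + RtoC k * RtoC y)%C).
        { intros. now rewrite RtoC_plus, RtoC_mult. }
        apply rcont_plus; [apply rcont_const |].
        apply rcont_mult; [apply rcont_const | apply rcont_RtoC].
    - apply rcont_plus; [apply dpath_rcont, hx | apply rcont_const]. }
  assert (I0 : is_RInt (V := C_R_NormedModule) (fun x => G (p x) t * dp x)%C 0 1
     (path_integral (fun xi => G xi t) p dp)).
  { apply is_RInt_CRInt; [lra |]. intros x hx. apply rcont_mult; [| apply dpath_rcont, hx].
    apply (rcont_comp (fun z => G z t) p); [apply hC; [exact hD | apply Om_path, hx] | apply path_rcont, hx]. }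
  assert (Ib : is_RInt (V := C_R_NormedModule) (fun x => b (p x) * dp x)%C 0 1
     (CRInt (fun x => b (p x) * dp x)%C 0 1)).
  { apply is_RInt_CRInt; [lra |]. intros x hx. apply rcont_mult; [apply cb, hx | apply dpath_rcont, hx]. }
  apply (is_RInt_Cscal _ (s - t)) in Ib.
  (* The part of the integrand that is linear in [v] is the derivative of
     [v * G (p x) t * (e + k x)] along the path. *)
  assert (If : is_RInt (V := C_R_NormedModule)
     (fun x => v * (a (p x) * dp x * RtoC (e + k * x) + G (p x) t * RtoC k))%C 0 1
     (v * (G (p 1) t * RtoC (e + k * 1)) - v * (G (p 0) t * RtoC (e + k * 0)))%C).
  { apply (is_RInt_derive (V := C_R_CompleteNormedModule)
       (fun x => v * (G (p x) t * RtoC (e + k * x)))%C).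
    - intros x. rewrite Rmin_left, Rmax_right by lra. intros hx.
      apply rderiv_is_derive, rderiv_pderiv.
      assert (T : (fun _ : R => True) x) by easy.
      assert (X1 : sdiff (fun _ => True) (fun _ s => p s) 0 x 0 (dp x)).
      { apply sdiff_of_pderiv, rderiv_pderiv, rderiv_is_derive. now apply hp. }
      assert (X2 := sdiff_comp_outer (fun _ => True) (fun z => G z t) _ _ _ _ _ _ T
        (sdiff_cstrict D G _ _ _ _ hD (hS _ (Om_path x hx))) X1).
      assert (X3 := sdiff_of_pderiv _ _ 0 _ _
          (pderiv_linear (fun _ => True) (RtoC e) (RtoC k) x)).
      assert (X4 := sdiff_scal (fun _ => True) v _ _ _ _ _ T
         (sdiff_mult (fun _ => True) _ _ _ _ _ _ _ _ T X2 X3)).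
      cbv beta in X4.
      refine (sdiff_pderiv _ (fun _ x => (v * (G (p x) t * RtoC (e + k * x)))%C) 0 _ 0 _ _).
      refine (sdiff_ext _ _ _ 0 x _ _ 1 Rlt_0_1 T _ (sdiff_eq _ _ _ _ _ _ _ _ X4 _ _)).
      + intros. cbv beta. now rewrite RtoC_plus, RtoC_mult.
      + ring.
      + rewrite RtoC_plus, RtoC_mult. ring.
    - intros x. rewrite Rmin_left, Rmax_right by lra. intros hx. apply rcont_continuous.
      assert (cphi : rcont (fun y => RtoC (e + k * y)) x).
      { apply (rcont_ext (fun y => RtoC e + RtoC k * RtoC y)%C).
        { intros. now rewrite RtoC_plus, RtoC_mult. }
        apply rcont_plus; [apply rcont_const |].
        apply rcont_mult; [apply rcont_const | apply rcont_RtoC]. }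
      apply rcont_mult; [apply rcont_const |].
      apply rcont_plus.
      + apply rcont_mult; [| exact cphi].
        apply rcont_mult; [apply ca, hx | apply dpath_rcont, hx].
      + apply rcont_mult; [| apply rcont_const].
        apply (rcont_comp (fun z => G z t) p); [apply hC; [exact hD | apply Om_path, hx] | apply path_rcont, hx]. }
  assert (I := is_RInt_Cminus _ _ _ _ _ _
    (is_RInt_Cminus _ _ _ _ _ _ (is_RInt_Cminus _ _ _ _ _ _ I1 I0) If) Ib).
  rewrite Rmult_1_r, Rmult_0_r, Rplus_0_r in I.
  replace (v * (G (p 1) t * RtoC (e + k)) - v * (G (p 0) t * RtoC e))%C
    with (v * (G (p 1) t * RtoC (e + k) - G (p 0) t * RtoC e))%C in I by ring.
  replace (eps * (Cmod v + Rabs (s - t))) with ((1 - 0) * (eps * (Cmod v + Rabs (s - t)))) by ring.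
  refine (is_RInt_bound _ 0 1 _ _ Rle_0_1 _ I). clear I.
  intros x hx.
  match goal with |- Cmod ?X <= _ =>
    replace X with
      ((G (p x + v * RtoC (e + k * x)) s - G (p x) t - a (p x) * (v * RtoC (e + k * x))
         - b (p x) * RtoC (s - t)) * (dp x + v * RtoC k)
       + (a (p x) * (v * RtoC (e + k * x)) + b (p x) * RtoC (s - t)) * (v * RtoC k))%C by ring
  end.
  assert (P := phi_bound x hx).
  assert (hphi : Cmod (v * RtoC (e + k * x)) <= Cmod v).
  { rewrite Cmod_mult, Cmod_R, Rabs_right by lra. nra. }
  assert (hvk : Cmod (v * RtoC k) <= Cmod v).
  { rewrite Cmod_mult, Cmod_R, Rabs_right by lra. nra. }
  specialize (U x hx (p x + v * RtoC (e + k * x))%C s).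
  replace (p x + v * RtoC (e + k * x) - p x)%C with (v * RtoC (e + k * x))%C in U by ring.
  specialize (U ltac:(lra) hs ltac:(lra)).
  set (w := (v * RtoC (e + k * x))%C) in *. set (vk := (v * RtoC k)%C) in *.
  set (rr := (G (p x + w) s - G (p x) t - a (p x) * w - b (p x) * RtoC (s - t))%C) in *.
  eapply Rle_trans; [apply Cmod_triangle |]. rewrite !Cmod_mult.
  set (u := Cmod v + Rabs (s - t)) in *.
  assert (hu : 0 <= u) by (unfold u; lra).
  assert (Y1 : Cmod rr <= q * u).
  { eapply Rle_trans; [apply U |]. apply Rmult_le_compat_l; unfold u; lra. }
  assert (Y2 : Cmod (dp x + vk) <= M1 + 1).
  { eapply Rle_trans; [apply Cmod_triangle |]. specialize (hdp x hx). lra. }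
  assert (Y3 : Cmod (a (p x) * w + b (p x) * RtoC (s - t)) <= (M2 + M3) * u).
  { eapply Rle_trans; [apply Cmod_triangle |]. rewrite !Cmod_mult, Cmod_R.
    specialize (ha x hx). specialize (hbb x hx). cbv beta in ha, hbb.
    assert (Cmod (a (p x)) * Cmod w <= M2 * u)
      by (apply Rmult_le_compat; try apply Cmod_ge_0; unfold u; lra).
    assert (Cmod (b (p x)) * Rabs (s - t) <= M3 * u)
      by (apply Rmult_le_compat; try apply Cmod_ge_0; try apply Rabs_pos; unfold u; lra).
    lra. }
  assert (Z1 : Cmod rr * Cmod (dp x + vk) <= (q * u) * (M1 + 1))
    by (apply Rmult_le_compat; try apply Cmod_ge_0; lra).
  assert (Z2 : Cmod (a (p x) * w + b (p x) * RtoC (s - t)) * Cmod vk <= ((M2 + M3) * u) * q)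
    by (apply Rmult_le_compat; try apply Cmod_ge_0; lra).
  assert (Z3 : q * M * u <= eps / 2 * u) by (apply Rmult_le_compat_r; lra).
  unfold M in Z3. nra.
Qed.

End PathVariation.

(** * Horizontal periods of 1-periodic functions *)

Definition hperiod (h : C -> C) (w : C) : C := CRInt (fun x => h (w + RtoC x)%C) 0 1.

Lemma rderiv_affine (w : C) x : rderiv (fun y => w + RtoC y)%C x 1.
Proof.
  intros e he. exists 1. split; [lra |]. intros y _.
  replace (w + RtoC y - (w + RtoC x) - 1 * RtoC (y - x))%C with (RtoC 0)
    by (rewrite RtoC_minus; ring).
  rewrite Cmod_0. generalize (Rabs_pos (y - x)). nra.
Qed.

Lemma im_add_real (w : C) x : Im (w + RtoC x) = Im w.
Proof. unfold Im; simpl; ring. Qed.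

Lemma CRInt_ext f g a b : a <= b -> (forall x, a <= x <= b -> f x = g x) ->
  CRInt f a b = CRInt g a b.
Proof.
  intros hab h. apply (RInt_ext (V := C_R_CompleteNormedModule)).
  intros x. rewrite Rmin_left, Rmax_right by exact hab. intros. apply h. lra.
Qed.

Lemma cderiv_ccont H w a : cderiv H w a -> ccont H w.
Proof. exact (cderiv_cont H w a). Qed.

(** Translating the segment, the first variation is [h (w + 1) - h w], which vanishes by
    periodicity. Hence the derivative in [w] is zero throughout the strip. *)
Lemma hperiod_const (h : C -> C) (lo hi : R) :
  (forall z, lo < Im z < hi -> exists a, cstrict h z a) ->
  (forall z, lo < Im z < hi -> h (z + 1)%C = h z) ->
  forall w1 w2, lo < Im w1 < hi -> lo < Im w2 < hi -> hperiod h w1 = hperiod h w2.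
Proof.
  intros hex hper.
  set (h' := fun z => epsilon (inhabits (RtoC 0)) (cstrict h z)).
  assert (hh : forall z, lo < Im z < hi -> cstrict h z (h' z)).
  { intros z hz. apply (epsilon_spec (inhabits (RtoC 0)) (cstrict h z)), hex, hz. }
  assert (A : forall w, lo < Im w < hi -> cderiv (hperiod h) w 0).
  { intros w hw e he.
    (* Time is the single point 0, and [e = 1, k = 0] displaces the whole segment. *)
    destruct (path_variation (fun s => s = 0) 0 (fun z _ => h z) h' (fun _ => 0%C)
      (fun z _ => lo < Im z < hi) (fun x => w + RtoC x)%C (fun _ => 1%C) 1 0) with (eps := e)
      as [d [hd V]]; try lra; try reflexivity.
    - intros x hx. split.
      + apply rderiv_is_derive, rderiv_affine.
      + apply rcont_continuous, rcont_const.
    - intros x hx. exists (Rmin (Im w - lo) (hi - Im w)). split; [apply Rmin_glb_lt; lra |].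
      intros xi s hxi _ _.
      assert (B := im_le_Cmod (xi - (w + RtoC x))).
      replace (Im (xi - (w + RtoC x))) with (Im xi - Im w) in B by (unfold Im; simpl; ring).
      pose_rmin.
      assert (B' : Rabs (Im xi - Im w) < Rmin (Im w - lo) (hi - Im w)) by lra.
      apply Rabs_lt_between in B'. lra.
    - intros xi s _ hxi. apply (cderiv_ccont h xi (h' xi)), cstrict_cderiv, hh, hxi.
    - intros xi hxi. apply sdiff_of_cstrict, hh, hxi.
    - intros xi _ e0 he0. exists 1. split; [lra |]. intros. rewrite Cmod_self. lra.
    - exists d. split; [exact hd |]. intros w' hw'.
      specialize (V (w' - w)%C 0 hw' eq_refl). rewrite Rminus_eq_0, Rabs_R0 in V.
      specialize (V hd). rewrite Rplus_0_r in V.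
      match type of V with Cmod ?X <= ?Y * ?Z =>
        replace X with (hperiod h w' - hperiod h w - 0 * (w' - w))%C in V;
        [replace Z with (Cmod (w' - w)) in V by ring; exact V |] end.
      unfold path_integral. fold (CRInt (fun s : R =>
         (h (w + RtoC s + (w' - w) * RtoC (1 + 0 * s)) * (1 + (w' - w) * RtoC 0))%C) 0 1).
      fold (CRInt (fun s : R => (h (w + RtoC s) * 1)%C) 0 1).
      replace (h (w + RtoC 1)%C) with (h (w + RtoC 0)%C).
      2:{ replace (w + RtoC 0)%C with w by ring. symmetry. apply hper, hw. }
      replace (CRInt (fun s : R => (h (w + RtoC s + (w' - w) * RtoC (1 + 0 * s))
                * (1 + (w' - w) * RtoC 0))%C) 0 1) with (hperiod h w').
      2:{ apply CRInt_ext; [lra |]. intros x _. rewrite Rmult_0_l, Rplus_0_r.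
          replace (w + RtoC x + (w' - w) * RtoC 1)%C with (w' + RtoC x)%C by ring. ring. }
      replace (CRInt (fun s : R => (h (w + RtoC s) * 1)%C) 0 1) with (hperiod h w).
      2:{ apply CRInt_ext; [lra |]. intros x _. ring. }
      ring. }
  intros w1 w2 h1 h2.
  assert (Z : Cmod (hperiod h w1 - hperiod h w2) <= 2 * 0 * Cmod (w1 - w2)).
  { apply (cmean (hperiod h) (fun _ => 0%C)).
    - intros x hx. apply A.
      replace (Im (segpt w2 w1 x)) with ((1 - x) * Im w2 + x * Im w1)
        by (unfold segpt, Im; simpl; ring).
      assert (0 <= (1 - x) * (Im w2 - lo)) by (apply Rmult_le_pos; lra).
      assert (0 <= (1 - x) * (hi - Im w2)) by (apply Rmult_le_pos; lra).
      destruct (Req_dec x 0) as [-> | hx0]; [lra |].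
      assert (0 < x * (Im w1 - lo)) by (apply Rmult_lt_0_compat; lra).
      assert (0 < x * (hi - Im w1)) by (apply Rmult_lt_0_compat; lra). lra.
    - intros. rewrite Cmod_0. lra. }
  rewrite Rmult_0_r, Rmult_0_l in Z.
  assert (E : (hperiod h w1 - hperiod h w2)%C = 0%C)
    by (apply Cmod_eq_0, Rle_antisym; [exact Z | apply Cmod_ge_0]).
  replace (hperiod h w1) with ((hperiod h w1 - hperiod h w2) + hperiod h w2)%C by ring.
  rewrite E. ring.
Qed.

(** * Poisson kernels and the jump across a horizontal line of simple poles *)

Lemma sum_sq_pos a y : 0 < y -> 0 < a ^ 2 + y ^ 2.
Proof. intros h. assert (0 < y ^ 2) by now apply pow_lt. assert (X := pow2_ge_0 a). lra. Qed.

Lemma is_RInt_poisson (c y : R) : 0 < y ->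
  is_RInt (fun x => y / ((c + x) ^ 2 + y ^ 2)) 0 1 (atan ((c + 1) / y) - atan (c / y)).
Proof.
  intros hy.
  replace (atan (c / y)) with (atan ((c + 0) / y)) by (now rewrite Rplus_0_r).
  apply (is_RInt_derive (V := R_CompleteNormedModule) (fun x => atan ((c + x) / y))).
  - intros x _. auto_derive; [exact I |]. field. split; apply Rgt_not_eq; [now apply sum_sq_pos | lra].
  - intros x _. apply continuity_pt_filterlim, derivable_continuous_pt.
    apply ex_derive_Reals_0. auto_derive. now apply Rgt_not_eq, sum_sq_pos.
Qed.

Lemma poisson_integral_le (c y : R) : 0 < y -> atan ((c + 1) / y) - atan (c / y) <= PI.
Proof. intros _. destruct (atan_bound ((c + 1) / y)), (atan_bound (c / y)). lra. Qed.

Lemma atan_le_id x : 0 <= x -> atan x <= x.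
Proof.
  intros hx. destruct (MVT_gen (fun x => x - atan x) 0 x (fun x => 1 - / (1 + x ^ 2))) as [c [hc E]].
  - intros u _. auto_derive; [exact I |]. field. apply Rgt_not_eq; nra.
  - intros u _. apply derivable_continuous_pt, ex_derive_Reals_0. auto_derive. exact I.
  - rewrite atan_0 in E.
    assert (/ (1 + c ^ 2) <= 1) by (rewrite <- Rinv_1; apply Rinv_le_contravar; nra).
    nra.
Qed.

(** For a pole strictly inside the unit interval, at distances [u] and [v] from its ends, the mass
    of the kernel of width [y] tends to [PI] at an explicit rate. *)
Lemma poisson_mass (u v y : R) : 0 < u -> 0 < v -> 0 < y ->
  Rabs (atan (u / y) - atan (- v / y) - PI) <= y / u + y / v.
Proof.
  intros hu hv hy.
  assert (A : forall w, 0 < w -> PI / 2 - y / w <= atan (w / y)).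
  { intros w hw. assert (P : 0 < y / w) by (apply Rdiv_lt_0_compat; lra).
    replace (w / y) with (/ (y / w)) by (field; lra).
    rewrite atan_inv by exact P. assert (X := atan_le_id (y / w) ltac:(lra)). lra. }
  replace (- v / y) with (- (v / y)) by (field; lra). rewrite atan_opp.
  assert (X := A u hu). assert (Y := A v hv).
  destruct (atan_bound (u / y)), (atan_bound (v / y)).
  apply Rabs_le. lra.
Qed.

Lemma rderiv_RtoC (g : R -> R) x l : is_derive g x l -> rderiv (fun y => RtoC (g y)) x (RtoC l).
Proof.
  intros h e he. destruct (proj1 (is_derive_eps _ _ _) h e he) as [d [hd h']].
  exists d. split; [exact hd |]. intros y hy.
  rewrite <- RtoC_mult, <- !RtoC_minus, Cmod_R. now apply h'.
Qed.

(** Subtracting a simple pole seen from height [y] below it from the same pole seen from [y] above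
    gives [- 2 i gm] times the Poisson kernel of width [y]. *)
Lemma pole_difference_integral (gm p : C) (al y : R) : 0 < y ->
  is_RInt (V := C_R_NormedModule)
    (fun x => gm / (RtoC (al + x) + Ci * RtoC (Im p + y) - p)
              - gm / (RtoC (al + x) + Ci * RtoC (Im p - y) - p))%C 0 1
    (- (2 * Ci * gm) * RtoC (atan ((al - Re p + 1) / y) - atan ((al - Re p) / y)))%C.
Proof.
  intros hy. set (c := al - Re p).
  apply (is_RInt_ext (V := C_R_NormedModule)
    (fun x => (- (2 * Ci * gm)) * RtoC (y / ((c + x) ^ 2 + y ^ 2)))%C).
  { intros x _.
    assert (n1 : (RtoC (al + x) + Ci * RtoC (Im p + y) - p)%C <> 0%C).
    { intros h. apply (f_equal Im) in h. unfold Im in h; simpl in h. lra. }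
    assert (n2 : (RtoC (al + x) + Ci * RtoC (Im p - y) - p)%C <> 0%C).
    { intros h. apply (f_equal Im) in h. unfold Im in h; simpl in h. lra. }
    assert (n3 : (c + x) ^ 2 + y ^ 2 <> 0) by (now apply Rgt_not_eq, sum_sq_pos).
    assert (E1 : (RtoC (al + x) + Ci * RtoC (Im p + y) - p = RtoC (c + x) + Ci * RtoC y)%C).
    { unfold c. destruct p as [pr pi]. unfold Re, Im.
      apply injective_projections; simpl; ring. }
    assert (E2 : (RtoC (al + x) + Ci * RtoC (Im p - y) - p = RtoC (c + x) - Ci * RtoC y)%C).
    { unfold c. destruct p as [pr pi]. unfold Re, Im.
      apply injective_projections; simpl; ring. }
    rewrite E1 in n1 |- *. rewrite E2 in n2 |- *.
    assert (E3 : RtoC ((c + x) ^ 2 + y ^ 2)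
                 = ((RtoC (c + x) + Ci * RtoC y) * (RtoC (c + x) - Ci * RtoC y))%C).
    { apply injective_projections; simpl; ring. }
    unfold Rdiv. rewrite RtoC_mult, RtoC_inv by exact n3. rewrite E3.
    match goal with |- ?l = ?r => change (@eq C l r) end. field. split; assumption. }
  set (k := (- (2 * Ci * gm))%C).
  replace (k * RtoC (atan ((c + 1) / y) - atan (c / y)))%C
    with (k * RtoC (atan ((c + 1) / y)) - k * RtoC (atan ((c + 0) / y)))%C
    by (rewrite Rplus_0_r, RtoC_minus; ring).
  apply (is_RInt_derive (V := C_R_CompleteNormedModule)
    (fun x => k * RtoC (atan ((c + x) / y)))%C).
  - intros x _. apply rderiv_is_derive, rderiv_pderiv.
    assert (T : (fun _ : R => True) x) by easy.
    assert (X : sdiff (fun _ => True) (fun _ x => RtoC (atan ((c + x) / y))) 0 x 0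
                   (RtoC (y / ((c + x) ^ 2 + y ^ 2)))).
    { apply sdiff_of_pderiv, rderiv_pderiv, (rderiv_RtoC (fun x => atan ((c + x) / y))).
      auto_derive; [exact I |]. field. split; apply Rgt_not_eq; [now apply sum_sq_pos | lra]. }
    exact (sdiff_pderiv _ _ _ _ _ _ (sdiff_scal (fun _ => True) k _ _ _ _ _ T X)).
  - intros x _. apply rcont_continuous. apply rcont_mult; [apply rcont_const |].
    apply (rderiv_rcont _ _ (RtoC (Derive (fun x => y / ((c + x) ^ 2 + y ^ 2)) x))).
    apply (rderiv_RtoC (fun x => y / ((c + x) ^ 2 + y ^ 2))). apply Derive_correct.
    auto_derive. now apply Rgt_not_eq, sum_sq_pos.
Qed.

(** The integrals of [h] just above and just below the line are compared after removing the polar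
    parts. The polar parts contribute Poisson masses, which tend to [PI]; the remainder [q]
    contributes nothing in the limit. Its boundedness is asked only off the line, where regularity
    will be known from the height alone. *)
Lemma hperiod_jump (h : C -> C) (al ys a1 a2 r B : R) (g1 g2 Kp Km : C) :
  let p1 := (RtoC a1 + Ci * RtoC ys)%C in
  let p2 := (RtoC a2 + Ci * RtoC ys)%C in
  let q := fun z => (h z - g1 / (z - p1) - g2 / (z - p2))%C in
  0 < r -> 0 <= B -> al < a1 < al + 1 -> al < a2 < al + 1 ->
  (forall z, al <= Re z <= al + 1 -> Rabs (Im z - ys) < r -> z <> p1 -> z <> p2 -> ccont h z) ->
  (forall z, z <> p1 -> Cmod (z - p1) < r -> Im z <> ys -> Cmod (q z) <= B) ->
  (forall z, z <> p2 -> Cmod (z - p2) < r -> Im z <> ys -> Cmod (q z) <= B) ->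
  (forall y, 0 < y < r -> hperiod h (RtoC al + Ci * RtoC (ys + y)) = Kp) ->
  (forall y, 0 < y < r -> hperiod h (RtoC al + Ci * RtoC (ys - y)) = Km) ->
  (Kp - Km = - (2 * PI * Ci) * (g1 + g2))%C.
Proof.
  intros p1 p2 q hr hB ha1 ha2 hcont hq1 hq2 hKp hKm.
  set (zp := fun y x => (RtoC (al + x) + Ci * RtoC (ys + y))%C).
  set (zm := fun y x => (RtoC (al + x) + Ci * RtoC (ys - y))%C).
  set (th := fun a y => atan ((al - a + 1) / y) - atan ((al - a) / y)).
  assert (P1 : Re p1 = a1 /\ Im p1 = ys) by (unfold p1, Re, Im; simpl; split; ring).
  assert (P2 : Re p2 = a2 /\ Im p2 = ys) by (unfold p2, Re, Im; simpl; split; ring).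
  destruct P1 as [R1 I1]. destruct P2 as [R2 I2].
  assert (Ezp : forall y x, Re (zp y x) = al + x /\ Im (zp y x) = ys + y)
    by (intros; unfold zp, Re, Im; simpl; split; ring).
  assert (Ezm : forall y x, Re (zm y x) = al + x /\ Im (zm y x) = ys - y)
    by (intros; unfold zm, Re, Im; simpl; split; ring).
  assert (cp : forall y x, 0 < y < r -> 0 <= x <= 1 -> rcont (fun x => h (zp y x)) x).
  { intros y x hy hx. apply (rcont_comp h (zp y)).
    - destruct (Ezp y x) as [e1 e2]. apply hcont.
      + lra.
      + rewrite e2. replace (ys + y - ys) with y by ring. rewrite Rabs_right; lra.
      + intros e. rewrite e in e2. lra.
      + intros e. rewrite e in e2. lra.
    - apply (rcont_ext (fun x => (RtoC al + Ci * RtoC (ys + y)) + RtoC x)%C).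
      { intros. unfold zp. rewrite (RtoC_plus al). ring. }
      apply (rderiv_rcont _ _ 1), rderiv_affine. }
  assert (cm : forall y x, 0 < y < r -> 0 <= x <= 1 -> rcont (fun x => h (zm y x)) x).
  { intros y x hy hx. apply (rcont_comp h (zm y)).
    - destruct (Ezm y x) as [e1 e2]. apply hcont.
      + lra.
      + rewrite e2. replace (ys - y - ys) with (- y) by ring. rewrite Rabs_Ropp, Rabs_right; lra.
      + intros e. rewrite e in e2. lra.
      + intros e. rewrite e in e2. lra.
    - apply (rcont_ext (fun x => (RtoC al + Ci * RtoC (ys - y)) + RtoC x)%C).
      { intros. unfold zm. rewrite (RtoC_plus al). ring. }
      apply (rderiv_rcont _ _ 1), rderiv_affine. }
  assert (ID : forall y, 0 < y < r -> is_RInt (V := C_R_NormedModule)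
     (fun x => q (zp y x) - q (zm y x))%C 0 1
     (Kp - Km + 2 * Ci * (g1 * RtoC (th a1 y) + g2 * RtoC (th a2 y)))%C).
  { intros y hy.
    assert (Ip : is_RInt (V := C_R_NormedModule) (fun x => h (zp y x)) 0 1 Kp).
    { rewrite <- (hKp y hy). unfold hperiod.
      rewrite (CRInt_ext _ (fun x => h (zp y x))).
      - apply is_RInt_CRInt; [lra |]. intros; now apply cp.
      - lra.
      - intros. unfold zp. apply (f_equal h). rewrite (RtoC_plus al). ring. }
    assert (Im' : is_RInt (V := C_R_NormedModule) (fun x => h (zm y x)) 0 1 Km).
    { rewrite <- (hKm y hy). unfold hperiod.
      rewrite (CRInt_ext _ (fun x => h (zm y x))).
      - apply is_RInt_CRInt; [lra |]. intros; now apply cm.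
      - lra.
      - intros. unfold zm. apply (f_equal h). rewrite (RtoC_plus al). ring. }
    assert (J1 := pole_difference_integral g1 p1 al y (proj1 hy)).
    assert (J2 := pole_difference_integral g2 p2 al y (proj1 hy)).
    rewrite R1, I1 in J1. rewrite R2, I2 in J2.
    assert (X := is_RInt_Cminus _ _ _ _ _ _
       (is_RInt_Cminus _ _ _ _ _ _ (is_RInt_Cminus _ _ _ _ _ _ Ip Im') J1) J2).
    replace (Kp - Km + 2 * Ci * (g1 * RtoC (th a1 y) + g2 * RtoC (th a2 y)))%C
      with (Kp - Km - - (2 * Ci * g1) * RtoC (th a1 y) - - (2 * Ci * g2) * RtoC (th a2 y))%C by ring.
    refine (is_RInt_ext (V := C_R_NormedModule) _ _ _ _ _ _ X).
    intros x _. match goal with |- ?l = ?r => change (@eq C l r) end.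
    unfold q, zp, zm. ring. }
  (* A majorant on the whole interval, which avoids cutting it at the poles. Within [e1] of a pole
     the kernel term is at least [2 * B], the trivial bound for the difference of [q]; elsewhere
     continuity gives [e1]. The integral of each kernel term is at most [4 * B * e1 * PI]. *)
  assert (D1 : forall e1, 0 < e1 <= r / 2 -> exists eta, 0 < eta /\ forall y x, 0 < y < eta ->
     0 <= x <= 1 -> Cmod (q (zp y x) - q (zm y x)) <=
       e1 + 4 * B * e1 * (e1 / ((al - a1 + x) ^ 2 + e1 ^ 2))
          + 4 * B * e1 * (e1 / ((al - a2 + x) ^ 2 + e1 ^ 2))).
  { intros e1 he1.
    assert (pos : forall a x, 0 <= 4 * B * e1 * (e1 / ((al - a + x) ^ 2 + e1 ^ 2))).
    { intros a x. apply Rmult_le_pos; [nra |].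
      apply Rmult_le_pos; [lra |]. left. apply Rinv_0_lt_compat, sum_sq_pos. lra. }
    assert (near : forall p a x y, (forall z, z <> p -> Cmod (z - p) < r -> Im z <> ys -> Cmod (q z) <= B) ->
       Re p = a -> Im p = ys -> Rabs (al + x - a) < e1 -> 0 < y < e1 ->
       Cmod (q (zp y x) - q (zm y x)) <= 4 * B * e1 * (e1 / ((al - a + x) ^ 2 + e1 ^ 2))).
    { intros p a x y hqp hra hia hx hy.
      destruct (Ezp y x) as [u1 u2]. destruct (Ezm y x) as [w1 w2].
      assert (Bp : Cmod (q (zp y x)) <= B).
      { apply hqp.
        - intros e. rewrite e in u2. lra.
        - eapply Rle_lt_trans; [apply Cmod_le_Re_Im |].
          replace (Re (zp y x - p)) with (al + x - a) by (rewrite <- u1, <- hra; reflexivity).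
          replace (Im (zp y x - p)) with y by (transitivity (Im (zp y x) - Im p); [rewrite u2, hia; ring | reflexivity]).
          rewrite (Rabs_right y) by lra. lra.
        - lra. }
      assert (Bm : Cmod (q (zm y x)) <= B).
      { apply hqp.
        - intros e. rewrite e in w2. lra.
        - eapply Rle_lt_trans; [apply Cmod_le_Re_Im |].
          replace (Re (zm y x - p)) with (al + x - a) by (rewrite <- w1, <- hra; reflexivity).
          replace (Im (zm y x - p)) with (- y) by (transitivity (Im (zm y x) - Im p); [rewrite w2, hia; ring | reflexivity]).
          rewrite Rabs_Ropp, (Rabs_right y) by lra. lra.
        - lra. }
      eapply Rle_trans; [apply Cmod_minus_le |].
      apply Rle_trans with (2 * B); [lra |].
      assert (hpos := sum_sq_pos (al - a + x) e1 (proj1 he1)).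
      assert (hs : (al - a + x) ^ 2 + e1 ^ 2 <= 2 * e1 ^ 2).
      { apply Rabs_lt_between in hx. nra. }
      replace (4 * B * e1 * (e1 / ((al - a + x) ^ 2 + e1 ^ 2)))
        with (2 * B * (2 * e1 ^ 2 / ((al - a + x) ^ 2 + e1 ^ 2))) by (field; lra).
      assert (1 <= 2 * e1 ^ 2 / ((al - a + x) ^ 2 + e1 ^ 2)) by (apply Rle_div_r; lra). nra. }
    destruct (uniform_gauge 0 1 (fun x d => forall y, 0 < y < d -> Cmod (q (zp y x) - q (zm y x)) <=
       e1 + 4 * B * e1 * (e1 / ((al - a1 + x) ^ 2 + e1 ^ 2))
          + 4 * B * e1 * (e1 / ((al - a2 + x) ^ 2 + e1 ^ 2)))) as [eta [heta U]].
    - intros x0 hx0.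
      destruct (Req_dec (al + x0) a1) as [E1 | N1].
      { exists e1. split; [lra |]. intros x hx hxx y hy.
        assert (X := near p1 a1 x y hq1 R1 I1
          ltac:(replace (al + x - a1) with (x - x0) by lra; exact hxx) hy).
        specialize (pos a2 x). lra. }
      destruct (Req_dec (al + x0) a2) as [E2 | N2].
      { exists e1. split; [lra |]. intros x hx hxx y hy.
        assert (X := near p2 a2 x y hq2 R2 I2
          ltac:(replace (al + x - a2) with (x - x0) by lra; exact hxx) hy).
        specialize (pos a1 x). lra. }
      set (z0 := zp 0 x0). destruct (Ezp 0 x0) as [u1 u2]. fold z0 in u1, u2.
      assert (n1 : z0 <> p1) by (intros e; rewrite e in u1; lra).
      assert (n2 : z0 <> p2) by (intros e; rewrite e in u1; lra).
      assert (ch : ccont h z0).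
      { apply hcont; auto; [lra |]. rewrite u2. replace (ys + 0 - ys) with 0 by ring.
        rewrite Rabs_R0. exact hr. }
      assert (cf : forall (g p : C), z0 <> p -> ccont (fun z => g / (z - p))%C z0).
      { intros g p hp.
        assert (T : (fun _ : R => True) 0) by easy.
        assert (X := sdiff_minus (fun _ => True) _ _ _ _ _ _ _ _ T
            (sdiff_id (fun _ => True) z0 0) (sdiff_const (fun _ => True) p z0 0)).
        assert (n0 : (z0 - p)%C <> 0%C).
        { intros e. apply hp. replace z0 with ((z0 - p) + p)%C by ring. rewrite e. ring. }
        assert (Y := sdiff_scal (fun _ => True) g _ _ _ _ _ T (sdiff_inv (fun _ => True) _ _ _ _ _ T n0 X)).
        exact (cderiv_ccont _ _ _ (cstrict_cderiv _ _ _ (sdiff_cstrict (fun _ => True) _ _ _ _ _ T Y))). }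
      destruct (ch (e1 / 6)) as [d1 [hd1 k1]]; [lra |].
      destruct (cf g1 p1 n1 (e1 / 6)) as [d2 [hd2 k2]]; [lra |].
      destruct (cf g2 p2 n2 (e1 / 6)) as [d3 [hd3 k3]]; [lra |].
      set (d := Rmin d1 (Rmin d2 d3)).
      assert (hd : 0 < d) by (unfold d; repeat apply Rmin_glb_lt; assumption).
      assert (b1 : d <= d1) by (unfold d; rmin).
      assert (b2 : d <= d2) by (unfold d; rmin).
      assert (b3 : d <= d3) by (unfold d; rmin).
      assert (Q : forall z, Cmod (z - z0) < d -> Cmod (q z - q z0) <= e1 / 2).
      { intros z hz. specialize (k1 z ltac:(lra)). specialize (k2 z ltac:(lra)).
        specialize (k3 z ltac:(lra)).
        replace (q z - q z0)%C with ((h z - h z0) - (g1 / (z - p1) - g1 / (z0 - p1))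
           - (g2 / (z - p2) - g2 / (z0 - p2)))%C by (unfold q; ring).
        eapply Rle_trans; [apply Cmod_minus_le |].
        assert (T := Cmod_minus_le (h z - h z0) (g1 / (z - p1) - g1 / (z0 - p1))). lra. }
      exists (d / 2). split; [lra |]. intros x hx hxx y hy.
      assert (S1 : Cmod (zp y x - z0) < d).
      { eapply Rle_lt_trans; [apply Cmod_le_Re_Im |].
        replace (Re (zp y x - z0)) with (x - x0) by (unfold z0, zp, Re; simpl; ring).
        replace (Im (zp y x - z0)) with y by (unfold z0, zp, Im; simpl; ring).
        rewrite (Rabs_right y) by lra. lra. }
      assert (S2 : Cmod (zm y x - z0) < d).
      { eapply Rle_lt_trans; [apply Cmod_le_Re_Im |].
        replace (Re (zm y x - z0)) with (x - x0) by (unfold z0, zp, zm, Re; simpl; ring).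
        replace (Im (zm y x - z0)) with (- y) by (unfold z0, zp, zm, Im; simpl; ring).
        rewrite Rabs_Ropp, (Rabs_right y) by lra. lra. }
      apply Q in S1. apply Q in S2.
      replace (q (zp y x) - q (zm y x))%C with ((q (zp y x) - q z0) - (q (zm y x) - q z0))%C by ring.
      eapply Rle_trans; [apply Cmod_minus_le |].
      assert (X1 := pos a1 x). assert (X2 := pos a2 x). lra.
    - intros x d d' hQ hd y hy. apply hQ. lra.
    - exists eta. split; [exact heta |]. intros. now apply U. }
  assert (Z : Cmod (Kp - Km + 2 * PI * Ci * (g1 + g2)) <= 0).
  { apply le_epsilon. intros e he. rewrite Rplus_0_l.
    assert (hpi := PI_RGT_0).
    (* [e1 * W] bounds the integral of the majorant. Once [e1] is fixed, [y] is taken so small that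
       replacing the two Poisson masses by [PI] costs at most [e / 2]. *)
    set (W := 1 + 8 * B * PI).
    assert (hW : 0 < W) by (unfold W; nra).
    set (e1 := Rmin (r / 2) (e / (2 * W))).
    assert (he1 : 0 < e1) by (apply Rmin_glb_lt; [lra | apply Rdiv_lt_0_compat; lra]).
    assert (he1r : e1 <= r / 2) by apply Rmin_l.
    assert (he1e : e1 <= e / (2 * W)) by apply Rmin_r.
    assert (he1W : e1 * W <= e / 2).
    { apply Rle_trans with (e / (2 * W) * W); [nra | apply Req_le; field; lra]. }
    destruct (D1 e1 (conj he1 he1r)) as [eta [heta U]].
    set (G := Cmod g1 + Cmod g2).
    assert (hG1 := Cmod_ge_0 g1). assert (hG2 := Cmod_ge_0 g2).
    set (cc := / (al + 1 - a1) + / (a1 - al) + / (al + 1 - a2) + / (a2 - al)).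
    assert (i1 : 0 < / (al + 1 - a1)) by (apply Rinv_0_lt_compat; lra).
    assert (i2 : 0 < / (a1 - al)) by (apply Rinv_0_lt_compat; lra).
    assert (i3 : 0 < / (al + 1 - a2)) by (apply Rinv_0_lt_compat; lra).
    assert (i4 : 0 < / (a2 - al)) by (apply Rinv_0_lt_compat; lra).
    assert (hcc : 0 < cc) by (unfold cc; lra).
    set (V := 2 * G * cc + 1).
    assert (hV : 0 < V) by (unfold V, G; nra).
    set (y := Rmin (Rmin (r / 2) (eta / 2)) (e / (2 * V))).
    assert (hy : 0 < y).
    { repeat apply Rmin_glb_lt; try lra. apply Rdiv_lt_0_compat; lra. }
    assert (y1 : y <= r / 2) by (eapply Rle_trans; [apply Rmin_l | apply Rmin_l]).
    assert (y2 : y <= eta / 2) by (eapply Rle_trans; [apply Rmin_l | apply Rmin_r]).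
    assert (y3 : y <= e / (2 * V)) by apply Rmin_r.
    assert (yV : y * V <= e / 2).
    { apply Rle_trans with (e / (2 * V) * V); [nra | apply Req_le; field; lra]. }
    assert (T1 : Rabs (th a1 y - PI) <= y * cc).
    { unfold th. replace ((al - a1) / y) with (- (a1 - al) / y) by (field; lra).
      eapply Rle_trans; [apply poisson_mass; lra |].
      replace (al - a1 + 1) with (al + 1 - a1) by ring. unfold cc, Rdiv. nra. }
    assert (T2 : Rabs (th a2 y - PI) <= y * cc).
    { unfold th. replace ((al - a2) / y) with (- (a2 - al) / y) by (field; lra).
      eapply Rle_trans; [apply poisson_mass; lra |].
      replace (al - a2 + 1) with (al + 1 - a2) by ring. unfold cc, Rdiv. nra. }
    assert (Bd : Cmod (Kp - Km + 2 * Ci * (g1 * RtoC (th a1 y) + g2 * RtoC (th a2 y))) <= e1 * W).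
    { rewrite <- norm_C_R.
      apply Rle_trans with (e1 + 4 * B * e1 * (atan ((al - a1 + 1) / e1) - atan ((al - a1) / e1))
         + 4 * B * e1 * (atan ((al - a2 + 1) / e1) - atan ((al - a2) / e1))).
      - apply (norm_RInt_le (V := C_R_NormedModule) (fun x => q (zp y x) - q (zm y x))%C
          (fun x => e1 + 4 * B * e1 * (e1 / ((al - a1 + x) ^ 2 + e1 ^ 2))
          + 4 * B * e1 * (e1 / ((al - a2 + x) ^ 2 + e1 ^ 2))) 0 1).
        + lra.
        + intros x hx. rewrite norm_C_R. apply U; lra.
        + apply ID. lra.
        + apply (is_RInt_plus (V := R_NormedModule)).
          * apply (is_RInt_plus (V := R_NormedModule)).
            -- assert (Ic := is_RInt_const (V := R_NormedModule) 0 1 e1).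
               refine (eq_ind _ (fun l => is_RInt (V := R_NormedModule) (fun _ => e1) 0 1 l) Ic e1 _).
               unfold scal; simpl; unfold mult; simpl; ring.
            -- apply (is_RInt_scal (V := R_NormedModule)). now apply is_RInt_poisson.
          * apply (is_RInt_scal (V := R_NormedModule)). now apply is_RInt_poisson.
      - assert (Q1 := poisson_integral_le (al - a1) e1 he1).
        assert (Q2 := poisson_integral_le (al - a2) e1 he1).
        assert (0 <= 4 * B * e1) by nra. unfold W. nra. }
    replace (Kp - Km + 2 * PI * Ci * (g1 + g2))%C
      with ((Kp - Km + 2 * Ci * (g1 * RtoC (th a1 y) + g2 * RtoC (th a2 y)))
        - 2 * Ci * (g1 * RtoC (th a1 y - PI) + g2 * RtoC (th a2 y - PI)))%C
      by (rewrite !RtoC_minus; ring).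
    eapply Rle_trans; [apply Cmod_minus_le |].
    assert (F : Cmod (2 * Ci * (g1 * RtoC (th a1 y - PI) + g2 * RtoC (th a2 y - PI)))
                <= 2 * (G * (y * cc))).
    { rewrite !Cmod_mult, Cmod_Ci, Cmod_R, Rabs_right, Rmult_1_r by lra.
      apply Rmult_le_compat_l; [lra |].
      eapply Rle_trans; [apply Cmod_triangle |]. rewrite !Cmod_mult, !Cmod_R. unfold G.
      rewrite Rmult_plus_distr_r.
      apply Rplus_le_compat; apply Rmult_le_compat_l; assumption. }
    unfold V in yV. lra. }
  assert (E : (Kp - Km + 2 * PI * Ci * (g1 + g2))%C = 0%C)
    by (apply Cmod_eq_0, Rle_antisym; [exact Z | apply Cmod_ge_0]).
  replace (Kp - Km)%C with ((Kp - Km + 2 * PI * Ci * (g1 + g2)) - 2 * PI * Ci * (g1 + g2))%C by ring.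
  rewrite E. ring.
Qed.

Lemma cstrict_ccont F z a : cstrict F z a -> ccont F z.
Proof. intros h. exact (cderiv_ccont _ _ _ (cstrict_cderiv _ _ _ h)). Qed.

Lemma cstrict_lip F p a : cstrict F p a ->
  exists d K, 0 < d /\ 0 < K /\ forall z, Cmod (z - p) < d -> Cmod (F z - F p) <= K * Cmod (z - p).
Proof.
  intros h. destruct (h 1 Rlt_0_1) as [d [hd h']].
  exists d, (1 + Cmod a). split; [exact hd |]. split; [generalize (Cmod_ge_0 a); lra |].
  intros z hz. specialize (h' p z). rewrite Cmod_self in h'. specialize (h' hd hz).
  replace (F z - F p)%C with ((F z - F p - a * (z - p)) + a * (z - p))%C by ring.
  eapply Rle_trans; [apply Cmod_triangle |]. rewrite Cmod_mult. lra.
Qed.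

Lemma cstrict_div F G z a b : cstrict F z a -> cstrict G z b -> G z <> 0%C ->
  exists c, cstrict (fun v => F v / G v)%C z c.
Proof.
  intros hF hG h0. assert (T : (fun _ : R => True) 0) by easy.
  assert (X := sdiff_mult (fun _ => True) _ _ z 0 _ _ _ _ T (sdiff_of_cstrict (fun _ => True) _ _ 0 _ hF)
    (sdiff_inv (fun _ => True) (fun v _ => G v) z 0 _ _ T h0 (sdiff_of_cstrict (fun _ => True) _ _ 0 _ hG))).
  eexists. exact (sdiff_cstrict (fun _ => True) _ _ _ _ _ T X).
Qed.

Lemma cderiv_minus F G z a b : cderiv F z a -> cderiv G z b ->
  cderiv (fun v => F v - G v)%C z (a - b)%C.
Proof.
  intros hF hG e he. destruct (hF (e / 2)) as [d [hd h]]; [lra |].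
  destruct (hG (e / 2)) as [d' [hd' h']]; [lra |].
  exists (Rmin d d'). split; [now apply Rmin_glb_lt |].
  pose_rmin.
  intros v hv. specialize (h v ltac:(lra)). specialize (h' v ltac:(lra)).
  replace (F v - G v - (F z - G z) - (a - b) * (v - z))%C
    with ((F v - F z - a * (v - z)) - (G v - G z - b * (v - z)))%C by ring.
  eapply Rle_trans; [apply Cmod_minus_le | lra].
Qed.

Lemma cderiv_ext_loc F G w a r : 0 < r -> (forall v, Cmod (v - w) < r -> F v = G v) ->
  cderiv F w a -> cderiv G w a.
Proof.
  intros hr E h e he. destruct (h e he) as [d [hd h']].
  exists (Rmin d r). split; [now apply Rmin_glb_lt |].
  pose_rmin.
  intros v hv. rewrite <- !E; try lra.
  - apply h'. lra.
  - rewrite Cmod_self. exact hr.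
Qed.

Lemma pderiv_unique (D : R -> Prop) mu t a b : accum D t ->
  pderiv D mu t a -> pderiv D mu t b -> a = b.
Proof.
  intros hac ha hb.
  assert (Z : Cmod (a - b) <= 0).
  { apply le_epsilon. intros e he. rewrite Rplus_0_l.
    destruct (ha (e / 2)) as [d [hd h]]; [lra |]. destruct (hb (e / 2)) as [d' [hd' h']]; [lra |].
    destruct (hac (Rmin d d')) as [s [hs [hne hst]]]; [now apply Rmin_glb_lt |].
    pose_rmin.
    specialize (h s hs ltac:(lra)). specialize (h' s hs ltac:(lra)).
    assert (hp : 0 < Rabs (s - t)) by (apply Rabs_pos_lt; lra).
    apply Rmult_le_reg_r with (Rabs (s - t)); [exact hp |].
    replace (Cmod (a - b) * Rabs (s - t)) with (Cmod ((a - b) * RtoC (s - t)))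
      by (rewrite Cmod_mult, Cmod_R; ring).
    replace ((a - b) * RtoC (s - t))%C
      with ((mu s - mu t - b * RtoC (s - t)) - (mu s - mu t - a * RtoC (s - t)))%C by ring.
    eapply Rle_trans; [apply Cmod_minus_le | lra]. }
  assert (E : (a - b)%C = 0%C) by (apply Cmod_eq_0, Rle_antisym; [exact Z | apply Cmod_ge_0]).
  replace a with ((a - b) + b)%C by ring. rewrite E. ring.
Qed.

(** * Local behaviour of [ft / g] at zeros and poles of [g] *)

(** After subtraction of the polar part the numerator is [(ft z - ft p) G p - ft p (G z - G p)]. By
    the Lipschitz bounds at [p] it is of order [z - p], which cancels the remaining zero of the
    denominator. *)
Lemma simple_zero_bound (ft g G : C -> C) (p a b : C) (r : R) : 0 < r ->
  cstrict ft p a -> cstrict G p b -> G p <> 0%C ->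
  (forall z, Cmod (z - p) < r -> g z = ((z - p) * G z)%C) ->
  exists B r', 0 <= B /\ 0 < r' /\ forall z, z <> p -> Cmod (z - p) < r' ->
    Cmod (ft z / g z - (ft p / G p) / (z - p)) <= B.
Proof.
  intros hr hf hG h0 hg.
  destruct (cstrict_lip _ _ _ hf) as [d1 [K1 [hd1 [hK1 L1]]]].
  destruct (cstrict_lip _ _ _ hG) as [d2 [K2 [hd2 [hK2 L2]]]].
  assert (m0 : 0 < Cmod (G p)) by (apply Cmod_gt_0; exact h0).
  set (d3 := Cmod (G p) / (2 * K2)).
  assert (hd3 : 0 < d3) by (apply Rdiv_lt_0_compat; lra).
  set (M := K1 * Cmod (G p) + Cmod (ft p) * K2).
  assert (hM : 0 <= M) by (unfold M; generalize (Cmod_ge_0 (ft p)); nra).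
  set (m2 := Cmod (G p) / 2 * Cmod (G p)).
  assert (hm2 : 0 < m2) by (unfold m2; nra).
  exists (M / m2), (Rmin (Rmin r d1) (Rmin d2 d3)).
  split; [apply Rle_div_r; lra |]. split; [repeat apply Rmin_glb_lt; assumption |].
  intros z hz hzd.
  assert (b0 : Cmod (z - p) < r) by rmin.
  assert (b1 : Cmod (z - p) < d1) by rmin.
  assert (b2 : Cmod (z - p) < d2) by rmin.
  assert (b3 : Cmod (z - p) < d3) by rmin.
  specialize (L1 z b1). specialize (L2 z b2).
  assert (nz : (z - p)%C <> 0%C).
  { intros e. apply hz. replace z with ((z - p) + p)%C by ring. rewrite e. ring. }
  assert (pz : 0 < Cmod (z - p)) by (apply Cmod_gt_0; exact nz).
  assert (low : Cmod (G p) / 2 <= Cmod (G z)).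
  { assert (T := Cmod_triangle_sub (G p) (G z)). rewrite (Cmod_sym (G p)) in T.
    assert (K2 * Cmod (z - p) <= Cmod (G p) / 2).
    { apply Rle_trans with (K2 * d3); [nra | apply Req_le; unfold d3; field; lra]. }
    lra. }
  assert (nG : G z <> 0%C) by (apply Cmod_gt_0; lra).
  rewrite hg by exact b0.
  replace (ft z / ((z - p) * G z) - ft p / G p / (z - p))%C
    with (((ft z - ft p) * G p - ft p * (G z - G p)) / ((z - p) * (G z * G p)))%C
    by (field; auto).
  rewrite Cmod_div by (repeat apply Cmult_neq_0; auto). rewrite !Cmod_mult.
  apply Rle_div_l; [repeat apply Rmult_lt_0_compat; lra |].
  apply Rle_trans with (M * Cmod (z - p)).
  - eapply Rle_trans; [apply Cmod_minus_le |]. rewrite !Cmod_mult. unfold M.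
    generalize (Cmod_ge_0 (ft p)). nra.
  - replace (M * Cmod (z - p)) with (M / m2 * (Cmod (z - p) * m2)) by (field; lra).
    apply Rmult_le_compat_l; [apply Rle_div_r; lra |].
    apply Rmult_le_compat_l; [lra |]. unfold m2. apply Rmult_le_compat_r; lra.
Qed.

Lemma Cmod_polar phi r : Cmod (polar r phi) = Rabs r.
Proof.
  unfold polar, Cmod; simpl.
  replace (_ + _) with (r * r * (Rsqr (sin phi) + Rsqr (cos phi))) by (unfold Rsqr; ring).
  rewrite sin2_cos2, Rmult_1_r. rewrite <- (sqrt_Rsqr_abs r). reflexivity.
Qed.

(* Integrating [|ft'| <= K / |z - p|^3] along radii. *)
Lemma double_pole_growth (ft gb : C -> C) (p : C) (r K : R) : 0 < r -> 0 <= K ->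
  (forall z, 0 < Cmod (z - p) < r -> cderiv ft z (gb z)) ->
  (forall z, 0 < Cmod (z - p) < r -> Cmod (gb z) <= K / Cmod (z - p) ^ 3) ->
  exists M, 0 <= M /\ forall z, 0 < Cmod (z - p) < r / 2 ->
    Cmod (ft z) <= M / Cmod (z - p) ^ 2.
Proof.
  intros hr hK hd hb.
  set (r1 := r / 2). assert (hr1 : 0 < r1) by (unfold r1; lra).
  (* The starting values of the radial integration: [ft] is continuous on the circle of radius
     [r / 2], hence bounded there. *)
  assert (circ : exists M0, 0 <= M0 /\ forall phi, - PI <= phi <= PI ->
     Cmod (ft (p + polar r1 phi)%C) <= M0).
  { apply (rcont_bounded (fun phi => ft (p + polar r1 phi)%C)).
    intros phi _. apply (rcont_comp ft (fun phi => (p + polar r1 phi)%C)).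
    - apply (cderiv_ccont ft _ (gb (p + polar r1 phi)%C)), hd.
      replace (p + polar r1 phi - p)%C with (polar r1 phi) by ring.
      rewrite Cmod_polar, Rabs_right; unfold r1; lra.
    - apply rcont_plus; [apply rcont_const |].
      apply (rcont_ext (fun phi => RtoC (r1 * cos phi) + Ci * RtoC (r1 * sin phi))%C).
      { intros y. apply injective_projections; simpl; ring. }
      apply (rderiv_rcont _ _ (RtoC (- r1 * sin phi) + Ci * RtoC (r1 * cos phi))%C), rderiv_pderiv.
      assert (T : (fun _ : R => True) phi) by easy.
      assert (X1 : rderiv (fun phi => RtoC (r1 * cos phi)) phi (RtoC (- r1 * sin phi))).
      { apply (rderiv_RtoC (fun phi => r1 * cos phi)). auto_derive; [exact I | ring]. }
      assert (X2 : rderiv (fun phi => RtoC (r1 * sin phi)) phi (RtoC (r1 * cos phi))).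
      { apply (rderiv_RtoC (fun phi => r1 * sin phi)). auto_derive; [exact I | ring]. }
      apply rderiv_pderiv in X1. apply rderiv_pderiv in X2.
      exact (sdiff_pderiv _ _ 0 _ _ _ (sdiff_plus _ _ _ 0 _ _ _ _ _
        (sdiff_of_pderiv _ _ _ _ _ X1)
        (sdiff_scal _ Ci _ 0 _ _ _ T (sdiff_of_pderiv _ _ _ _ _ X2)))). }
  destruct circ as [M0 [hM0 circ]].
  assert (circ' : forall w, Cmod (w - p) = r1 -> Cmod (ft w) <= M0).
  { intros w hw. destruct (polar_exists_pi (w - p)) as [phi [hphi E]].
    replace w with (p + polar r1 phi)%C; [now apply circ |].
    rewrite <- hw, <- E. ring. }
  exists (2 * (M0 * r1 ^ 2 + K)). split.
  { assert (0 <= M0 * r1 ^ 2) by (apply Rmult_le_pos; [lra | apply pow_le; lra]). lra. }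
  intros z hz. fold r1 in hz.
  set (rho := Cmod (z - p)) in *.
  set (e := ((z - p) / RtoC rho)%C).
  assert (nr : RtoC rho <> 0%C) by (intros x; apply RtoC_inj in x; lra).
  assert (he : Cmod e = 1).
  { unfold e. rewrite Cmod_div, Cmod_R, Rabs_right by (auto; lra). fold rho. field. lra. }
  set (ray := fun y : R => (p + RtoC y * e)%C).
  assert (hray : forall y, 0 < y -> Cmod (ray y - p) = y).
  { intros y hy. unfold ray. replace (p + RtoC y * e - p)%C with (RtoC y * e)%C by ring.
    rewrite Cmod_mult, he, Cmod_R, Rabs_right; lra. }
  assert (E1 : ray rho = z) by (unfold ray, e; field; exact nr).
  assert (dray : forall y, 0 < y < r -> rderiv (fun y => ft (ray y)) y (gb (ray y) * e)).
  { intros y hy.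
    assert (X : rderiv (fun x => ft (segpt p (p + e) x)) y (gb (ray y) * (p + e - p))).
    { apply cderiv_segment. replace (segpt p (p + e) y) with (ray y) by (unfold segpt, ray; ring).
      apply hd. rewrite hray; lra. }
    replace (p + e - p)%C with e in X by ring.
    intros e0 he0. destruct (X e0 he0) as [d [hd' X']]. exists d. split; [exact hd' |].
    intros y' hy'. specialize (X' y' hy').
    replace (segpt p (p + e) y') with (ray y') in X' by (unfold segpt, ray; ring).
    replace (segpt p (p + e) y) with (ray y) in X' by (unfold segpt, ray; ring).
    exact X'. }
  assert (A : forall u du : R -> R,
     (forall y, 0 < y < r -> is_derive u y (du y)) ->
     (forall y, 0 < y < r -> Rabs (du y) <= K / y ^ 3) -> Rabs (u r1) <= M0 ->
     Rabs (u rho) <= (M0 * r1 ^ 2 + K) / rho ^ 2).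
  { intros u du hu hdu hu1.
    assert (key : forall sg, (sg = 1 \/ sg = -1) -> sg * u rho <= M0 + K / rho ^ 2).
    { intros sg hsg.
      (* By the bound on [du], this function has derivative [sg * du + K / y ^ 3 >= 0], so its value
         at [rho] is at most the one at [r1]. The two signs [sg] give the bound on
         [Rabs (u rho)]. *)
      destruct (MVT_gen (fun y => sg * u y - K / (2 * y ^ 2)) rho r1
         (fun y => sg * du y + K / y ^ 3)) as [c [hc E]].
      - intros y. rewrite Rmin_left, Rmax_right by lra. intros hy.
        assert (hyr : 0 < y < r) by (unfold r1 in *; lra).
        auto_derive.
        + split; [eexists; exact (hu y hyr) |]. split; [| exact I].
          apply Rgt_not_eq. nra.
        + replace (Derive (fun x => u x) y) with (du y)
            by (symmetry; apply is_derive_unique, hu, hyr).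
          field. lra.
      - intros y. rewrite Rmin_left, Rmax_right by lra. intros hy.
        assert (hyr : 0 < y < r) by (unfold r1 in *; lra).
        apply derivable_continuous_pt, ex_derive_Reals_0.
        auto_derive. split; [eexists; exact (hu y hyr) |]. split; [| exact I].
        apply Rgt_not_eq. nra.
      - rewrite Rmin_left, Rmax_right in hc by lra.
        assert (hc3 : 0 < c ^ 3) by (apply pow_lt; lra).
        assert (B1 : - (K / c ^ 3) <= sg * du c).
        { assert (Y3 := hdu c ltac:(unfold r1 in *; lra)).
          apply Rabs_le_between in Y3. destruct hsg; subst sg; lra. }
        assert (pos : 0 <= (sg * du c + K / c ^ 3) * (r1 - rho)) by (apply Rmult_le_pos; lra).
        rewrite <- E in pos.
        assert (hr12 : 0 < r1 ^ 2) by (apply pow_lt; lra).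
        assert (hrho2 : 0 < rho ^ 2) by (apply pow_lt; lra).
        assert (Y4 : sg * u r1 <= M0).
        { apply Rabs_le_between in hu1. destruct hsg; subst sg; lra. }
        assert (0 <= K / (2 * r1 ^ 2)) by (apply Rle_div_r; lra).
        assert (K / (2 * rho ^ 2) <= K / rho ^ 2).
        { unfold Rdiv. apply Rmult_le_compat_l; [exact hK | apply Rinv_le_contravar; lra]. }
        lra. }
    assert (hrho2 : 0 < rho ^ 2) by (apply pow_lt; lra).
    assert (fin' : M0 + K / rho ^ 2 <= (M0 * r1 ^ 2 + K) / rho ^ 2).
    { replace ((M0 * r1 ^ 2 + K) / rho ^ 2) with (M0 * (r1 ^ 2 / rho ^ 2) + K / rho ^ 2) by (field; lra).
      assert (1 <= r1 ^ 2 / rho ^ 2).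
      { apply Rle_div_r; [lra |]. rewrite Rmult_1_l. apply pow_incr. lra. }
      nra. }
    assert (k1 := key 1 (or_introl eq_refl)). assert (k2 := key (-1) (or_intror eq_refl)).
    apply Rabs_le. lra. }
  eapply Rle_trans; [apply Cmod_le_Re_Im |].
  assert (dbd : forall Q : C -> R, (forall w, Rabs (Q w) <= Cmod w) ->
     forall y, 0 < y < r -> Rabs (Q (gb (ray y) * e)%C) <= K / y ^ 3).
  { intros Q hQ y hy. eapply Rle_trans; [apply hQ |]. rewrite Cmod_mult, he, Rmult_1_r.
    rewrite <- (hray y) at 2 by lra. apply hb. rewrite hray; lra. }
  assert (end1 : forall Q : C -> R, (forall w, Rabs (Q w) <= Cmod w) -> Rabs (Q (ft (ray r1))) <= M0).
  { intros Q hQ. eapply Rle_trans; [apply hQ |]. apply circ', hray, hr1. }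
  assert (A1 := A (fun y => Re (ft (ray y))) _ (fun y hy => rderiv_Re _ _ _ (dray y hy))
     (dbd Re re_le_Cmod) (end1 Re re_le_Cmod)).
  assert (A2 := A (fun y => Im (ft (ray y))) _ (fun y hy => rderiv_Im _ _ _ (dray y hy))
     (dbd Im im_le_Cmod) (end1 Im im_le_Cmod)).
  cbv beta in A1, A2. rewrite E1 in A1, A2.
  unfold Rdiv in *. lra.
Qed.

(** The growth of [ft], of order at most two, is matched by the double pole of [g], whose
    coefficient [N] stays away from 0 near [p]. *)
Lemma double_pole_bound (ft gb g N : C -> C) (p : C) (r K : R) : 0 < r -> 0 <= K ->
  (forall z, 0 < Cmod (z - p) < r -> cderiv ft z (gb z)) ->
  (forall z, 0 < Cmod (z - p) < r -> Cmod (gb z) <= K / Cmod (z - p) ^ 3) ->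
  ccont N p -> N p <> 0%C ->
  (forall z, 0 < Cmod (z - p) < r -> (g z * (z - p) ^ 2 = N z)%C) ->
  exists B r', 0 <= B /\ 0 < r' /\ forall z, 0 < Cmod (z - p) < r' -> Cmod (ft z / g z) <= B.
Proof.
  intros hr hK hd hb hN h0 hg.
  destruct (double_pole_growth ft gb p r K hr hK hd hb) as [M [hM hG]].
  assert (m0 : 0 < Cmod (N p)) by (apply Cmod_gt_0; exact h0).
  destruct (hN (Cmod (N p) / 2)) as [d [hd0 hN']]; [lra |].
  exists (M / (Cmod (N p) / 2)), (Rmin (r / 2) d).
  split; [apply Rle_div_r; lra |]. split; [apply Rmin_glb_lt; lra |].
  pose_rmin.
  intros z hz. specialize (hG z ltac:(lra)). specialize (hN' z ltac:(lra)).
  specialize (hg z ltac:(lra)).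
  assert (low : Cmod (N p) / 2 <= Cmod (N z)).
  { assert (T := Cmod_triangle_sub (N p) (N z)). rewrite (Cmod_sym (N p)) in T. lra. }
  assert (hp2 : 0 < Cmod (z - p) ^ 2) by (apply pow_lt; lra).
  assert (E : Cmod (g z) * Cmod (z - p) ^ 2 = Cmod (N z)).
  { rewrite <- hg, Cmod_mult, Cmod_pow. reflexivity. }
  assert (pg : 0 < Cmod (g z)) by (generalize (Cmod_ge_0 (g z)); nra).
  rewrite Cmod_div by (apply Cmod_gt_0; exact pg).
  apply Rle_div_l; [exact pg |]. eapply Rle_trans; [exact hG |].
  apply Rle_div_l; [exact hp2 |].
  replace (M / (Cmod (N p) / 2) * Cmod (g z) * Cmod (z - p) ^ 2)
    with (M / (Cmod (N p) / 2) * (Cmod (g z) * Cmod (z - p) ^ 2)) by ring.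
  rewrite E. apply Rle_trans with (M / (Cmod (N p) / 2) * (Cmod (N p) / 2)).
  - apply Req_le. field. lra.
  - apply Rmult_le_compat_l; [apply Rle_div_r; lra | exact low].
Qed.

Lemma pderiv_bound (D : R -> Prop) mu t b K r : accum D t -> 0 < r -> pderiv D mu t b ->
  (forall s, D s -> Rabs (s - t) < r -> Cmod (mu s - mu t) <= K * Rabs (s - t)) -> Cmod b <= K.
Proof.
  intros hac hr h hK. apply le_epsilon. intros e he.
  destruct (h e he) as [d [hd h']].
  destruct (hac (Rmin d r)) as [s [hs [hne hst]]]; [now apply Rmin_glb_lt |].
  pose_rmin.
  specialize (h' s hs ltac:(lra)). specialize (hK s hs ltac:(lra)).
  assert (hp : 0 < Rabs (s - t)) by (apply Rabs_pos_lt; lra).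
  apply Rmult_le_reg_r with (Rabs (s - t)); [exact hp |].
  replace (Cmod b * Rabs (s - t)) with (Cmod (b * RtoC (s - t)))
    by (rewrite Cmod_mult, Cmod_R; ring).
  replace (b * RtoC (s - t))%C with ((mu s - mu t) - (mu s - mu t - b * RtoC (s - t)))%C by ring.
  eapply Rle_trans; [apply Cmod_minus_le | lra].
Qed.

Lemma pderiv_ext_loc (D : R -> Prop) g1 g2 t l r : 0 < r -> D t ->
  (forall s, D s -> Rabs (s - t) < r -> g1 s = g2 s) ->
  pderiv D g1 t l -> pderiv D g2 t l.
Proof.
  intros hr hD hE h e he. destruct (h e he) as [d [hd h']].
  exists (Rmin d r). split; [now apply Rmin_glb_lt |].
  pose_rmin.
  intros s hs hst. rewrite <- !hE; try assumption; try lra.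
  - apply h'; [exact hs | lra].
  - rewrite Rminus_eq_0, Rabs_R0. exact hr.
Qed.

(* A moving double pole becomes a triple pole of the time derivative. *)
Lemma moving_double_pole (D : R -> Prop) (F N : C -> R -> C) (Z : R -> C) t (p zd : C)
    (gb : C -> C) r :
  D t -> accum D t -> Z t = p -> pderiv D Z t zd -> 0 < r ->
  (forall z, Cmod (z - p) < r -> sdiffable D N z t) ->
  (forall z s, D s -> z <> Z s -> F z s = (N z s * (/ (z - Z s) * / (z - Z s)))%C) ->
  (forall z, 0 < Cmod (z - p) < r -> pderiv D (F z) t (gb z)) ->
  exists K r', 0 <= K /\ 0 < r' <= r /\
    forall z, 0 < Cmod (z - p) < r' -> Cmod (gb z) <= K / Cmod (z - p) ^ 3.
Proof.
  intros hD hac hZt hZ hr hN hF hgb.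
  destruct (hN p) as [a0 [b0 hNp]]; [rewrite Cmod_self; exact hr |].
  destruct (sdiff_lip _ _ _ _ _ _ hNp) as [d0 [K0 [hd0 [hK0 L]]]].
  set (r' := Rmin r d0). assert (hr' : 0 < r') by now apply Rmin_glb_lt.
  assert (R1 : r' <= r) by apply Rmin_l. assert (R2 : r' <= d0) by apply Rmin_r.
  set (B := Cmod (N p t) + K0 * r').
  assert (nN := Cmod_ge_0 (N p t)). assert (nz := Cmod_ge_0 zd).
  assert (hB : 0 <= B) by (unfold B; nra).
  exists (K0 * r' + 2 * B * Cmod zd), r'. split; [nra |]. split; [lra |].
  intros z hz.
  assert (nzp : (z - p)%C <> 0%C) by (apply Cmod_gt_0; lra).
  destruct (hN z ltac:(lra)) as [aN [bN hNz]].
  assert (hbN : Cmod bN <= K0).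
  { apply (pderiv_bound D (N z) t bN K0 d0 hac hd0 (sdiff_pderiv _ _ _ _ _ _ hNz)).
    intros s hs hst. specialize (L z z s ltac:(lra) ltac:(lra) hs hst).
    rewrite Cmod_self, Rplus_0_l in L. exact L. }
  assert (hNB : Cmod (N z t) <= B).
  { specialize (L p z t). rewrite Cmod_self, Rminus_eq_0, Rabs_R0 in L.
    specialize (L hd0 ltac:(lra) hD hd0). unfold B.
    assert (T := Cmod_triangle_sub (N z t) (N p t)). nra. }
  assert (hu : sdiff D (fun (_ : C) s => (z - Z s)%C) 0 t (0 - 0) (0 - zd)).
  { apply sdiff_minus; [exact hD | apply sdiff_const | now apply sdiff_of_pderiv]. }
  assert (nzt : (z - Z t)%C <> 0%C) by (rewrite hZt; exact nzp).
  assert (hw := sdiff_inv D _ _ _ _ _ hD nzt hu).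
  assert (hww := sdiff_mult D _ _ _ _ _ _ _ _ hD hw hw).
  assert (hall := sdiff_mult D _ _ _ _ _ _ _ _ hD
    (sdiff_of_pderiv D _ 0 _ _ (sdiff_pderiv _ _ _ _ _ _ hNz)) hww).
  cbv beta in hall. apply sdiff_pderiv in hall.
  assert (ext : exists e, 0 < e /\ forall s, D s -> Rabs (s - t) < e -> z <> Z s).
  { destruct (sdiff_nonzero _ _ _ _ _ _ hu nzt) as [e [he hE]].
    exists e. split; [exact he |]. intros s hs hst hzs.
    specialize (hE 0%C s). rewrite Cmod_self in hE. specialize (hE he hs hst).
    rewrite <- hzs, Cmod_self in hE. generalize (Cmod_ge_0 (z - Z t)). lra. }
  destruct ext as [e [he hE]].
  assert (X := pderiv_ext_loc D _ (F z) t _ e he hD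
     (fun s hs hst => eq_sym (hF z s hs (hE s hs hst))) hall).
  rewrite (pderiv_unique D (F z) t _ _ hac (hgb z ltac:(lra)) X).
  rewrite hZt in *.
  set (u := (z - p)%C) in *. set (rho := Cmod u) in *.
  (* The time derivative of [N / (z - Z)^2] is [N_t / (z - p)^2 + 2 N Z' / (z - p)^3]; the triple
     pole is due to the motion of the pole. *)
  match goal with |- Cmod ?X <= _ =>
    replace X with (bN * / (u * u) + 2 * N z t * zd * / (u * u * u))%C by (field; exact nzp) end.
  eapply Rle_trans; [apply Cmod_triangle |].
  rewrite !Cmod_mult, !Cmod_inv, !Cmod_mult, Cmod_R, (Rabs_right 2)
    by (try lra; repeat apply Cmult_neq_0; exact nzp).
  fold rho.
  assert (h3 : 0 < rho ^ 3) by (apply pow_lt; lra).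
  apply Rle_div_r; [exact h3 |].
  replace ((Cmod bN * / (rho * rho) + 2 * Cmod (N z t) * Cmod zd * / (rho * rho * rho)) * rho ^ 3)
    with (Cmod bN * rho + 2 * Cmod (N z t) * Cmod zd) by (field; lra).
  apply Rplus_le_compat.
  - apply Rmult_le_compat; try apply Cmod_ge_0; lra.
  - apply Rmult_le_compat_r; lra.
Qed.

(** * Differentiability of the data of a slit family *)

(** [filterdiff] demands its estimate at every limit of the filter; as [t] belongs to [J], the
    relative neighbourhood filter has no limit other than [t]. *)
Lemma within_lim_unique (J : R -> Prop) (t x : R) : J t ->
  is_filter_lim (within J (locally t)) x -> x = t.
Proof.
  intros ht h. destruct (Req_dec x t) as [e | n]; [exact e | exfalso].
  assert (hp : 0 < Rabs (x - t)) by (apply Rabs_pos_lt; lra).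
  destruct (h (fun y => Rabs (y - x) < Rabs (x - t))) as [[d hd] h'].
  { exists (mkposreal _ hp). intros y hy. exact hy. }
  specialize (h' t (ball_center t _) ht). rewrite Rabs_minus_sym in h'. lra.
Qed.

Lemma is_derive_on_pderiv (J : R -> Prop) (g : R -> C) t l : J t ->
  is_derive_on (V := C_R_NormedModule) J g t l <-> pderiv J g t l.
Proof.
  intros ht.
  assert (E : forall y, (minus (minus (g y) (g t)) (scal (minus y t) l) : C_R_NormedModule)
            = (g y - g t - l * RtoC (y - t))%C).
  { intros y. apply injective_projections; simpl;
      unfold minus, plus, opp, scal; simpl; unfold mult; simpl; ring. }
  split.
  - intros [_ h] e he.
    destruct (h t) with (eps := mkposreal e he) as [[d hd] h'].
    { intros Q [d hQ]. exists d. intros y hy _. now apply hQ. }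
    exists d. split; [exact hd |]. intros s hs hst. specialize (h' s hst hs).
    rewrite <- E, <- norm_C_R. exact h'.
  - intros h. split.
    { apply (is_linear_scal_l (V := C_R_NormedModule)). }
    intros x hx. apply within_lim_unique in hx; [| exact ht]. subst x.
    intros [e he]. destruct (h e he) as [d [hd h']].
    exists (mkposreal d hd). intros y hy hJ. specialize (h' y hJ hy).
    rewrite <- E, <- norm_C_R in h'. exact h'.
Qed.

Lemma is_derive_on_pderiv_R (J : R -> Prop) (g : R -> R) t l : J t ->
  is_derive_on (V := R_NormedModule) J g t l <-> pderiv J (fun s => RtoC (g s)) t (RtoC l).
Proof.
  intros ht.
  assert (E : forall y, minus (minus (g y) (g t)) (scal (minus y t) l)
            = g y - g t - l * (y - t)).
  { intros y. unfold minus, plus, opp, scal; simpl; unfold mult; simpl; ring. }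
  split.
  - intros [_ h] e he.
    destruct (h t) with (eps := mkposreal e he) as [[d hd] h'].
    { intros Q [d hQ]. exists d. intros y hy _. now apply hQ. }
    exists d. split; [exact hd |]. intros s hs hst. specialize (h' s hst hs).
    rewrite <- RtoC_mult, <- !RtoC_minus, Cmod_R, <- E. exact h'.
  - intros h. split.
    { apply (is_linear_scal_l (V := R_NormedModule)). }
    intros x hx. apply within_lim_unique in hx; [| exact ht]. subst x.
    intros [e he]. destruct (h e he) as [d [hd h']].
    exists (mkposreal d hd). intros y hy hJ. specialize (h' y hJ hy).
    rewrite <- RtoC_mult, <- !RtoC_minus, Cmod_R, <- E in h'. exact h'.
Qed.

Lemma pderiv_ext (D : R -> Prop) g1 g2 t l : D t -> (forall s, D s -> g1 s = g2 s) ->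
  pderiv D g1 t l -> pderiv D g2 t l.
Proof.
  intros hD hE h e he. destruct (h e he) as [d [hd h']]. exists d. split; [exact hd |].
  intros s hs hst. rewrite <- !hE by assumption. now apply h'.
Qed.

Lemma smooth_on_pderiv (J : R -> Prop) (g : R -> C) t : J t ->
  smooth_on (V := C_R_NormedModule) J g -> exists l, pderiv J g t l.
Proof.
  intros ht [d [h0 h]]. exists (d 1%nat t).
  apply (pderiv_ext J (d O)); auto. apply is_derive_on_pderiv; auto.
Qed.

Lemma smooth_on_pderiv_R (J : R -> Prop) (g : R -> R) t : J t ->
  smooth_on (V := R_NormedModule) J g -> exists l : R, pderiv J (fun s => RtoC (g s)) t (RtoC l).
Proof.
  intros ht [d [h0 h]]. exists (d 1%nat t).
  apply (pderiv_ext J (fun s => RtoC (d O s))); auto.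
  - intros; f_equal; auto.
  - apply is_derive_on_pderiv_R; auto.
Qed.

(** A nondegenerate interval contains times arbitrarily close to [t] on at least one side, also when
    [t] is an end point. *)
Lemma interval_accum J t : interval J -> J t -> accum J t.
Proof.
  intros [hc [a [b [ha [hb hab]]]]] ht d hd.
  destruct (Rlt_dec t b) as [l | n].
  - exists (Rmin b (t + d / 2)).
    assert (t < Rmin b (t + d / 2)) by (apply Rmin_glb_lt; lra).
    assert (Rmin b (t + d / 2) <= b) by apply Rmin_l.
    assert (Rmin b (t + d / 2) <= t + d / 2) by apply Rmin_r.
    split; [apply (hc t b); auto; lra |]. split; [lra |]. rewrite Rabs_right; lra.
  - exists (Rmax a (t - d / 2)).
    assert (Rmax a (t - d / 2) < t) by (apply Rmax_lub_lt; lra).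
    assert (a <= Rmax a (t - d / 2)) by apply Rmax_l.
    assert (t - d / 2 <= Rmax a (t - d / 2)) by apply Rmax_r.
    split; [apply (hc a t); auto; lra |]. split; [lra |]. rewrite Rabs_left; lra.
Qed.

Lemma pderiv_plus D g1 g2 t l1 l2 : pderiv D g1 t l1 -> pderiv D g2 t l2 ->
  pderiv D (fun s => (g1 s + g2 s)%C) t (l1 + l2)%C.
Proof.
  intros h1 h2. exact (sdiff_pderiv _ _ _ _ _ _
    (sdiff_plus _ _ _ 0 _ _ _ _ _ (sdiff_of_pderiv _ _ _ _ _ h1) (sdiff_of_pderiv _ _ _ _ _ h2))).
Qed.

Lemma pderiv_scal (D : R -> Prop) c g t l : D t -> pderiv D g t l ->
  pderiv D (fun s => (c * g s)%C) t (c * l)%C.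
Proof.
  intros hD h. exact (sdiff_pderiv _ _ _ _ _ _
    (sdiff_scal _ c _ 0 _ _ _ hD (sdiff_of_pderiv _ _ _ _ _ h))).
Qed.

Lemma pderiv_eq D g t l l' : pderiv D g t l -> l = l' -> pderiv D g t l'.
Proof. now intros h <-. Qed.

Local Notation sigma := Defs.sigma.

Section Family.

Variables (J : R -> Prop) (theta beta : R) (P : slit_data) (f : C -> R -> Chat).
Hypothesis sf : slit_family J theta beta P f.

Lemma m_pderiv t : J t -> exists mp : R, pderiv J (fun s => RtoC (sd_m P s)) t (RtoC mp).
Proof. intros ht. apply smooth_on_pderiv_R; [exact ht | apply sf]. Qed.

Lemma zpt_pderiv t k : J t -> (k <= 4)%nat -> exists zd, pderiv J (zpt P k) t zd.
Proof.
  intros ht hk.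
  destruct (m_pderiv t ht) as [mp hm].
  destruct (smooth_on_pderiv_R J (sd_y0 P) t ht (sf_smooth_y0 _ _ _ _ _ sf)) as [yp hy].
  assert (hx : forall j, (1 <= j <= 4)%nat -> exists l : R, pderiv J (fun s => RtoC (sd_x P j s)) t (RtoC l)).
  { intros j hj. apply smooth_on_pderiv_R; [exact ht | now apply sf]. }
  destruct (hx 1%nat ltac:(lia)) as [l1 h1]. destruct (hx 2%nat ltac:(lia)) as [l2 h2].
  destruct (hx 3%nat ltac:(lia)) as [l3 h3]. destruct (hx 4%nat ltac:(lia)) as [l4 h4].
  destruct k as [| [| [| [| [| k]]]]]; try lia; eexists.
  - exact (pderiv_scal J Ci _ _ _ ht hy).
  - exact h1.
  - exact h2.
  - exact (pderiv_plus _ _ _ _ _ _ h3 (pderiv_scal J Ci _ _ _ ht hm)).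
  - apply (pderiv_ext J (fun s => RtoC (sd_x P 4 s) + (- Ci) * RtoC (sd_m P s))%C); auto.
    + intros. unfold zpt. ring.
    + exact (pderiv_plus _ _ _ _ _ _ h4 (pderiv_scal J (- Ci)%C _ _ _ ht hm)).
Qed.

Lemma conj_z0 s : Cconj (zpt P 0 s) = (- zpt P 0 s)%C.
Proof. unfold zpt. apply injective_projections; simpl; ring. Qed.

Lemma conj_z0_pderiv t : J t -> exists zd, pderiv J (fun s => Cconj (zpt P 0 s)) t zd.
Proof.
  intros ht. destruct (zpt_pderiv t 0 ht ltac:(lia)) as [zd h].
  eexists. apply (pderiv_ext J (fun s => (- (1)) * zpt P 0 s)%C); auto.
  - intros. rewrite conj_z0. ring.
  - exact (pderiv_scal J (- (1))%C _ _ _ ht h).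
Qed.

Lemma sigma_eq s w : J s -> sigma P s w = (w * sig_red w (sd_m P s))%C.
Proof. intros hs. apply wsigma_eq. now apply sf. Qed.

Lemma sigma_nonzero s w : J s -> ~ in_lattice (sd_m P s) w -> sigma P s w <> 0%C.
Proof.
  intros hs h. rewrite sigma_eq by exact hs. apply Cmult_neq_0.
  - intros ->. apply h. exists 0%Z, 0%Z. ring.
  - apply sig_red_nonzero; [now apply sf | now right].
Qed.

Section Strict.

Variables (D : R -> Prop) (t : R).
Hypothesis hDt : D t.
Hypothesis hDJ : forall s, D s -> J s.

Lemma sig_red_comp Z zd xi : pderiv D Z t zd ->
  sdiffable D (fun z s => sig_red (z - Z s) (sd_m P s)) xi t.
Proof.
  intros hZ. destruct (m_pderiv t (hDJ t hDt)) as [mp hm].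
  assert (hm0 : 0 < sd_m P t) by (apply (sf_m _ _ _ _ _ sf), hDJ, hDt).
  destruct (sig_red_sdiffable (xi - Z t) (sd_m P t) hm0) as [a [b h]].
  eexists. eexists.
  apply (sdiff_comp D (fun _ => True) sig_red (sd_m P) (fun z s => z - Z s)%C (xi - Z t)%C (sd_m P t));
    auto.
  - exact h.
  - exact (sdiff_minus D _ _ _ _ _ _ _ _ hDt (sdiff_id D xi t) (sdiff_of_pderiv _ _ _ _ _ hZ)).
  - exact (pderiv_incl _ _ _ _ _ hDJ hm).
Qed.

Lemma sdiffable_mult F G z : sdiffable D F z t -> sdiffable D G z t ->
  sdiffable D (fun v s => F v s * G v s)%C z t.
Proof.
  intros [a [b h]] [a' [b' h']]. eexists. eexists. exact (sdiff_mult D _ _ _ _ _ _ _ _ hDt h h').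
Qed.

Lemma sdiffable_ext F G z : (forall v s, D s -> F v s = G v s) ->
  sdiffable D F z t -> sdiffable D G z t.
Proof.
  intros E [a [b h]]. exists a, b. apply (sdiff_ext D F G z t a b 1); auto. lra.
Qed.

Lemma sdiffable_inv (F : C -> R -> C) z : F z t <> 0%C -> sdiffable D F z t ->
  sdiffable D (fun v s => / F v s)%C z t.
Proof.
  intros h0 [a [b h]]. eexists. eexists. exact (sdiff_inv D _ _ _ _ _ hDt h0 h).
Qed.

Lemma sdiffable_par mu b z : pderiv D mu t b -> sdiffable D (fun _ s => mu s) z t.
Proof. intros h. exists 0%C, b. now apply sdiff_of_pderiv. Qed.

Lemma sdiffable_shift mu b z : pderiv D mu t b -> sdiffable D (fun v s => v - mu s)%C z t.
Proof.
  intros h. eexists. eexists.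
  exact (sdiff_minus D _ _ _ _ _ _ _ _ hDt (sdiff_id D z t) (sdiff_of_pderiv _ _ _ _ _ h)).
Qed.

Lemma sigma_comp Z zd xi : pderiv D Z t zd ->
  sdiffable D (fun z s => sigma P s (z - Z s)) xi t.
Proof.
  intros hZ.
  apply (sdiffable_ext (fun z s => (z - Z s) * sig_red (z - Z s) (sd_m P s))%C).
  - intros v s hs. now rewrite sigma_eq by auto.
  - apply sdiffable_mult; [now apply (sdiffable_shift Z zd) | now apply (sig_red_comp Z zd)].
Qed.

Lemma sigma_zpt k xi : (k <= 4)%nat ->
  sdiffable D (fun z s => sigma P s (z - zpt P k s)) xi t.
Proof.
  intros hk. destruct (zpt_pderiv t k (hDJ t hDt) hk) as [zd hz].
  apply (sigma_comp (zpt P k) zd). exact (pderiv_incl _ _ _ _ _ hDJ hz).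
Qed.

Lemma sigma_conj_z0 xi : sdiffable D (fun z s => sigma P s (z - Cconj (zpt P 0 s))) xi t.
Proof.
  destruct (conj_z0_pderiv t (hDJ t hDt)) as [zd hz].
  apply (sigma_comp (fun s => Cconj (zpt P 0 s)) zd). exact (pderiv_incl _ _ _ _ _ hDJ hz).
Qed.

Lemma denom_sdiffable xi : sdiffable D (fun z s => denom P s z) xi t.
Proof.
  assert (A := sigma_zpt 0 xi ltac:(lia)). assert (B := sigma_conj_z0 xi).
  apply (sdiffable_ext (fun z s => (sigma P s (z - zpt P 0 s) * sigma P s (z - zpt P 0 s))
     * (sigma P s (z - Cconj (zpt P 0 s)) * sigma P s (z - Cconj (zpt P 0 s))))%C).
  - intros v s _. unfold denom. generalize (sigma P s (v - zpt P 0 s)), (sigma P s (v - Cconj (zpt P 0 s))).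
    intros u w. simpl. ring.
  - apply sdiffable_mult; apply sdiffable_mult; assumption.
Qed.

Variable gp : C.
Hypothesis hgam : pderiv D (gam beta P) t gp.

Lemma exp_sdiffable xi : sdiffable D (fun z s => Cexp (gam beta P s * z)) xi t.
Proof.
  assert (X := sdiff_mult D _ _ _ _ _ _ _ _ hDt (sdiff_of_pderiv D _ xi t _ hgam) (sdiff_id D xi t)).
  eexists. eexists. exact (sdiff_comp_outer D Cexp _ _ _ _ _ _ hDt (Cexp_cstrict _) X).
Qed.

Definition numer s xi : C := Cprod (map (fun k => sigma P s (xi - zpt P k s)) [1; 2; 3; 4]%nat).

Lemma numer_sdiffable xi : sdiffable D (fun z s => numer s z) xi t.
Proof.
  unfold numer. cbn [map Cprod fold_right].
  repeat apply sdiffable_mult; try (apply sigma_zpt; lia).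
  exists 0%C, 0%C. exact (sdiff_const D 1%C xi t).
Qed.

Lemma integrand_sdiffable xi : denom P t xi <> 0%C ->
  sdiffable D (fun z s => integrand beta P s z) xi t.
Proof.
  intros h0. unfold integrand, Cdiv.
  apply sdiffable_mult.
  - apply sdiffable_mult; [apply exp_sdiffable | apply numer_sdiffable].
  - apply (sdiffable_inv (fun z s => denom P s z)); [exact h0 | apply denom_sdiffable].
Qed.

End Strict.

(** * Location of the zeros and poles of the integrand *)

Lemma in_lattice_Re m w : in_lattice m w -> exists i : Z, Re w = IZR i.
Proof. intros [i [j ->]]. exists i. unfold Re; simpl. ring. Qed.

Lemma in_lattice_Im m w : in_lattice m w -> exists j : Z, Im w = IZR j * (2 * m).
Proof. intros [i [j ->]]. exists j. unfold Im; simpl. ring. Qed.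

(** Imaginary parts of lattice points are integral multiples of [2 * m]. *)
Lemma not_lattice_Im m w : 0 < Rabs (Im w) < 2 * m -> ~ in_lattice m w.
Proof.
  intros h hl. apply in_lattice_Im in hl. destruct hl as [j hj].
  rewrite hj, Rabs_mult, <- abs_IZR, (Rabs_right (2 * m)) in h by (generalize (Rabs_pos (Im w)); lra).
  assert (A : 0 < IZR (Z.abs j)) by nra. assert (B : IZR (Z.abs j) < 1) by nra.
  apply lt_IZR in A. apply lt_IZR in B. lia.
Qed.

Lemma denom_nonzero s xi : J s -> ~ in_lattice (sd_m P s) (xi - zpt P 0 s) ->
  ~ in_lattice (sd_m P s) (xi + zpt P 0 s) -> denom P s xi <> 0%C.
Proof.
  intros hs h1 h2. unfold denom. rewrite conj_z0.
  replace (xi - - zpt P 0 s)%C with (xi + zpt P 0 s)%C by ring.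
  simpl Cpow. repeat apply Cmult_neq_0; try (now apply sigma_nonzero);
    intros h; apply RtoC_inj in h; lra.
Qed.

Lemma Re_shift_z0 s xi : Re (xi - zpt P 0 s) = Re xi /\ Re (xi + zpt P 0 s) = Re xi.
Proof. unfold zpt, Re; simpl. split; ring. Qed.

Lemma Im_shift_z0 s xi : Im (xi - zpt P 0 s) = Im xi - sd_y0 P s /\
  Im (xi + zpt P 0 s) = Im xi + sd_y0 P s.
Proof. unfold zpt, Im; simpl. split; ring. Qed.

Lemma denom_nonzero_Re s xi : J s -> (forall i : Z, Re xi <> IZR i) -> denom P s xi <> 0%C.
Proof.
  intros hs h. destruct (Re_shift_z0 s xi) as [e1 e2].
  apply denom_nonzero; [exact hs | |]; intros hl; apply in_lattice_Re in hl;
    destruct hl as [i hi]; apply (h i); congruence.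
Qed.

(** The poles have height [y0] or [- y0] modulo [2 * m], and [0 < y0 < m]. With the preceding lemma
    on real parts, this gives the two kinds of pole-free lines from which paths are built. *)
Lemma denom_nonzero_real s xi : J s -> Im xi = 0 -> denom P s xi <> 0%C.
Proof.
  intros hs h. destruct (Im_shift_z0 s xi) as [e1 e2].
  assert (hy := sf_y0 _ _ _ _ _ sf s hs).
  apply denom_nonzero; [exact hs | |]; apply not_lattice_Im.
  - rewrite e1, h, Rminus_0_l, Rabs_Ropp, Rabs_right; lra.
  - rewrite e2, h, Rplus_0_l, Rabs_right; lra.
Qed.

(** * Pole-free paths from the origin, assembled from squared positive parts, which are [C^1] *)

Definition ramp (c k x : R) : R := Rmax 0 (c + k * x) ^ 2.

Lemma ramp_deriv c k x : is_derive (ramp c k) x (2 * k * Rmax 0 (c + k * x)).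
Proof.
  apply is_derive_eps. intros e he.
  assert (hq : 0 < e / (k ^ 2 + 1)).
  { apply Rdiv_lt_0_compat; [exact he |]. generalize (pow2_ge_0 k). lra. }
  exists (e / (k ^ 2 + 1)). split; [exact hq |].
  intros y hy. unfold ramp.
  set (u := c + k * x). set (d := k * (y - x)).
  replace (c + k * y) with (u + d) by (unfold u, d; ring).
  replace (2 * k * Rmax 0 u * (y - x)) with (2 * Rmax 0 u * d) by (unfold d; ring).
  apply Rle_trans with (d ^ 2).
  - unfold Rmax. destruct (Rle_dec 0 u), (Rle_dec 0 (u + d)); apply Rabs_le; split; nra.
  - unfold d. rewrite Rpow_mult_distr, <- (pow2_abs (y - x)).
    assert (P2 := pow2_ge_0 k). assert (p := Rabs_pos (y - x)).
    assert (X : (k ^ 2 + 1) * Rabs (y - x) <= e).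
    { apply Rle_trans with ((k ^ 2 + 1) * (e / (k ^ 2 + 1))).
      - apply Rmult_le_compat_l; lra.
      - apply Req_le. field. lra. }
    nra.
Qed.

Lemma rcont_Rmax c k x : rcont (fun y => RtoC (Rmax 0 (c + k * y))) x.
Proof.
  intros e he.
  assert (hq : 0 < e / (Rabs k + 1)).
  { apply Rdiv_lt_0_compat; [exact he |]. generalize (Rabs_pos k). lra. }
  exists (e / (Rabs k + 1)). split; [exact hq |]. intros y hy.
  rewrite <- RtoC_minus, Cmod_R.
  apply Rle_lt_trans with (Rabs k * Rabs (y - x)).
  - rewrite <- Rabs_mult. replace (k * (y - x)) with ((c + k * y) - (c + k * x)) by ring.
    unfold Rmax. destruct (Rle_dec 0 (c + k * y)), (Rle_dec 0 (c + k * x));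
      unfold Rabs; repeat destruct Rcase_abs; lra.
  - assert (p := Rabs_pos k). assert (p' := Rabs_pos (y - x)).
    apply Rle_lt_trans with ((Rabs k + 1) * Rabs (y - x)); [nra |].
    apply Rlt_le_trans with ((Rabs k + 1) * (e / (Rabs k + 1))).
    + apply Rmult_lt_compat_l; lra.
    + apply Req_le. field. lra.
Qed.

(* The path runs along the real axis to [a'], then vertically, then horizontally
   to [u]; the poles have integral real part, so [a'] is chosen off the integers. *)
Lemma good_path t u : J t -> denom P t u <> 0%C ->
  exists p dp, C1_path p dp /\ p 0 = RtoC 0 /\ p 1 = u /\
    forall x, 0 <= x <= 1 -> denom P t (p x) <> 0%C.
Proof.
  intros ht hu.
  set (a := Re u). set (b := Im u).
  (* If [Re u] is an integer, [a'] is a half unit to the right of it. The last leg then has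
     non-integral real part except at its end [u], where [denom] is nonzero by hypothesis. *)
  assert (ha : exists a', (forall i : Z, a' <> IZR i) /\
     forall s, 0 <= s < 1 -> forall i : Z, a' + (a - a') * s <> IZR i).
  { destruct (classic (exists n : Z, a = IZR n)) as [[n hn] | hn].
    - assert (A : forall s, 0 <= s < 1 -> forall i : Z, a + / 2 + (a - (a + / 2)) * s <> IZR i).
      { intros s hs i hi. rewrite hn in hi.
        assert (h1 : IZR 0 < IZR (i - n)) by (rewrite minus_IZR; lra).
        assert (h2 : IZR (i - n) < IZR 1) by (rewrite minus_IZR; lra).
        apply lt_IZR in h1. apply lt_IZR in h2. lia. }
      exists (a + / 2). split; [| exact A].
      intros i hi. apply (A 0 ltac:(lra) i). lra.
    - exists a. split.
      + intros i hi. apply hn. now exists i.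
      + intros s _ i hi. apply hn. exists i. lra. }
  destruct ha as [a' [ha1 ha2]].
  set (A := RtoC a'). set (B := RtoC (a - a')). set (E := (Ci * RtoC b)%C).
  set (rr := fun c k x => RtoC (ramp c k x)).
  set (dr := fun c k x => (RtoC (2 * k) * RtoC (Rmax 0 (c + k * x)))%C).
  (* One leg on each third of [[0, 1]]: the real part is [a' (1 - (1 - 3 x)^2)] on the first and
     [a' + (a - a') (3 x - 2)^2] on the last. The three ramps with coefficients 2, -4, 2 form a
     quadratic step from 0 to 1 on the middle third. The speed vanishes at both corners, so the path
     is [C^1]. *)
  set (p := fun x => (A + (- A) * rr 1%R (-3)%R x + (B * rr (-2)%R 3%R x
      + ((E * 2) * rr (-1)%R 3%R x + (- (E * 4) * rr (-3/2)%R 3%R x + (E * 2) * rr (-2)%R 3%R x))))%C).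
  set (dp := fun x => (0 + (- A) * dr 1%R (-3)%R x + (B * dr (-2)%R 3%R x
      + ((E * 2) * dr (-1)%R 3%R x + (- (E * 4) * dr (-3/2)%R 3%R x + (E * 2) * dr (-2)%R 3%R x))))%C).
  exists p, dp.
  assert (hR : forall x, Re (p x) = a' * (1 - ramp 1 (-3) x) + (a - a') * ramp (-2) 3 x).
  { intros x. unfold p, rr, A, B, E, Re; simpl. ring. }
  assert (hI : forall x, Im (p x)
     = b * (2 * ramp (-1) 3 x - 4 * ramp (-3/2) 3 x + 2 * ramp (-2) 3 x)).
  { intros x. unfold p, rr, A, B, E, Im; simpl. ring. }
  assert (z1 : forall c k x, c + k * x <= 0 -> ramp c k x = 0).
  { intros c k x h. unfold ramp. rewrite Rmax_left by lra. ring. }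
  assert (z2 : forall c k x, 0 <= c + k * x -> ramp c k x = (c + k * x) ^ 2).
  { intros c k x h. unfold ramp. rewrite Rmax_right by lra. ring. }
  assert (h1 : p 1 = u).
  { assert (r1 : Re (p 1) = a).
    { rewrite hR, z1, z2 by lra. ring. }
    assert (r2 : Im (p 1) = b).
    { rewrite hI, !z2 by lra. field. }
    apply injective_projections; [exact r1 | exact r2]. }
  split; [| split; [| split; [exact h1 |]]].
  - intros x _. split.
    + apply rderiv_is_derive, rderiv_pderiv.
      assert (T : (fun _ : R => True) x) by easy.
      assert (X : forall c k, pderiv (fun _ => True) (rr c k) x (dr c k x)).
      { intros c k. unfold dr. rewrite <- RtoC_mult.
        apply rderiv_pderiv, (rderiv_RtoC (ramp c k)), ramp_deriv. }
      assert (K : pderiv (fun _ => True) (fun _ => A) x 0).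
      { intros e he. exists 1. split; [lra |]. intros s _ _.
        replace (A - A - 0 * RtoC (s - x))%C with (RtoC 0) by ring.
        rewrite Cmod_0. generalize (Rabs_pos (s - x)). nra. }
      unfold p, dp.
      apply pderiv_plus; [apply pderiv_plus; [exact K | apply pderiv_scal; [exact T | apply X]] |].
      repeat apply pderiv_plus; apply pderiv_scal; try exact T; apply X.
    + apply rcont_continuous. unfold dp, dr.
      repeat (apply rcont_plus || apply rcont_mult || apply rcont_const || apply rcont_Rmax).
  - assert (r1 : Re (p 0) = 0). { rewrite hR, z2, z1 by lra. ring. }
    assert (r2 : Im (p 0) = 0). { rewrite hI, !z1 by lra. ring. }
    apply injective_projections; [exact r1 | exact r2].
  - intros x hx.
    destruct (Rle_dec x (1 / 3)) as [c1 | c1].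
    { apply denom_nonzero_real; [exact ht |]. rewrite hI, !z1 by lra. ring. }
    destruct (Rle_dec x (2 / 3)) as [c2 | c2].
    { apply denom_nonzero_Re; [exact ht |]. intros i. rewrite hR, !z1 by lra.
      intros h. apply (ha1 i). lra. }
    destruct (Req_dec x 1) as [-> | c3]; [now rewrite h1 |].
    apply denom_nonzero_Re; [exact ht |]. intros i.
    rewrite hR, (z1 1), (z2 (-2)) by lra. intros h.
    apply (ha2 ((-2 + 3 * x) ^ 2) ltac:(nra) i). lra.
Qed.

(** * Joint differentiability of [f] away from its poles *)

Definition fv (v : C) (s : R) : C := fin (f v s).

(** Ordinary joint differentiability, each point being compared with the base point only. Unlike
    [sdiff], it is what the variation of a path with a free end point delivers. *)
Definition ndiff (D : R -> Prop) (F : C -> R -> C) (u : C) (t : R) (A B : C) : Prop :=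
  forall eps, 0 < eps -> exists d, 0 < d /\ forall v s, Cmod (v - u) < d -> D s ->
    Rabs (s - t) < d ->
    Cmod (F v s - F u t - A * (v - u) - B * RtoC (s - t))
      <= eps * (Cmod (v - u) + Rabs (s - t)).

Lemma pderiv_singleton mu s b : pderiv (eq s) mu s b.
Proof.
  intros e he. exists 1. split; [lra |]. intros s' <- _.
  rewrite Rminus_eq_0. replace (mu s - mu s - b * 0)%C with (RtoC 0) by ring.
  rewrite Cmod_0, Rabs_R0. lra.
Qed.

(** With time frozen, the requirement that [gam] be differentiable holds trivially. Hence [f] can be
    differentiated in [z] before anything is known about [gam] as a function of time. *)
Lemma integrand_singleton s xi : J s -> denom P s xi <> 0%C ->
  sdiffable (eq s) (fun z s => integrand beta P s z) xi s.
Proof.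
  intros hs h. apply (integrand_sdiffable (eq s) s eq_refl) with (gp := RtoC 0).
  - now intros s' <-.
  - apply pderiv_singleton.
  - exact h.
Qed.

Lemma denom_open (D : R -> Prop) t xi : D t -> (forall s, D s -> J s) -> denom P t xi <> 0%C ->
  exists r, 0 < r /\ forall z s, Cmod (z - xi) < r -> D s -> Rabs (s - t) < r ->
    denom P s z <> 0%C.
Proof.
  intros hD hDJ h. destruct (denom_sdiffable D t hD hDJ xi) as [a [b hd]].
  destruct (sdiff_nonzero _ _ _ _ _ _ hd h) as [r [hr h']].
  exists r. split; [exact hr |]. intros z s hz hs hst. apply Cmod_gt_0.
  specialize (h' z s hz hs hst). apply Cmod_gt_0 in h. lra.
Qed.

(** The path to [u] is deformed into a path to [v] that still avoids the poles at the nearby time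
    [s], so the integral formula applies to both; [path_variation] compares the two integrals. *)
Lemma f_ndiff (D : R -> Prop) t (a b : C -> C) u :
  D t -> (forall s, D s -> J s) ->
  (forall xi, denom P t xi <> 0%C ->
     sdiff D (fun z s => integrand beta P s z) xi t (a xi) (b xi)) ->
  (forall xi, denom P t xi <> 0%C -> ccont b xi) ->
  denom P t u <> 0%C ->
  exists B, ndiff D fv u t (sd_c P t * integrand beta P t u) B.
Proof.
  intros hD hDJ hS hb hu.
  assert (ht := hDJ t hD).
  destruct (good_path t u ht hu) as [p [dp [hp [p0 [p1 hden]]]]].
  destruct (smooth_on_pderiv J (sd_c P) t ht (sf_smooth_c _ _ _ _ _ sf)) as [c' hc].
  destruct (smooth_on_pderiv J (sd_c1 P) t ht (sf_smooth_c1 _ _ _ _ _ sf)) as [c1' hc1].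
  apply (pderiv_incl J D) in hc; [| exact hDJ]. apply (pderiv_incl J D) in hc1; [| exact hDJ].
  assert (hO : forall x, 0 <= x <= 1 -> exists r, 0 < r /\ forall xi s,
     Cmod (xi - p x) < r -> D s -> Rabs (s - t) < r -> denom P s xi <> 0%C).
  { intros x hx. apply denom_open; auto. }
  assert (hC : forall xi s, D s -> denom P s xi <> 0%C ->
     ccont (fun z => integrand beta P s z) xi).
  { intros xi s hs h. destruct (integrand_singleton s xi (hDJ s hs) h) as [a1 [b1 h1]].
    apply (cderiv_ccont _ _ a1).
    exact (cstrict_cderiv _ _ _ (sdiff_cstrict (eq s) _ _ _ _ _ eq_refl h1)). }
  (* [e = 0, k = 1]: the path keeps starting at 0 and its end point moves from [u] to [v]. *)
  assert (V := path_variation D t (fun z s => integrand beta P s z) a b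
     (fun xi s => denom P s xi <> 0%C) p dp 0 1 hD ltac:(lra) ltac:(lra) ltac:(lra)
     hp hO hC hS hb).
  destruct (path_near_open D t (fun xi s => denom P s xi <> 0%C) p dp 0 1 ltac:(lra) ltac:(lra)
     ltac:(lra) hp hO) as [d0 [hd0 Onear]].
  set (I0 := path_integral (integrand beta P t) p dp) in *.
  set (Ib := CRInt (fun x => b (p x) * dp x)%C 0 1) in *.
  set (g := integrand beta P t u).
  set (c := sd_c P t) in *.
  (* The product rule in time for [c] times the integral plus [c1]. *)
  exists (c' * I0 + c * Ib + c1')%C.
  intros e he.
  assert (n1 := Cmod_ge_0 c). assert (n2 := Cmod_ge_0 c'). assert (n3 := Cmod_ge_0 I0).
  assert (n4 := Cmod_ge_0 Ib). assert (n5 := Cmod_ge_0 g).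
  set (M := 3 + Cmod c + Cmod I0 + Cmod g + Cmod Ib).
  assert (hM : 0 < M) by (unfold M; lra).
  set (q := Rmin 1 (e / M)).
  assert (hq : 0 < q) by (apply Rmin_glb_lt; [lra | apply Rdiv_lt_0_compat; lra]).
  assert (q1 : q <= 1) by apply Rmin_l.
  assert (qM : q * M <= e).
  { apply Rle_trans with (e / M * M); [| apply Req_le; field; lra].
    apply Rmult_le_compat_r; [lra | apply Rmin_r]. }
  destruct (V q hq) as [d1 [hd1 V1]].
  destruct (hc q hq) as [d2 [hd2 H2]]. destruct (hc1 q hq) as [d3 [hd3 H3]].
  set (K := Cmod c' + 1).
  assert (hqK : 0 < q / K) by (apply Rdiv_lt_0_compat; unfold K; lra).
  set (d := Rmin (Rmin d0 d1) (Rmin (Rmin d2 d3) (q / K))).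
  assert (Bd : d <= d0 /\ d <= d1 /\ d <= d2 /\ d <= d3 /\ d <= q / K).
  { unfold d. repeat split; rmin. }
  assert (hd : 0 < d) by (unfold d; repeat apply Rmin_glb_lt; assumption).
  exists d. split; [exact hd |].
  destruct Bd as (B0 & B1 & B2 & B3 & B4).
  intros v s hv hs hst.
  specialize (V1 (v - u)%C s ltac:(lra) hs ltac:(lra)).
  specialize (H2 s hs ltac:(lra)). specialize (H3 s hs ltac:(lra)).
  fold c in H2.
  assert (hpv : C1_path (fun x => p x + (v - u) * RtoC (0 + 1 * x))%C (fun x => dp x + (v - u) * RtoC 1)%C).
  { intros x hx. split.
    - apply rderiv_is_derive, rderiv_pderiv. apply pderiv_plus.
      + apply rderiv_pderiv, rderiv_is_derive. now apply hp.
      + apply pderiv_scal; [easy |]. apply rderiv_pderiv.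
        apply (rderiv_RtoC (fun x => 0 + 1 * x)). auto_derive; [exact I | ring].
    - apply rcont_continuous. apply rcont_plus; [| apply rcont_const].
      apply rcont_continuous. now apply hp. }
  assert (F1 : fv v s = (sd_c P s * path_integral (integrand beta P s)
      (fun x => p x + (v - u) * RtoC (0 + 1 * x)) (fun x => dp x + (v - u) * RtoC 1) + sd_c1 P s)%C).
  { unfold fv. rewrite (sf_formula _ _ _ _ _ sf s v
      (fun x => p x + (v - u) * RtoC (0 + 1 * x))%C (fun x => dp x + (v - u) * RtoC 1)%C); auto.
    - rewrite p0, Rmult_0_r, Rplus_0_r. ring.
    - rewrite p1, Rmult_1_r, Rplus_0_l. ring.
    - intros x hx. apply Onear; auto; lra. }
  assert (F0 : fv u t = (c * I0 + sd_c1 P t)%C).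
  { unfold fv. rewrite (sf_formula _ _ _ _ _ sf t u p dp); auto. }
  rewrite F1, F0.
  clear F1 F0.
  change (fun xi => integrand beta P s xi) with (integrand beta P s) in V1.
  set (Is := path_integral (integrand beta P s) _ _) in *.
  rewrite p1, p0 in V1. fold g in V1.
  replace ((v - u) * (g * RtoC (0 + 1) - integrand beta P t 0 * RtoC 0))%C
    with ((v - u) * g)%C in V1 by (rewrite Rplus_0_l; ring).
  set (R0 := (Is - I0 - (v - u) * g - RtoC (s - t) * Ib)%C) in *.
  set (dc := (sd_c P s - c - c' * RtoC (s - t))%C) in *.
  set (dc1 := (sd_c1 P s - sd_c1 P t - c1' * RtoC (s - t))%C) in *.
  replace (sd_c P s * Is + sd_c1 P s - (c * I0 + sd_c1 P t) - c * g * (v - u)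
     - (c' * I0 + c * Ib + c1') * RtoC (s - t))%C
    with (sd_c P s * R0 + ((sd_c P s - c) * ((v - u) * g + RtoC (s - t) * Ib)
          + (dc * I0 + dc1)))%C by (unfold R0, dc, dc1; ring).
  assert (pv := Cmod_ge_0 (v - u)). assert (ps := Rabs_pos (s - t)).
  set (w := Cmod (v - u) + Rabs (s - t)) in *.
  assert (hw : 0 <= w) by (unfold w; lra).
  assert (hsw : Rabs (s - t) <= w) by (unfold w; lra).
  assert (hdc : Cmod (sd_c P s - c) <= q).
  { replace (sd_c P s - c)%C with (dc + c' * RtoC (s - t))%C by (unfold dc; ring).
    eapply Rle_trans; [apply Cmod_triangle |]. rewrite Cmod_mult, Cmod_R.
    apply Rle_trans with (K * Rabs (s - t)); [unfold K; nra |].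
    apply Rle_trans with (K * (q / K)).
    - apply Rmult_le_compat_l; [unfold K; lra | lra].
    - apply Req_le. field. unfold K; lra. }
  assert (hcs : Cmod (sd_c P s) <= Cmod c + 1).
  { assert (T := Cmod_triangle_sub (sd_c P s) c). lra. }
  assert (X1 : Cmod (sd_c P s * R0) <= (Cmod c + 1) * (q * w)).
  { rewrite Cmod_mult. apply Rmult_le_compat; try apply Cmod_ge_0; [exact hcs | exact V1]. }
  assert (X2 : Cmod ((sd_c P s - c) * ((v - u) * g + RtoC (s - t) * Ib)) <= q * ((Cmod g + Cmod Ib) * w)).
  { rewrite Cmod_mult. apply Rmult_le_compat; try apply Cmod_ge_0; [exact hdc |].
    eapply Rle_trans; [apply Cmod_triangle |]. rewrite !Cmod_mult, Cmod_R. unfold w. nra. }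
  assert (X3 : Cmod (dc * I0 + dc1) <= q * w * Cmod I0 + q * w).
  { eapply Rle_trans; [apply Cmod_triangle |]. rewrite Cmod_mult.
    assert (Cmod dc * Cmod I0 <= q * w * Cmod I0).
    { apply Rmult_le_compat_r; [exact n3 |]. eapply Rle_trans; [exact H2 |].
      apply Rmult_le_compat_l; lra. }
    assert (Cmod dc1 <= q * w).
    { eapply Rle_trans; [exact H3 |]. apply Rmult_le_compat_l; lra. }
    lra. }
  eapply Rle_trans; [apply Cmod_triangle |].
  assert (T2 := Cmod_triangle ((sd_c P s - c) * ((v - u) * g + RtoC (s - t) * Ib)) (dc * I0 + dc1)).
  assert (X4 : q * M * w <= e * w) by (apply Rmult_le_compat_r; lra).
  unfold M in X4. nra.
Qed.

(** [f_ndiff] with time frozen at [s]. The time coefficient is then arbitrary and is taken to be 0,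
    which makes its continuity trivial. *)
Lemma f_cderiv s u : J s -> denom P s u <> 0%C ->
  cderiv (fun v => fv v s) u (sd_c P s * integrand beta P s u).
Proof.
  intros hs hu.
  assert (hc : exists a : C -> C, forall xi, denom P s xi <> 0%C ->
     sdiff (eq s) (fun z s => integrand beta P s z) xi s (a xi) 0).
  { exists (fun xi => epsilon (inhabits (RtoC 0)) (fun a =>
        sdiff (eq s) (fun z s => integrand beta P s z) xi s a 0)).
    intros xi h. apply epsilon_spec.
    destruct (integrand_singleton s xi hs h) as [a [b h1]]. exists a.
    intros e he. destruct (h1 e he) as [d [hd h2]]. exists d. split; [exact hd |].
    intros z1 z2 s' k1 k2 <- k3. specialize (h2 z1 z2 s k1 k2 eq_refl k3).
    rewrite Rminus_eq_0 in *.
    replace (integrand beta P s z2 - integrand beta P s z1 - a * (z2 - z1) - 0 * 0)%C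
      with (integrand beta P s z2 - integrand beta P s z1 - a * (z2 - z1) - b * 0)%C by ring.
    exact h2. }
  destruct hc as [a ha].
  destruct (f_ndiff (eq s) s a (fun _ => 0%C) u) as [B hB]; auto.
  - now intros s' <-.
  - intros xi _ e he. exists 1. split; [lra |]. intros. rewrite Cmod_self. lra.
  - intros e he. destruct (hB e he) as [d [hd h]]. exists d. split; [exact hd |].
    intros v hv. specialize (h v s hv eq_refl). rewrite Rminus_eq_0, Rabs_R0 in h.
    specialize (h hd). rewrite Rplus_0_r in h.
    replace (fv v s - fv u s - sd_c P s * integrand beta P s u * (v - u))%C
      with (fv v s - fv u s - sd_c P s * integrand beta P s u * (v - u) - B * 0)%C by ring.
    exact h.
Qed.

(** * The exponent [gam] as a differentiable function of time *)

Lemma cderiv_unique H w a b : cderiv H w a -> cderiv H w b -> a = b.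
Proof.
  intros ha hb. apply cderiv_is_derive in ha. apply cderiv_is_derive in hb.
  apply is_C_derive_unique in ha. apply is_C_derive_unique in hb. congruence.
Qed.

Lemma cderiv_ext F G w a : (forall v, F v = G v) -> cderiv F w a -> cderiv G w a.
Proof.
  intros E h e he. destruct (h e he) as [d [hd h']]. exists d. split; [exact hd |].
  intros. rewrite <- !E. now apply h'.
Qed.

Lemma cderiv_shift F w c a : cderiv F (w + c)%C a -> cderiv (fun v => F (v + c)%C) w a.
Proof.
  intros h e he. destruct (h e he) as [d [hd h']]. exists d. split; [exact hd |].
  intros v hv. specialize (h' (v + c)%C).
  replace (v + c - (w + c))%C with (v - w)%C in h' by ring. now apply h'.
Qed.

Lemma cderiv_real W x a : cderiv W (RtoC x) a -> (forall y, Im (W (RtoC y)) = 0) -> Im a = 0.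
Proof.
  intros h hW. apply Rabs_eq_0, Rle_antisym; [| apply Rabs_pos].
  apply le_epsilon. intros e he. rewrite Rplus_0_l.
  destruct (h e he) as [d [hd h']].
  specialize (h' (RtoC (x + d / 2))).
  replace (RtoC (x + d / 2) - RtoC x)%C with (RtoC (d / 2)) in h' by (rewrite RtoC_plus; ring).
  rewrite Cmod_R, Rabs_right in h' by lra. specialize (h' ltac:(lra)).
  assert (T := im_le_Cmod (W (RtoC (x + d / 2)) - W (RtoC x) - a * RtoC (d / 2))).
  replace (Im (W (RtoC (x + d / 2)) - W (RtoC x) - a * RtoC (d / 2)))
    with (Im (W (RtoC (x + d / 2))) - Im (W (RtoC x)) - Im a * (d / 2)) in T
    by (unfold Im; simpl; ring).
  rewrite !hW in T. replace (0 - 0 - Im a * (d / 2)) with (- (Im a * (d / 2))) in T by ring.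
  rewrite Rabs_Ropp, Rabs_mult, (Rabs_right (d / 2)) in T by lra. nra.
Qed.

Lemma wsigma_cderiv s z : J s -> exists a, cderiv (wsigma 1 (omega2 P s)) z a.
Proof.
  intros hs. assert (hm := sf_m _ _ _ _ _ sf s hs).
  destruct (sig_red_sdiffable z (sd_m P s) hm) as [a [b h]].
  assert (T : (fun _ : R => True) (sd_m P s)) by easy.
  assert (X := sdiff_mult (fun _ => True) _ _ _ _ _ _ _ _ T (sdiff_id (fun _ => True) z (sd_m P s)) h).
  eexists. apply (cderiv_ext (fun v => v * sig_red v (sd_m P s))%C).
  - intros v. symmetry. now apply wsigma_eq.
  - exact (cstrict_cderiv _ _ _ (sdiff_cstrict (fun _ => True) _ _ _ _ _ T X)).
Qed.

(** Sigma is real on the real axis, hence so are its derivative and its logarithmic derivative at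
    1/2. Reality later removes the ambiguity of the logarithm of [exp gam]. *)
Lemma gam_real s : J s -> Im (gam beta P s) = 0.
Proof.
  intros hs. assert (hm := sf_m _ _ _ _ _ sf s hs).
  assert (hW : forall y, Im (wsigma 1 (omega2 P s) (RtoC y)) = 0).
  { intros y. unfold omega2. rewrite wsigma_eq by exact hm.
    assert (X := sig_red_real y (sd_m P s)). revert X. generalize (sig_red (RtoC y) (sd_m P s)).
    intros w X. unfold Im in *. simpl. rewrite X. ring. }
  destruct (wsigma_cderiv s (RtoC (/ 2)) hs) as [a ha].
  assert (hra := cderiv_real _ _ _ ha hW).
  unfold gam, weta1, wzeta.
  assert (E2 : (1 / 2)%C = RtoC (/ 2)) by (rewrite RtoC_inv by lra; unfold Cdiv; ring).
  rewrite E2, (is_C_derive_unique _ _ a) by (now apply cderiv_is_derive).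
  specialize (hW (/ 2)). set (w := wsigma 1 (omega2 P s) (RtoC (/ 2))) in *.
  destruct a as [a1 a2], w as [w1 w2]. unfold Im in *. simpl in *. subst a2 w2.
  unfold Rdiv. ring.
Qed.

(** Inherited from the period of [f] by differentiating in [z] and dividing by the nonzero constant
    [c]. *)
Lemma integrand_period s z : J s -> denom P s z <> 0%C -> denom P s (z + 1) <> 0%C ->
  integrand beta P s (z + 1)%C = integrand beta P s z.
Proof.
  intros hs h0 h1.
  assert (X := cderiv_shift _ _ _ _ (f_cderiv s (z + 1)%C hs h1)).
  apply (cderiv_ext _ (fun v => fv v s)) in X.
  2:{ intros v. unfold fv. now rewrite (sf_period1 _ _ _ _ _ sf s v hs). }
  assert (E := cderiv_unique _ _ _ _ X (f_cderiv s z hs h0)).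
  assert (hc := sf_c _ _ _ _ _ sf s hs).
  replace (integrand beta P s (z + 1))
    with (/ sd_c P s * (sd_c P s * integrand beta P s (z + 1)))%C by (field; exact hc).
  rewrite E. field. exact hc.
Qed.

Lemma numer_nonzero s z : J s ->
  (forall k, (1 <= k <= 4)%nat -> ~ in_lattice (sd_m P s) (z - zpt P k s)) -> numer s z <> 0%C.
Proof.
  intros hs h. unfold numer. cbn [map Cprod fold_right].
  repeat apply Cmult_neq_0; try (apply sigma_nonzero; [exact hs | apply h; lia]).
  intros e. apply RtoC_inj in e. lra.
Qed.

Lemma Im_zpt s : Im (zpt P 0 s) = sd_y0 P s /\ Im (zpt P 1 s) = 0 /\ Im (zpt P 2 s) = 0 /\
  Im (zpt P 3 s) = sd_m P s /\ Im (zpt P 4 s) = - sd_m P s.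
Proof. unfold zpt, Im; simpl. repeat split; ring. Qed.

Lemma numer_nonzero_Im s z : J s -> 0 < Im z < sd_m P s -> numer s z <> 0%C.
Proof.
  intros hs hz. destruct (Im_zpt s) as [_ [e1 [e2 [e3 e4]]]].
  apply numer_nonzero; [exact hs |]. intros k hk. apply not_lattice_Im.
  assert (E : Im (z - zpt P k s) = Im z - Im (zpt P k s)) by (unfold Im; simpl; ring).
  rewrite E. destruct k as [| [| [| [| [| k]]]]]; try lia.
  - rewrite e1, Rabs_right; lra.
  - rewrite e2, Rabs_right; lra.
  - rewrite e3, Rabs_left; lra.
  - rewrite e4, Rabs_right; lra.
Qed.

(** For real [g] the modulus of [Cexp (g s)] determines [g s], so continuity of the exponential
    forces continuity of [g]. Once [g s] is close to [g t], [Cexp_log_estimate] transfers the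
    derivative. *)
Lemma pderiv_log (D : R -> Prop) (g : R -> C) t l : D t ->
  (forall s, D s -> Im (g s) = 0) -> pderiv D (fun s => Cexp (g s)) t l ->
  pderiv D g t (l / Cexp (g t)).
Proof.
  intros hD hre h.
  set (E0 := Cexp (g t)). assert (n0 : E0 <> 0%C) by apply Cexp_neq_0.
  assert (p0 : 0 < Cmod E0) by (apply Cmod_gt_0; exact n0).
  assert (hcont : forall e, 0 < e -> exists d, 0 < d /\ forall s, D s -> Rabs (s - t) < d ->
     Cmod (Cexp (g s) - E0) < e).
  { intros e he. destruct (sdiff_cont _ _ _ _ _ _ (sdiff_of_pderiv D _ 0 _ _ h) e he) as [d [hd h']].
    exists d. split; [exact hd |]. intros s hs hst.
    apply (h' 0%C s); try assumption. rewrite Cmod_self. exact hd. }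
  assert (gcont : forall e, 0 < e -> exists d, 0 < d /\ forall s, D s -> Rabs (s - t) < d ->
     Cmod (g s - g t) < e).
  { intros e he. set (x0 := Re (g t)).
    set (eta := Rmin (exp (x0 + e) - exp x0) (exp x0 - exp (x0 - e))).
    assert (heta : 0 < eta).
    { apply Rmin_glb_lt.
      - assert (exp x0 < exp (x0 + e)) by (apply exp_increasing; lra). lra.
      - assert (exp (x0 - e) < exp x0) by (apply exp_increasing; lra). lra. }
    destruct (hcont eta heta) as [d [hd h']]. exists d. split; [exact hd |].
    intros s hs hst. specialize (h' s hs hst).
    assert (A : Rabs (exp (Re (g s)) - exp x0) < eta).
    { unfold x0. rewrite <- !Cmod_Cexp. fold E0.
      assert (T1 := Cmod_triangle_sub (Cexp (g s)) E0).
      assert (T2 := Cmod_triangle_sub E0 (Cexp (g s))). rewrite Cmod_sym in T2.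
      apply Rabs_def1; lra. }
    eapply Rle_lt_trans; [apply Cmod_le_Re_Im |].
    replace (Im (g s - g t)) with (Im (g s) - Im (g t)) by (unfold Im; simpl; ring).
    rewrite !hre, Rminus_eq_0, Rabs_R0, Rplus_0_r by assumption.
    replace (Re (g s - g t)) with (Re (g s) - x0) by (unfold x0, Re; simpl; ring).
    assert (m1 := Rmin_l (exp (x0 + e) - exp x0) (exp x0 - exp (x0 - e))).
    assert (m2 := Rmin_r (exp (x0 + e) - exp x0) (exp x0 - exp (x0 - e))).
    fold eta in m1, m2. apply Rabs_lt_between in A.
    apply Rabs_def1.
    - assert (Re (g s) < x0 + e) by (apply exp_lt_inv; lra). lra.
    - assert (x0 - e < Re (g s)) by (apply exp_lt_inv; lra). lra. }
  intros e he.
  set (L := Cmod (l / E0)). assert (hL : 0 <= L) by apply Cmod_ge_0.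
  set (q := Rmin 1 (e / (3 + L))).
  assert (hq : 0 < q) by (apply Rmin_glb_lt; [lra | apply Rdiv_lt_0_compat; lra]).
  assert (q1 : q <= 1) by apply Rmin_l.
  assert (qL : q * (3 + L) <= e).
  { apply Rle_trans with (e / (3 + L) * (3 + L)); [| apply Req_le; field; lra].
    apply Rmult_le_compat_r; [lra | apply Rmin_r]. }
  destruct (Cexp_log_estimate q hq) as [d1 [hd1 h1]].
  destruct (gcont d1 hd1) as [d2 [hd2 h2]].
  destruct (h (q * Cmod E0)) as [d3 [hd3 h3]]; [nra |].
  exists (Rmin d2 d3). split; [now apply Rmin_glb_lt |].
  pose_rmin.
  intros s hs hst. specialize (h2 s hs ltac:(lra)). specialize (h3 s hs ltac:(lra)).
  specialize (h1 (g t) (g s) h2). fold E0 in h1, h3.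
  set (q0 := ((Cexp (g s) - E0) / E0)%C) in *.
  assert (Y : Cmod (q0 - l / E0 * RtoC (s - t)) <= q * Rabs (s - t)).
  { replace (q0 - l / E0 * RtoC (s - t))%C with ((Cexp (g s) - E0 - l * RtoC (s - t)) / E0)%C
      by (unfold q0; field; exact n0).
    rewrite Cmod_div by exact n0. apply Rle_div_l; [lra |].
    eapply Rle_trans; [apply h3 | apply Req_le; ring]. }
  assert (Z : Cmod q0 <= (L + 1) * Rabs (s - t)).
  { assert (T := Cmod_triangle_sub q0 (l / E0 * RtoC (s - t))).
    rewrite Cmod_mult, Cmod_R in T. fold L in T.
    generalize (Rabs_pos (s - t)). nra. }
  replace (g s - g t - l / E0 * RtoC (s - t))%C
    with ((g s - g t - q0) + (q0 - l / E0 * RtoC (s - t)))%C by ring.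
  eapply Rle_trans; [apply Cmod_triangle |].
  generalize (Rabs_pos (s - t)). intros p.
  assert (q * Cmod q0 <= q * ((L + 1) * Rabs (s - t))) by (apply Rmult_le_compat_l; lra).
  assert (q * (3 + L) * Rabs (s - t) <= e * Rabs (s - t)) by (apply Rmult_le_compat_r; lra).
  nra.
Qed.

(* [f' (z + 1) = f' z] determines [exp gam] as a quotient of values of [sigma];
   this yields the differentiability of [gam] without that of the zeta function. *)
Lemma gam_pderiv t : J t -> exists gp, pderiv J (gam beta P) t gp.
Proof.
  intros ht.
  assert (hy := sf_y0 _ _ _ _ _ sf t ht).
  (* The real part 1/2 keeps [z] and [z + 1] off the poles, whose real parts are integers; the
     height [y0], between 0 and [m], keeps them off the zeros of the numerator. *)
  set (z := (RtoC (/ 2) + Ci * RtoC (sd_y0 P t))%C).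
  assert (rz : Re z = / 2) by (unfold z, Re; simpl; ring).
  assert (iz : Im z = sd_y0 P t) by (unfold z, Im; simpl; ring).
  assert (rz1 : Re (z + 1) = / 2 + 1) by (unfold z, Re; simpl; ring).
  assert (iz1 : Im (z + 1) = sd_y0 P t) by (unfold z, Im; simpl; ring).
  assert (noint : forall i : Z, / 2 <> IZR i).
  { intros i hi. assert (h1 : IZR 0 < IZR i) by lra. assert (h2 : IZR i < IZR 1) by lra.
    apply lt_IZR in h1. apply lt_IZR in h2. lia. }
  assert (d0 : denom P t z <> 0%C).
  { apply denom_nonzero_Re; [exact ht |]. intros i. rewrite rz. apply noint. }
  assert (d1 : denom P t (z + 1) <> 0%C).
  { apply denom_nonzero_Re; [exact ht |]. intros i. rewrite rz1. intros hi.
    apply (noint (i - 1)%Z). rewrite minus_IZR. lra. }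
  assert (n1 : numer t (z + 1) <> 0%C).
  { apply numer_nonzero_Im; [exact ht | rewrite iz1; lra]. }
  assert (JJ : forall s, J s -> J s) by auto.
  destruct (denom_sdiffable J t ht JJ z) as [a1 [b1 h1]].
  destruct (denom_sdiffable J t ht JJ (z + 1)%C) as [a2 [b2 h2]].
  destruct (numer_sdiffable J t ht JJ z) as [a3 [b3 h3]].
  destruct (numer_sdiffable J t ht JJ (z + 1)%C) as [a4 [b4 h4]].
  destruct (sdiff_nonzero _ _ _ _ _ _ h1 d0) as [r1 [hr1 u1]].
  destruct (sdiff_nonzero _ _ _ _ _ _ h2 d1) as [r2 [hr2 u2]].
  destruct (sdiff_nonzero _ _ _ _ _ _ h4 n1) as [r4 [hr4 u4]].
  assert (Q : exists E', pderiv J (fun s => (numer s z * denom P s (z + 1))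
                 * (/ denom P s z * / numer s (z + 1)))%C t E').
  { assert (X : sdiffable J (fun (_ : C) s => (numer s z * denom P s (z + 1))
                 * (/ denom P s z * / numer s (z + 1)))%C 0 t).
    { apply sdiffable_mult; [exact ht | |]; apply sdiffable_mult; try exact ht.
      - apply (sdiffable_par J t (fun s => numer s z) b3). exact (sdiff_pderiv _ _ _ _ _ _ h3).
      - apply (sdiffable_par J t (fun s => denom P s (z + 1)) b2). exact (sdiff_pderiv _ _ _ _ _ _ h2).
      - apply (sdiffable_inv J t ht (fun _ s => denom P s z)); [exact d0 |].
        apply (sdiffable_par J t (fun s => denom P s z) b1). exact (sdiff_pderiv _ _ _ _ _ _ h1).
      - apply (sdiffable_inv J t ht (fun _ s => numer s (z + 1))); [exact n1 |].
        apply (sdiffable_par J t (fun s => numer s (z + 1)) b4). exact (sdiff_pderiv _ _ _ _ _ _ h4). }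
    destruct X as [a [b hX]]. exists b. exact (sdiff_pderiv _ _ _ _ _ _ hX). }
  destruct Q as [E' hE].
  exists (E' / Cexp (gam beta P t))%C.
  apply pderiv_log; [exact ht | exact gam_real |].
  set (r := Rmin r1 (Rmin r2 r4)).
  assert (hr : 0 < r) by (unfold r; repeat apply Rmin_glb_lt; assumption).
  apply (pderiv_ext_loc J _ _ t E' r hr ht) with (2 := hE).
  intros s hs hst.
  assert (b1' : r <= r1) by apply Rmin_l.
  assert (b2' : r <= r2) by (eapply Rle_trans; [apply Rmin_r | apply Rmin_l]).
  assert (b4' : r <= r4) by (eapply Rle_trans; [apply Rmin_r | apply Rmin_r]).
  assert (m1 : denom P s z <> 0%C).
  { apply Cmod_gt_0. apply Cmod_gt_0 in d0. specialize (u1 z s).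
    rewrite Cmod_self in u1. specialize (u1 hr1 hs ltac:(lra)). lra. }
  assert (m2 : denom P s (z + 1) <> 0%C).
  { apply Cmod_gt_0. apply Cmod_gt_0 in d1. specialize (u2 (z + 1)%C s).
    rewrite Cmod_self in u2. specialize (u2 hr2 hs ltac:(lra)). lra. }
  assert (m4 : numer s (z + 1) <> 0%C).
  { apply Cmod_gt_0. apply Cmod_gt_0 in n1. specialize (u4 (z + 1)%C s).
    rewrite Cmod_self in u4. specialize (u4 hr4 hs ltac:(lra)). lra. }
  assert (E := integrand_period s z hs m1 m2).
  unfold integrand in E. fold (numer s z) in E. fold (numer s (z + 1)) in E.
  replace (gam beta P s * (z + 1))%C with (gam beta P s * z + gam beta P s)%C in E by ring.
  rewrite Cexp_plus in E.
  assert (ne := Cexp_neq_0 (gam beta P s * z)).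
  set (e1 := Cexp (gam beta P s * z)) in *. set (eg := Cexp (gam beta P s)) in *.
  symmetry.
  replace eg with (e1 * eg * numer s (z + 1) / denom P s (z + 1)
     * (denom P s (z + 1) / (e1 * numer s (z + 1))))%C by (field; auto).
  rewrite E. field. auto.
Qed.

Lemma ndiff_path (D : R -> Prop) F mu u t A B mu' : mu t = u ->
  pderiv D mu t mu' -> ndiff D F u t A B ->
  pderiv D (fun s => F (mu s) s) t (A * mu' + B).
Proof.
  intros hu hm hF e he.
  set (K := 1 + Cmod mu' + 1 + Cmod A).
  assert (a1 := Cmod_ge_0 mu'). assert (a2 := Cmod_ge_0 A).
  assert (hK : 0 < K) by (unfold K; lra).
  set (q := Rmin 1 (e / (2 * K))).
  assert (hq : 0 < q) by (apply Rmin_glb_lt; [lra | apply Rdiv_lt_0_compat; lra]).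
  assert (q1 : q <= 1) by apply Rmin_l.
  assert (qK : q * K <= e / 2).
  { apply Rle_trans with (e / (2 * K) * K); [| apply Req_le; field; lra].
    apply Rmult_le_compat_r; [lra | apply Rmin_r]. }
  destruct (hF q hq) as [d1 [hd1 F1]]. destruct (hm q hq) as [d2 [hd2 M2]].
  assert (hdK : 0 < d1 / K) by (apply Rdiv_lt_0_compat; lra).
  exists (Rmin (Rmin d1 d2) (d1 / K)). split; [repeat apply Rmin_glb_lt; assumption |].
  intros s hs hst.
  assert (b1 : Rabs (s - t) < d1) by rmin.
  assert (b2 : Rabs (s - t) < d2) by rmin.
  assert (b3 : Rabs (s - t) < d1 / K) by rmin.
  specialize (M2 s hs b2). assert (p := Rabs_pos (s - t)).
  rewrite hu in *.
  assert (L : Cmod (mu s - u) <= (1 + Cmod mu') * Rabs (s - t)).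
  { replace (mu s - u)%C with ((mu s - u - mu' * RtoC (s - t)) + mu' * RtoC (s - t))%C by ring.
    eapply Rle_trans; [apply Cmod_triangle |]. rewrite Cmod_mult, Cmod_R. nra. }
  assert (L2 : Cmod (mu s - u) < d1).
  { apply Rle_lt_trans with (K * Rabs (s - t)).
    - eapply Rle_trans; [exact L |]. apply Rmult_le_compat_r; unfold K; lra.
    - apply Rlt_le_trans with (K * (d1 / K)); [apply Rmult_lt_compat_l; lra | apply Req_le; field; lra]. }
  specialize (F1 (mu s) s L2 hs b1).
  replace (F (mu s) s - F u t - (A * mu' + B) * RtoC (s - t))%C
    with ((F (mu s) s - F u t - A * (mu s - u) - B * RtoC (s - t))
          + A * (mu s - u - mu' * RtoC (s - t)))%C by ring.
  eapply Rle_trans; [apply Cmod_triangle |]. rewrite Cmod_mult.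
  assert (q * (Cmod (mu s - u) + Rabs (s - t)) <= q * ((1 + Cmod mu' + 1) * Rabs (s - t)))
    by (apply Rmult_le_compat_l; lra).
  assert (Cmod A * Cmod (mu s - u - mu' * RtoC (s - t)) <= Cmod A * (q * Rabs (s - t)))
    by (apply Rmult_le_compat_l; lra).
  assert (q * K * Rabs (s - t) <= e / 2 * Rabs (s - t)) by (apply Rmult_le_compat_r; lra).
  unfold K in *. nra.
Qed.

Lemma ndiff_pderiv (D : R -> Prop) F u t A B : ndiff D F u t A B -> pderiv D (F u) t B.
Proof.
  intros h e he. destruct (h e he) as [d [hd h']]. exists d. split; [exact hd |].
  intros s hs hst. specialize (h' u s). rewrite Cmod_self in h'. specialize (h' hd hs hst).
  replace (F u s - F u t - B * RtoC (s - t))%C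
    with (F u s - F u t - A * (u - u) - B * RtoC (s - t))%C by ring.
  lra.
Qed.

(** * Time derivatives of [f] and of [f' = gfun] *)

Definition gfun (z : C) (s : R) : C := (sd_c P s * integrand beta P s z)%C.

Lemma gfun_sdiffable t xi : J t -> denom P t xi <> 0%C -> sdiffable J gfun xi t.
Proof.
  intros ht h.
  destruct (smooth_on_pderiv J (sd_c P) t ht (sf_smooth_c _ _ _ _ _ sf)) as [c' hc].
  destruct (gam_pderiv t ht) as [gp hg].
  apply sdiffable_mult; [exact ht | now apply (sdiffable_par J t (sd_c P) c') |].
  exact (integrand_sdiffable J t ht (fun s hs => hs) gp hg xi h).
Qed.

Lemma time_derivatives t : J t -> exists ga gb ft : C -> C,
  (forall xi, denom P t xi <> 0%C -> sdiff J gfun xi t (ga xi) (gb xi)) /\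
  (forall xi, denom P t xi <> 0%C -> ndiff J fv xi t (gfun xi t) (ft xi)).
Proof.
  intros ht.
  assert (hac := interval_accum J t (sf_interval _ _ _ _ _ sf) ht).
  destruct (gam_pderiv t ht) as [gp hg].
  set (G := fun z s => integrand beta P s z).
  assert (ch : forall F, (forall xi, denom P t xi <> 0%C -> sdiffable J F xi t) ->
     exists a b : C -> C, forall xi, denom P t xi <> 0%C -> sdiff J F xi t (a xi) (b xi)).
  { intros F hF.
    set (ab := fun xi => epsilon (inhabits (RtoC 0, RtoC 0))
                           (fun ab => sdiff J F xi t (fst ab) (snd ab))).
    exists (fun xi => fst (ab xi)), (fun xi => snd (ab xi)). intros xi h.
    apply (epsilon_spec (inhabits (RtoC 0, RtoC 0)) (fun ab => sdiff J F xi t (fst ab) (snd ab))).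
    destruct (hF xi h) as [a [b hab]]. now exists (a, b). }
  destruct (ch gfun (fun xi h => gfun_sdiffable t xi ht h)) as [ga [gb hgab]].
  destruct (ch G (fun xi h => integrand_sdiffable J t ht (fun s hs => hs) gp hg xi h)) as [ia [ib hi]].
  (* Continuity of the time derivative comes with strictness: the expansion at [xi] also holds with
     both points equal to a nearby [v], and is compared there with the definition of [ib v]. *)
  assert (cib : forall xi, denom P t xi <> 0%C -> ccont ib xi).
  { intros xi h e he. destruct (hi xi h (e / 2)) as [d [hd S]]; [lra |].
    destruct (denom_open J t xi ht (fun s hs => hs) h) as [r [hr O]].
    exists (Rmin d r). split; [now apply Rmin_glb_lt |].
    pose_rmin.
    intros v hv.
    assert (hv0 : denom P t v <> 0%C).
    { apply O; [lra | exact ht |]. now rewrite Rminus_eq_0, Rabs_R0. }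
    destruct (sdiff_pderiv _ _ _ _ _ _ (hi v hv0) (e / 2)) as [d' [hd' S']]; [lra |].
    destruct (hac (Rmin d d')) as [s [hs [hne hst]]]; [now apply Rmin_glb_lt |].
    pose_rmin.
    specialize (S v v s ltac:(lra) ltac:(lra) hs ltac:(lra)). rewrite Cmod_self in S.
    specialize (S' s hs ltac:(lra)).
    assert (hp : 0 < Rabs (s - t)) by (apply Rabs_pos_lt; lra).
    apply Rmult_le_reg_r with (Rabs (s - t)); [exact hp |].
    replace (Cmod (ib v - ib xi) * Rabs (s - t)) with (Cmod ((ib v - ib xi) * RtoC (s - t)))
      by (rewrite Cmod_mult, Cmod_R; ring).
    replace ((ib v - ib xi) * RtoC (s - t))%C
      with ((G v s - G v t - ia xi * (v - v) - ib xi * RtoC (s - t))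
            - (G v s - G v t - ib v * RtoC (s - t)))%C by ring.
    eapply Rle_trans; [apply Cmod_minus_le | lra]. }
  set (ft := fun xi => epsilon (inhabits (RtoC 0)) (fun B => ndiff J fv xi t (gfun xi t) B)).
  exists ga, gb, ft. split; [exact hgab |].
  intros xi h. apply (epsilon_spec (inhabits (RtoC 0)) (fun B => ndiff J fv xi t (gfun xi t) B)).
  exact (f_ndiff J t ia ib xi ht (fun s hs => hs) hi cib h).
Qed.

Section FixedTime.

Variable t : R.
Hypothesis ht : J t.
Variables ga gb ft : C -> C.
Hypothesis hgab : forall xi, denom P t xi <> 0%C -> sdiff J gfun xi t (ga xi) (gb xi).
Hypothesis hft : forall xi, denom P t xi <> 0%C -> ndiff J fv xi t (gfun xi t) (ft xi).
Variable mp : R.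
Hypothesis hmp : pderiv J (fun s => RtoC (sd_m P s)) t (RtoC mp).

Local Notation m := (sd_m P t).
Local Notation y0 := (sd_y0 P t).

Lemma accum_J : accum J t.
Proof. exact (interval_accum J t (sf_interval _ _ _ _ _ sf) ht). Qed.

Lemma gfun_cstrict z : denom P t z <> 0%C -> cstrict (fun v => gfun v t) z (ga z).
Proof. intros h. exact (sdiff_cstrict J gfun z t _ _ ht (hgab z h)). Qed.

Lemma denom_open_t z : denom P t z <> 0%C ->
  exists r, 0 < r /\ forall v, Cmod (v - z) < r -> denom P t v <> 0%C.
Proof.
  intros h. destruct (denom_open J t z ht (fun s hs => hs) h) as [r [hr O]].
  exists r. split; [exact hr |]. intros v hv. apply O; [exact hv | exact ht |].
  now rewrite Rminus_eq_0, Rabs_R0.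
Qed.

(* Differentiating [f' = g] in time, by the mean value inequality applied to
   [f (., s) - f (., t) - (s - t) g_t(u) z]. *)
Lemma ft_cstrict u : denom P t u <> 0%C -> cstrict ft u (gb u).
Proof.
  intros hu e he.
  destruct (hgab u hu (e / 2)) as [d [hd S]]; [lra |].
  destruct (denom_open J t u ht (fun s hs => hs) hu) as [r [hr O]].
  exists (Rmin d r). split; [now apply Rmin_glb_lt |].
  pose_rmin.
  assert (hpos : 0 < Rmin d r) by now apply Rmin_glb_lt.
  intros z1 z2 h1 h2.
  assert (t0 : Rabs (t - t) < r) by now rewrite Rminus_eq_0, Rabs_R0.
  assert (n1 := O z1 t ltac:(lra) ht t0). assert (n2 := O z2 t ltac:(lra) ht t0).
  apply le_epsilon. intros e2 he2.
  destruct (ndiff_pderiv _ _ _ _ _ _ (hft z1 n1) (e2 / 2)) as [d1 [hd1 S1]]; [lra |].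
  destruct (ndiff_pderiv _ _ _ _ _ _ (hft z2 n2) (e2 / 2)) as [d2 [hd2 S2]]; [lra |].
  destruct (accum_J (Rmin (Rmin d r) (Rmin d1 d2))) as [s [hs [hne hst]]].
  { repeat apply Rmin_glb_lt; assumption. }
  assert (b0 : Rabs (s - t) < Rmin d r) by rmin.
  assert (b1 : Rabs (s - t) < d1) by rmin.
  assert (b2 : Rabs (s - t) < d2) by rmin.
  specialize (S1 s hs b1). specialize (S2 s hs b2).
  assert (hp : 0 < Rabs (s - t)) by (apply Rabs_pos_lt; lra).
  set (k := (RtoC (s - t) * gb u)%C).
  set (Ds := fun z => (fv z s - fv z t - k * z)%C).
  assert (MV : Cmod (Ds z2 - Ds z1) <= 2 * (e / 2 * Rabs (s - t)) * Cmod (z2 - z1)).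
  { apply (cmean Ds (fun z => (gfun z s - gfun z t - k)%C)).
    - intros x hx. assert (hb := segpt_ball z1 z2 u (Rmin d r) x hx h1 h2).
      apply cderiv_sub_linear. apply cderiv_minus.
      + apply f_cderiv; [exact hs | apply O; [lra | exact hs | lra]].
      + apply f_cderiv; [exact ht | apply O; [lra | exact ht | exact t0]].
    - intros x hx. assert (hb := segpt_ball z1 z2 u (Rmin d r) x hx h1 h2).
      set (z := segpt z1 z2 x) in *.
      specialize (S z z s ltac:(lra) ltac:(lra) hs ltac:(lra)). rewrite Cmod_self in S.
      unfold k. replace (gfun z s - gfun z t - RtoC (s - t) * gb u)%C
        with (gfun z s - gfun z t - ga u * (z - z) - gb u * RtoC (s - t))%C by ring.
      lra. }
  apply Rmult_le_reg_r with (Rabs (s - t)); [exact hp |].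
  replace (Cmod (ft z2 - ft z1 - gb u * (z2 - z1)) * Rabs (s - t))
    with (Cmod ((ft z2 - ft z1 - gb u * (z2 - z1)) * RtoC (s - t)))
    by (rewrite Cmod_mult, Cmod_R; ring).
  replace ((ft z2 - ft z1 - gb u * (z2 - z1)) * RtoC (s - t))%C
    with ((Ds z2 - Ds z1) + ((fv z1 s - fv z1 t - ft z1 * RtoC (s - t))
           - (fv z2 s - fv z2 t - ft z2 * RtoC (s - t))))%C by (unfold Ds, k; ring).
  eapply Rle_trans; [apply Cmod_triangle |].
  assert (T := Cmod_minus_le (fv z1 s - fv z1 t - ft z1 * RtoC (s - t))
     (fv z2 s - fv z2 t - ft z2 * RtoC (s - t))). lra.
Qed.

(** * The quotient [hfun], its period and its quasi-period *)

Definition hfun (z : C) : C := (ft z / gfun z t)%C.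

Lemma gfun_nonzero z : denom P t z <> 0%C -> numer t z <> 0%C -> gfun z t <> 0%C.
Proof.
  intros hd hn. unfold gfun, integrand, Cdiv. fold (numer t z).
  apply Cmult_neq_0; [now apply sf |]. apply Cmult_neq_0.
  - apply Cmult_neq_0; [apply Cexp_neq_0 | exact hn].
  - intros h. assert (E : (denom P t z * / denom P t z)%C = 1%C) by now field.
    rewrite h in E. replace (denom P t z * 0)%C with (RtoC 0) in E by ring.
    apply RtoC_inj in E. lra.
Qed.

Definition regular (z : C) : Prop := denom P t z <> 0%C /\ numer t z <> 0%C.

Lemma hfun_cstrict z : regular z -> exists a, cstrict hfun z a.
Proof.
  intros [h1 h2]. eapply cstrict_div.
  - now apply ft_cstrict.
  - now apply gfun_cstrict.
  - now apply gfun_nonzero.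
Qed.

Lemma ft_period z : denom P t z <> 0%C -> denom P t (z + 1) <> 0%C -> ft (z + 1)%C = ft z.
Proof.
  intros h0 h1. apply (pderiv_unique J (fv z) t); [apply accum_J | |].
  - apply (pderiv_ext J (fv (z + 1)%C)); [exact ht | |].
    + intros s hs. unfold fv. now rewrite (sf_period1 _ _ _ _ _ sf s z hs).
    + exact (ndiff_pderiv _ _ _ _ _ _ (hft _ h1)).
  - exact (ndiff_pderiv _ _ _ _ _ _ (hft _ h0)).
Qed.

Lemma hfun_period z : denom P t z <> 0%C -> denom P t (z + 1) <> 0%C -> hfun (z + 1)%C = hfun z.
Proof.
  intros h0 h1. unfold hfun, gfun. rewrite ft_period, integrand_period; auto.
Qed.

Lemma fv_period2 s z : J s -> fv (z + omega2 P s)%C s = (polar 1 (2 * beta) * fv z s)%C.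
Proof.
  intros hs. unfold fv. rewrite (sf_period2 _ _ _ _ _ sf s z hs).
  destruct (f z s); simpl; [reflexivity | ring].
Qed.

(* Differentiate [f (z + omega2 t, t) = exp (2 i beta) f (z, t)] in [z] and in [t]. *)
Lemma hfun_quasi_period z : denom P t z <> 0%C -> denom P t (z + omega2 P t) <> 0%C ->
  numer t z <> 0%C -> hfun (z + omega2 P t)%C = (hfun z - 2 * RtoC mp * Ci)%C.
Proof.
  intros h0 h1 hn. set (e := polar 1 (2 * beta)).
  assert (he : e <> 0%C).
  { apply Cmod_gt_0. unfold e. rewrite Cmod_polar, Rabs_R1. lra. }
  assert (Eg : gfun (z + omega2 P t)%C t = (e * gfun z t)%C).
  { assert (X := cderiv_shift _ _ _ _ (f_cderiv t (z + omega2 P t)%C ht h1)).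
    apply (cderiv_ext _ (fun v => (e * fv v t)%C)) in X.
    2:{ intros v. now apply fv_period2. }
    apply (cderiv_unique _ _ _ _ X).
    intros e0 he0. destruct (f_cderiv t z ht h0 e0 he0) as [d [hd h']].
    exists d. split; [exact hd |]. intros v hv. specialize (h' v hv).
    replace (e * fv v t - e * fv z t - e * gfun z t * (v - z))%C
      with (e * (fv v t - fv z t - gfun z t * (v - z)))%C by ring.
    rewrite Cmod_mult. unfold e. rewrite Cmod_polar, Rabs_R1, Rmult_1_l. exact h'. }
  (* The time derivative is taken along the moving point [z + omega2 P s], whose velocity is
     [2 i m']; the multiplier [e] does not depend on time. *)
  assert (Ef : (gfun (z + omega2 P t) t * (2 * RtoC mp * Ci) + ft (z + omega2 P t))%C = (e * ft z)%C).
  { apply (pderiv_unique J (fun s => e * fv z s)%C t); [apply accum_J | |].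
    - apply (pderiv_ext J (fun s => fv (z + omega2 P s)%C s)); [exact ht | |].
      + intros s hs. now apply fv_period2.
      + apply (ndiff_path J fv (fun s => z + omega2 P s)%C (z + omega2 P t)%C); auto.
        assert (X := pderiv_scal J (2 * Ci)%C _ _ _ ht hmp).
        intros e0 he0. destruct (X e0 he0) as [d [hd h']]. exists d. split; [exact hd |].
        intros s hs hst. specialize (h' s hs hst). unfold omega2.
        replace (z + 2 * sd_m P s * Ci - (z + 2 * sd_m P t * Ci) - 2 * mp * Ci * RtoC (s - t))%C
          with (2 * Ci * sd_m P s - 2 * Ci * sd_m P t - 2 * Ci * mp * RtoC (s - t))%C by ring.
        exact h'.
    - apply pderiv_scal; [exact ht | exact (ndiff_pderiv _ _ _ _ _ _ (hft _ h0))]. }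
  unfold hfun.
  replace (ft (z + omega2 P t)) with (e * ft z - e * gfun z t * (2 * RtoC mp * Ci))%C
    by (rewrite <- Eg, <- Ef; ring).
  rewrite Eg. field. split; [exact (gfun_nonzero z h0 hn) | exact he].
Qed.

(** * Criteria for regular points at the fixed time *)

Lemma not_lattice_strip n w : IZR n * (2 * m) < Im w < IZR (n + 1) * (2 * m) -> ~ in_lattice m w.
Proof.
  intros h hl. assert (hm := sf_m _ _ _ _ _ sf t ht).
  apply in_lattice_Im in hl. destruct hl as [j hj]. rewrite hj in h.
  assert (h1 : IZR n < IZR j) by nra. assert (h2 : IZR j < IZR (n + 1)) by nra.
  apply lt_IZR in h1. apply lt_IZR in h2. lia.
Qed.

Lemma not_lattice_column n w : IZR n < Re w < IZR (n + 1) -> ~ in_lattice m w.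
Proof.
  intros h hl. apply in_lattice_Re in hl. destruct hl as [j hj]. rewrite hj in h.
  destruct h as [h1 h2]. apply lt_IZR in h1. apply lt_IZR in h2. lia.
Qed.

Lemma Im_sub z w : Im (z - w) = Im z - Im w.
Proof. unfold Im; simpl; ring. Qed.

Lemma Re_sub z w : Re (z - w) = Re z - Re w.
Proof. unfold Re; simpl; ring. Qed.

Lemma Re_zpt : Re (zpt P 0 t) = 0 /\ Re (zpt P 1 t) = sd_x P 1 t /\ Re (zpt P 2 t) = sd_x P 2 t /\
  Re (zpt P 3 t) = sd_x P 3 t /\ Re (zpt P 4 t) = sd_x P 4 t.
Proof. unfold zpt, Re; simpl. repeat split; ring. Qed.

Lemma regular_intro z :
  (forall k, (k <= 4)%nat -> ~ in_lattice m (z - zpt P k t)) ->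
  ~ in_lattice m (z + zpt P 0 t) -> regular z.
Proof.
  intros h h'. split.
  - apply denom_nonzero; [exact ht | apply h; lia | exact h'].
  - apply numer_nonzero; [exact ht |]. intros k hk. apply h. lia.
Qed.

Lemma zpt_denom k : (1 <= k <= 4)%nat -> denom P t (zpt P k t) <> 0%C.
Proof.
  intros hk. assert (hy := sf_y0 _ _ _ _ _ sf t ht).
  destruct (Im_zpt t) as [e0 [e1 [e2 [e3 e4]]]].
  destruct (Im_shift_z0 t (zpt P k t)) as [f1 f2].
  destruct k as [| [| [| [| [| k]]]]]; try lia.
  - rewrite e1 in *. apply denom_nonzero_real; [exact ht | exact e1].
  - rewrite e2 in *. apply denom_nonzero_real; [exact ht | exact e2].
  - rewrite e3 in *. apply denom_nonzero; [exact ht | |].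
    + apply (not_lattice_strip 0). rewrite f1. simpl. lra.
    + apply (not_lattice_strip 0). rewrite f2. simpl. lra.
  - rewrite e4 in *. apply denom_nonzero; [exact ht | |].
    + apply (not_lattice_strip (-1)). rewrite f1. simpl. lra.
    + apply (not_lattice_strip (-1)). rewrite f2. simpl. lra.
Qed.

(** * Local behaviour of [hfun] at the zeros and poles of [f'] *)

Definition others (k : nat) : list nat :=
  match k with
  | 1 => [2; 3; 4] | 2 => [1; 3; 4] | 3 => [1; 2; 4] | _ => [1; 2; 3]
  end%nat.

(* [gfun] with the zero at [zpt k] divided out. *)
Definition cofactor (k : nat) (z : C) (s : R) : C :=
  (sd_c P s * (Cexp (gam beta P s * z)
    * (sig_red (z - zpt P k s) (sd_m P s) * Cprod (map (fun j => sigma P s (z - zpt P j s)) (others k)))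
    * / denom P s z))%C.

Lemma gfun_cofactor k z s : (1 <= k <= 4)%nat -> J s ->
  gfun z s = ((z - zpt P k s) * cofactor k z s)%C.
Proof.
  intros hk hs. unfold gfun, integrand, cofactor, Cdiv.
  destruct k as [| [| [| [| [| k]]]]]; try lia; cbn [others map Cprod fold_right].
  - rewrite (sigma_eq s (z - zpt P 1 s)) by exact hs. ring.
  - rewrite (sigma_eq s (z - zpt P 2 s)) by exact hs. ring.
  - rewrite (sigma_eq s (z - zpt P 3 s)) by exact hs. ring.
  - rewrite (sigma_eq s (z - zpt P 4 s)) by exact hs. ring.
Qed.

Lemma cofactor_cstrict k z : (1 <= k <= 4)%nat -> denom P t z <> 0%C ->
  exists a, cstrict (fun v => cofactor k v t) z a.
Proof.
  intros hk h.
  assert (JJ : forall s, J s -> J s) by auto.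
  destruct (smooth_on_pderiv J (sd_c P) t ht (sf_smooth_c _ _ _ _ _ sf)) as [c' hc].
  destruct (gam_pderiv t ht) as [gp hg].
  destruct (zpt_pderiv t k ht ltac:(lia)) as [zd hz].
  assert (X : sdiffable J (cofactor k) z t).
  { unfold cofactor. apply sdiffable_mult; [exact ht | now apply (sdiffable_par J t (sd_c P) c') |].
    apply sdiffable_mult; [exact ht | |].
    - apply sdiffable_mult; [exact ht | exact (exp_sdiffable J t ht gp hg z) |].
      apply sdiffable_mult; [exact ht | exact (sig_red_comp J t ht JJ _ zd z hz) |].
      assert (A : forall l, (forall j, In j l -> (j <= 4)%nat) ->
        sdiffable J (fun z s => Cprod (map (fun j => sigma P s (z - zpt P j s)) l)) z t).
      { induction l as [| j l IH]; intros hl.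
        - exists 0%C, 0%C. exact (sdiff_const J 1%C z t).
        - cbn [map Cprod fold_right]. apply sdiffable_mult; [exact ht | |].
          + apply sigma_zpt; auto. apply hl. now left.
          + apply IH. intros i hi. apply hl. now right. }
      apply A. intros j hj. destruct k as [| [| [| [| k]]]]; simpl in hj; lia.
    - apply (sdiffable_inv J t ht (fun z s => denom P s z)); [exact h | now apply denom_sdiffable]. }
  destruct X as [a [b hX]]. exists a. exact (sdiff_cstrict J _ _ _ _ _ ht hX).
Qed.

(** Near [z_k] the first derivative is [(z - z_k)] times the cofactor; differentiating once more at
    [z_k] leaves the cofactor. *)
Lemma slit_D_eq k : (1 <= k <= 4)%nat -> slit_D P f k t = cofactor k (zpt P k t) t.
Proof.
  intros hk. assert (hd := zpt_denom k hk).
  destruct (denom_open_t _ hd) as [r [hr O]].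
  unfold slit_D. apply is_C_derive_unique, cderiv_is_derive.
  apply (cderiv_ext_loc (fun v => gfun v t) _ _ _ r hr).
  { intros v hv. symmetry. apply is_C_derive_unique, cderiv_is_derive.
    apply f_cderiv; [exact ht | now apply O]. }
  destruct (cofactor_cstrict k _ hk hd) as [a ha].
  assert (T : (fun _ : R => True) 0) by easy.
  assert (X := sdiff_mult (fun _ => True) _ _ _ _ _ _ _ _ T
    (sdiff_minus (fun _ => True) _ _ _ 0 _ _ _ _ T (sdiff_id _ (zpt P k t) 0)
       (sdiff_const _ (zpt P k t) (zpt P k t) 0))
    (sdiff_of_cstrict (fun _ => True) _ _ 0 _ ha)).
  cbv beta in X. apply (sdiff_cstrict (fun _ => True) _ _ _ _ _ T) in X. apply cstrict_cderiv in X.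
  apply (cderiv_ext (fun v => (v - zpt P k t) * cofactor k v t)%C).
  { intros v. symmetry. now apply gfun_cofactor. }
  replace (cofactor k (zpt P k t) t) with
    ((1 - 0) * cofactor k (zpt P k t) t + (zpt P k t - zpt P k t) * a)%C by ring.
  exact X.
Qed.

(** In the chain rule along [z_k (s)] the term with the velocity of [z_k] drops out because [f']
    vanishes at [z_k]. *)
Lemma slit_A_pderiv k : (1 <= k <= 4)%nat -> pderiv J (slit_A P f k) t (ft (zpt P k t)).
Proof.
  intros hk. destruct (zpt_pderiv t k ht ltac:(lia)) as [zd hz].
  apply (pderiv_eq J _ t (gfun (zpt P k t) t * zd + ft (zpt P k t))%C).
  - exact (ndiff_path J fv (zpt P k) _ t _ _ zd eq_refl hz (hft _ (zpt_denom k hk))).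
  - rewrite (gfun_cofactor k) by auto. ring.
Qed.

(** By [slit_A_pderiv] the numerator is the derivative of [A_k], so this is [gamma_k]. *)
Definition res (k : nat) : C := (ft (zpt P k t) / slit_D P f k t)%C.

Lemma zero_residue k : (1 <= k <= 4)%nat -> exists B r, 0 <= B /\ 0 < r /\
  forall z, z <> zpt P k t -> Cmod (z - zpt P k t) < r ->
    Cmod (hfun z - res k / (z - zpt P k t)) <= B.
Proof.
  intros hk. assert (hd := zpt_denom k hk).
  destruct (cofactor_cstrict k _ hk hd) as [a ha].
  assert (h0 := sf_f2 _ _ _ _ _ sf t k ht hk). fold (slit_D P f k t) in h0.
  unfold res. rewrite slit_D_eq in * by exact hk.
  apply (simple_zero_bound ft (fun z => gfun z t) (fun z => cofactor k z t) (zpt P k t) _ a 1 Rlt_0_1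
     (ft_cstrict _ hd) ha h0).
  intros z _. now apply gfun_cofactor.
Qed.

(** The time derivative of [f'] has at most a triple pole at the moving pole [Z]; integrating in
    [z], that of [f] grows at most to order two, and the quotient by [f'] stays bounded. The roles
    of [Z] and [Z'] are symmetric, so both [z_0] and its conjugate are covered. *)
Lemma pole_bound (Z Z' : R -> C) zd zd' : pderiv J Z t zd -> pderiv J Z' t zd' ->
  (forall s z, J s -> denom P s z
     = (sigma P s (z - Z s) * sigma P s (z - Z s) * (sigma P s (z - Z' s) * sigma P s (z - Z' s)))%C) ->
  ~ in_lattice m (Z t - Z' t) -> numer t (Z t) <> 0%C ->
  exists B r, 0 <= B /\ 0 < r /\ forall z, 0 < Cmod (z - Z t) < r -> Cmod (hfun z) <= B.
Proof.
  intros hZ hZ' hden hlat hnum. set (p := Z t) in *.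
  assert (JJ : forall s, J s -> J s) by auto.
  assert (hm := sf_m _ _ _ _ _ sf t ht).
  destruct (smooth_on_pderiv J (sd_c P) t ht (sf_smooth_c _ _ _ _ _ sf)) as [c' hc].
  destruct (gam_pderiv t ht) as [gp hg].
  set (S1 := fun z s => sig_red (z - Z s) (sd_m P s)).
  set (S2 := fun z s => sigma P s (z - Z' s)).
  set (den := fun z s => (S1 z s * S1 z s * (S2 z s * S2 z s))%C).
  set (N := fun z s => (sd_c P s * (Cexp (gam beta P s * z) * numer s z * / den z s))%C).
  assert (dS1 : forall z, sdiffable J S1 z t) by (intros z; exact (sig_red_comp J t ht JJ Z zd z hZ)).
  assert (dS2 : forall z, sdiffable J S2 z t) by (intros z; exact (sigma_comp J t ht JJ Z' zd' z hZ')).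
  assert (dden : forall z, sdiffable J den z t).
  { intros z. unfold den. repeat (apply sdiffable_mult; [exact ht | |]); auto. }
  assert (n0 : den p t <> 0%C).
  { unfold den, S1, S2. fold p. repeat apply Cmult_neq_0;
      try (apply sig_red_nonzero; [exact hm | left; ring]); now apply sigma_nonzero. }
  destruct (dden p) as [a1 [b1 hd1]].
  destruct (sdiff_nonzero _ _ _ _ _ _ hd1 n0) as [r0 [hr0 D0]].
  assert (den0 : forall z, Cmod (z - p) < r0 -> den z t <> 0%C).
  { intros z hz. apply Cmod_gt_0. specialize (D0 z t hz ht).
    rewrite Rminus_eq_0, Rabs_R0 in D0. specialize (D0 hr0).
    generalize (Cmod_ge_0 (den p t)). lra. }
  assert (dN : forall z, Cmod (z - p) < r0 -> sdiffable J N z t).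
  { intros z hz. unfold N. apply sdiffable_mult; [exact ht | now apply (sdiffable_par J t (sd_c P) c') |].
    apply sdiffable_mult; [exact ht | |].
    - apply sdiffable_mult; [exact ht | exact (exp_sdiffable J t ht gp hg z) | now apply numer_sdiffable].
    - apply sdiffable_inv; auto. }
  assert (hden2 : forall z s, J s -> denom P s z = ((z - Z s) * (z - Z s) * den z s)%C).
  { intros z s hs. rewrite hden by exact hs. unfold den, S1, S2.
    rewrite (sigma_eq s (z - Z s)) by exact hs. ring. }
  assert (hF : forall z s, J s -> z <> Z s -> gfun z s = (N z s * (/ (z - Z s) * / (z - Z s)))%C).
  { intros z s hs hz. unfold gfun, integrand, N, Cdiv. fold (numer s z).
    rewrite hden2 by exact hs.
    assert (n1 : (z - Z s)%C <> 0%C).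
    { intros e. apply hz. replace z with ((z - Z s) + Z s)%C by ring. rewrite e. ring. }
    destruct (Ceq_dec (den z s) 0) as [e | n].
    - rewrite e. replace ((z - Z s) * (z - Z s) * 0)%C with (RtoC 0) by ring.
      replace (/ 0)%C with (RtoC 0); [ring |].
      apply injective_projections; simpl; unfold Rdiv; ring.
    - field. auto. }
  assert (hne : forall z, 0 < Cmod (z - p) -> z <> Z t).
  { intros z hz e. fold p in e. rewrite e, Cmod_self in hz. lra. }
  assert (dz : forall z, 0 < Cmod (z - p) < r0 -> denom P t z <> 0%C).
  { intros z hz. rewrite hden2 by exact ht. fold p.
    assert (n1 : (z - p)%C <> 0%C) by (apply Cmod_gt_0; lra).
    apply Cmult_neq_0; [now apply Cmult_neq_0 | apply den0; lra]. }
  destruct (moving_double_pole J gfun N Z t p zd gb r0 ht accum_J eq_refl hZ hr0 dN hF) as [K [r [hK [hr hb]]]].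
  { intros z hz. exact (sdiff_pderiv _ _ _ _ _ _ (hgab z (dz z hz))). }
  destruct (dN p) as [a2 [b2 hNp]]. { rewrite Cmod_self. exact hr0. }
  destruct (double_pole_bound ft gb (fun z => gfun z t) (fun z => N z t) p r K (proj1 hr) hK)
    as [B [r' [hB [hr' hbd]]]].
  - intros z hz. apply cstrict_cderiv, ft_cstrict, dz. lra.
  - exact hb.
  - exact (cstrict_ccont _ _ _ (sdiff_cstrict J _ _ _ _ _ ht hNp)).
  - unfold N. apply Cmult_neq_0; [now apply sf |]. apply Cmult_neq_0.
    + apply Cmult_neq_0; [apply Cexp_neq_0 | exact hnum].
    + intros e. assert (E : (den p t * / den p t)%C = 1%C) by (field; exact n0).
      rewrite e in E. replace (den p t * 0)%C with (RtoC 0) in E by ring.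
      apply RtoC_inj in E. lra.
  - intros z hz. rewrite (hF z t ht (hne z (proj1 hz))). fold p.
    assert (n1 : (z - p)%C <> 0%C) by (apply Cmod_gt_0; lra).
    simpl. field. exact n1.
  - exists B, r'. auto.
Qed.

Lemma z0_bound : exists B r, 0 <= B /\ 0 < r /\
  forall z, 0 < Cmod (z - zpt P 0 t) < r -> Cmod (hfun z) <= B.
Proof.
  destruct (zpt_pderiv t 0 ht ltac:(lia)) as [zd hz]. destruct (conj_z0_pderiv t ht) as [zd' hz'].
  assert (hy := sf_y0 _ _ _ _ _ sf t ht). destruct (Im_zpt t) as [e0 _].
  apply (pole_bound (zpt P 0) (fun s => Cconj (zpt P 0 s)) zd zd' hz hz').
  - intros s z _. unfold denom. generalize (sigma P s (z - zpt P 0 s)), (sigma P s (z - Cconj (zpt P 0 s))).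
    intros u w. simpl. ring.
  - apply (not_lattice_strip 0). rewrite conj_z0, Im_sub, e0.
    replace (Im (- zpt P 0 t)) with (- sd_y0 P t) by (rewrite <- e0; reflexivity). simpl. lra.
  - apply numer_nonzero_Im; [exact ht | rewrite e0; exact hy].
Qed.

Lemma conj_z0_bound : exists B r, 0 <= B /\ 0 < r /\
  forall z, 0 < Cmod (z - Cconj (zpt P 0 t)) < r -> Cmod (hfun z) <= B.
Proof.
  destruct (zpt_pderiv t 0 ht ltac:(lia)) as [zd hz]. destruct (conj_z0_pderiv t ht) as [zd' hz'].
  assert (hy := sf_y0 _ _ _ _ _ sf t ht). destruct (Im_zpt t) as [e0 [e1 [e2 [e3 e4]]]].
  assert (ec : Im (Cconj (zpt P 0 t)) = - sd_y0 P t) by (rewrite <- e0; reflexivity).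
  apply (pole_bound (fun s => Cconj (zpt P 0 s)) (zpt P 0) zd' zd hz' hz).
  - intros s z _. unfold denom. generalize (sigma P s (z - zpt P 0 s)), (sigma P s (z - Cconj (zpt P 0 s))).
    intros u w. simpl. ring.
  - apply (not_lattice_strip (-1)). rewrite Im_sub, e0, ec. simpl. lra.
  - apply numer_nonzero; [exact ht |]. intros k hk.
    destruct k as [| [| [| [| [| k]]]]]; try lia.
    + apply (not_lattice_strip (-1)). rewrite Im_sub, ec, e1. simpl. lra.
    + apply (not_lattice_strip (-1)). rewrite Im_sub, ec, e2. simpl. lra.
    + apply (not_lattice_strip (-1)). rewrite Im_sub, ec, e3. simpl. lra.
    + apply (not_lattice_strip 0). rewrite Im_sub, ec, e4. simpl. lra.
Qed.

(** * Jumps of the horizontal period across the singular heights *)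

Lemma regular_strips z :
  (forall k, (k <= 4)%nat -> exists n : Z,
     IZR n * (2 * m) < Im z - Im (zpt P k t) < IZR (n + 1) * (2 * m)) ->
  (exists n : Z, IZR n * (2 * m) < Im z + y0 < IZR (n + 1) * (2 * m)) -> regular z.
Proof.
  intros h [n hn]. apply regular_intro.
  - intros k hk. destruct (h k hk) as [n' hn']. apply (not_lattice_strip n'). now rewrite Im_sub.
  - apply (not_lattice_strip n). now rewrite (proj2 (Im_shift_z0 t z)).
Qed.

Ltac lattice_strip :=
  first [ apply (not_lattice_strip 0); rewrite plus_IZR; lra | apply (not_lattice_strip (-1)); rewrite plus_IZR; lra
        | apply (not_lattice_strip 1); rewrite plus_IZR; lra | apply (not_lattice_strip (-2)); rewrite plus_IZR; lra ].

(** Between [- (2 * m - y0)] and [2 * m - y0] the singular heights are [- m], [- y0], [0], [y0] and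
    [m]; in the strips between them every point is regular, whatever its real part. *)
Lemma regular_Im z :
  - (2 * m - y0) < Im z < - m \/ - m < Im z < - y0 \/ - y0 < Im z < 0 \/
  0 < Im z < y0 \/ y0 < Im z < m \/ m < Im z < 2 * m - y0 -> regular z.
Proof.
  intros h. assert (hy := sf_y0 _ _ _ _ _ sf t ht).
  destruct (Im_zpt t) as [e0 [e1 [e2 [e3 e4]]]].
  assert (L : forall x, (- (4 * m) < x < - (2 * m) \/ - (2 * m) < x < 0 \/
      0 < x < 2 * m \/ 2 * m < x < 4 * m) ->
      exists n : Z, IZR n * (2 * m) < x < IZR (n + 1) * (2 * m)).
  { clear. intros x [H | [H | [H | H]]];
      [exists (-2)%Z | exists (-1)%Z | exists 0%Z | exists 1%Z]; rewrite plus_IZR; lra. }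
  apply regular_strips.
  - intros k hk. apply L.
    destruct k as [| [| [| [| [| k]]]]]; try lia;
      [rewrite e0 | rewrite e1 | rewrite e2 | rewrite e3 | rewrite e4];
      clear - h hy; destruct h as [h | [h | [h | [h | [h | h]]]]];
      first [left; lra | right; left; lra | right; right; left; lra | right; right; right; lra].
  - apply L. clear - h hy. destruct h as [h | [h | [h | [h | [h | h]]]]];
      first [left; lra | right; left; lra | right; right; left; lra | right; right; right; lra].
Qed.

Lemma hperiod_strip lo hi : (forall z, lo < Im z < hi -> regular z) ->
  forall w1 w2, lo < Im w1 < hi -> lo < Im w2 < hi -> hperiod hfun w1 = hperiod hfun w2.
Proof.
  intros hreg. apply hperiod_const.
  - intros z hz. apply hfun_cstrict, hreg, hz.
  - intros z hz. apply hfun_period; [now apply hreg |]. apply hreg.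
    replace (Im (z + 1)) with (Im z) by (unfold Im; simpl; ring). exact hz.
Qed.

(** Constancy of the horizontal period in each adjacent strip allows the jump to be read off at any
    two points [wp], [wm] of these strips. *)
Lemma hperiod_jump_at (ys a1 a2 al lo hi : R) (g1 g2 wp wm : C) :
  let p1 := (RtoC a1 + Ci * RtoC ys)%C in
  let p2 := (RtoC a2 + Ci * RtoC ys)%C in
  let bounded_near := fun p => exists B r, 0 <= B /\ 0 < r /\
     forall z, z <> p -> Cmod (z - p) < r -> Im z <> ys ->
       Cmod (hfun z - g1 / (z - p1) - g2 / (z - p2)) <= B in
  lo < ys < hi -> al < a1 < al + 1 -> al < a2 < al + 1 ->
  (forall z, ys < Im z < hi -> regular z) ->
  (forall z, lo < Im z < ys -> regular z) ->
  (forall z, Im z = ys -> al <= Re z <= al + 1 -> Re z <> a1 -> Re z <> a2 -> regular z) ->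
  bounded_near p1 -> bounded_near p2 ->
  ys < Im wp < hi -> lo < Im wm < ys ->
  (hperiod hfun wp - hperiod hfun wm = - (2 * PI * Ci) * (g1 + g2))%C.
Proof.
  intros p1 p2 bn hys ha1 ha2 rp rm r0 [B1 [r1 [hB1 [hr1 b1]]]] [B2 [r2 [hB2 [hr2 b2]]]] hwp hwm.
  set (r := Rmin (Rmin r1 r2) (Rmin (ys - lo) (hi - ys))).
  assert (hr : 0 < r) by (unfold r; repeat apply Rmin_glb_lt; lra).
  assert (q1 : r <= r1) by (unfold r; rmin).
  assert (q2 : r <= r2) by (unfold r; rmin).
  assert (q3 : r <= ys - lo) by (unfold r; rmin).
  assert (q4 : r <= hi - ys) by (unfold r; rmin).
  assert (eqC : forall z a, Re z = a -> Im z = ys -> z = (RtoC a + Ci * RtoC ys)%C).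
  { intros z a h1 h2. apply injective_projections; unfold Re, Im in *; simpl; lra. }
  apply (hperiod_jump hfun al ys a1 a2 r (Rmax B1 B2)).
  - exact hr.
  - eapply Rle_trans; [exact hB1 | apply Rmax_l].
  - exact ha1.
  - exact ha2.
  - intros z hz1 hz2 n1 n2. apply Rabs_lt_between in hz2.
    assert (hreg : regular z).
    { destruct (Rtotal_order (Im z) ys) as [l | [e | g]].
      - apply rm. lra.
      - apply (r0 z e hz1); intros h; [apply n1 | apply n2]; exact (eqC z _ h e).
      - apply rp. lra. }
    destruct (hfun_cstrict z hreg) as [a ha]. exact (cstrict_ccont _ _ _ ha).
  - intros z n1 hz hi'. eapply Rle_trans; [apply b1; [exact n1 | fold p1 in hz; lra | exact hi'] | apply Rmax_l].
  - intros z n1 hz hi'. eapply Rle_trans; [apply b2; [exact n1 | fold p2 in hz; lra | exact hi'] | apply Rmax_r].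
  - intros y hy. apply (hperiod_strip ys hi rp); [| exact hwp].
    replace (Im (RtoC al + Ci * RtoC (ys + y))) with (ys + y) by (unfold Im; simpl; ring). lra.
  - intros y hy. apply (hperiod_strip lo ys rm); [| exact hwm].
    replace (Im (RtoC al + Ci * RtoC (ys - y))) with (ys - y) by (unfold Im; simpl; ring). lra.
Qed.

Lemma Cdiv_0_l z : (0 / z)%C = RtoC 0.
Proof. unfold Cdiv. ring. Qed.

Lemma zpt0_eq : zpt P 0 t = (RtoC 0 + Ci * RtoC y0)%C.
Proof. unfold zpt. ring. Qed.

Lemma conj_zpt0_eq : Cconj (zpt P 0 t) = (RtoC 0 + Ci * RtoC (- y0))%C.
Proof. unfold zpt. apply injective_projections; simpl; ring. Qed.

Lemma Cmod_sub_pos z p : z <> p -> 0 < Cmod (z - p).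
Proof.
  intros h. apply Cmod_gt_0. intros e. apply h.
  replace z with ((z - p) + p)%C by ring. rewrite e. ring.
Qed.

(** [hfun] is bounded at [z_0], so the jump lemma applies with both residues 0, the two poles being
    merged into the single point [i y0]. *)
Lemma no_jump_y0 wp wm : y0 < Im wp < m -> 0 < Im wm < y0 ->
  hperiod hfun wp = hperiod hfun wm.
Proof.
  intros hp hm. assert (hy := sf_y0 _ _ _ _ _ sf t ht).
  assert (Bd : exists B r, 0 <= B /\ 0 < r /\
     forall z, z <> (RtoC 0 + Ci * RtoC y0)%C -> Cmod (z - (RtoC 0 + Ci * RtoC y0)) < r -> Im z <> y0 ->
       Cmod (hfun z - 0 / (z - (RtoC 0 + Ci * RtoC y0)) - 0 / (z - (RtoC 0 + Ci * RtoC y0))) <= B).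
  { destruct z0_bound as [B [r [hB [hr h]]]]. exists B, r. split; [exact hB |]. split; [exact hr |].
    intros z hz hzr _. rewrite !Cdiv_0_l. replace (hfun z - 0 - 0)%C with (hfun z) by ring.
    rewrite zpt0_eq in h. apply h. split; [now apply Cmod_sub_pos | exact hzr]. }
  assert (X := hperiod_jump_at y0 0 0 (- / 2) 0 m 0 0 wp wm ltac:(lra) ltac:(lra) ltac:(lra)
    (fun z hz => regular_Im z ltac:(lra)) (fun z hz => regular_Im z ltac:(lra))).
  replace (hperiod hfun wp) with ((hperiod hfun wp - hperiod hfun wm) + hperiod hfun wm)%C by ring.
  rewrite X; auto; [ring |].
  intros z hz h1 n1 _. destruct (Im_zpt t) as [e0 [e1 [e2 [e3 e4]]]].
  destruct (Re_shift_z0 t z) as [f1 _]. destruct (Im_shift_z0 t z) as [_ f2].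
  apply regular_intro; [| lattice_strip].
  intros k hk. assert (E := Im_sub z (zpt P k t)).
  destruct k as [| [| [| [| [| k]]]]]; try lia;
    [| rewrite e1 in E; lattice_strip | rewrite e2 in E; lattice_strip
     | rewrite e3 in E; lattice_strip | rewrite e4 in E; lattice_strip ].
  destruct (Rlt_dec (Re z) 0).
  - apply (not_lattice_column (-1)). rewrite plus_IZR; lra.
  - apply (not_lattice_column 0). rewrite plus_IZR; lra.
Qed.

Lemma no_jump_minus_y0 wp wm : - y0 < Im wp < 0 -> - m < Im wm < - y0 ->
  hperiod hfun wp = hperiod hfun wm.
Proof.
  intros hp hm. assert (hy := sf_y0 _ _ _ _ _ sf t ht).
  assert (Bd : exists B r, 0 <= B /\ 0 < r /\
     forall z, z <> (RtoC 0 + Ci * RtoC (- y0))%C -> Cmod (z - (RtoC 0 + Ci * RtoC (- y0))) < r -> Im z <> - y0 ->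
       Cmod (hfun z - 0 / (z - (RtoC 0 + Ci * RtoC (- y0))) - 0 / (z - (RtoC 0 + Ci * RtoC (- y0)))) <= B).
  { destruct conj_z0_bound as [B [r [hB [hr h]]]]. exists B, r. split; [exact hB |]. split; [exact hr |].
    intros z hz hzr _. rewrite !Cdiv_0_l. replace (hfun z - 0 - 0)%C with (hfun z) by ring.
    rewrite conj_zpt0_eq in h. apply h. split; [now apply Cmod_sub_pos | exact hzr]. }
  assert (X := hperiod_jump_at (- y0) 0 0 (- / 2) (- m) 0 0 0 wp wm ltac:(lra) ltac:(lra) ltac:(lra)
    (fun z hz => regular_Im z ltac:(lra)) (fun z hz => regular_Im z ltac:(lra))).
  replace (hperiod hfun wp) with ((hperiod hfun wp - hperiod hfun wm) + hperiod hfun wm)%C by ring.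
  rewrite X; auto; [ring |].
  intros z hz h1 n1 _. destruct (Im_zpt t) as [e0 [e1 [e2 [e3 e4]]]].
  destruct (Re_shift_z0 t z) as [_ f2].
  apply regular_intro.
  - intros k hk. assert (E := Im_sub z (zpt P k t)).
    destruct k as [| [| [| [| [| k]]]]]; try lia;
      first [rewrite e0 in E | rewrite e1 in E | rewrite e2 in E | rewrite e3 in E | rewrite e4 in E];
      lattice_strip.
  - destruct (Rlt_dec (Re z) 0).
    + apply (not_lattice_column (-1)). rewrite plus_IZR; lra.
    + apply (not_lattice_column 0). rewrite plus_IZR; lra.
Qed.

(** Within half the distance of the poles, the polar part at [p2] is bounded near [p1], so
    subtracting it preserves the local bound. *)
Lemma bounded_other_pole (h : C -> C) (g1 g2 p1 p2 : C) (B r : R) (Q : C -> Prop) : p1 <> p2 ->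
  0 <= B -> 0 < r ->
  (forall z, z <> p1 -> Cmod (z - p1) < r -> Q z -> Cmod (h z - g1 / (z - p1)) <= B) ->
  exists B' r', 0 <= B' /\ 0 < r' /\ forall z, z <> p1 -> Cmod (z - p1) < r' -> Q z ->
    Cmod (h z - g1 / (z - p1) - g2 / (z - p2)) <= B'.
Proof.
  intros hne hB hr hb. set (d := Cmod (p1 - p2)).
  assert (hd : 0 < d) by now apply Cmod_sub_pos.
  assert (hg := Cmod_ge_0 g2).
  exists (B + Cmod g2 / (d / 2)), (Rmin r (d / 2)). split.
  { assert (0 <= Cmod g2 / (d / 2)) by (apply Rle_div_r; lra). lra. }
  split; [apply Rmin_glb_lt; lra |].
  pose_rmin.
  intros z hz hzr hQ. eapply Rle_trans; [apply Cmod_minus_le |].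
  apply Rplus_le_compat; [apply hb; auto; lra |].
  assert (low : d / 2 <= Cmod (z - p2)).
  { assert (T := Cmod_triangle_sub (p1 - p2) (z - p2)).
    replace (p1 - p2 - (z - p2))%C with (p1 - z)%C in T by ring.
    rewrite (Cmod_sym p1 z) in T. fold d in T. lra. }
  rewrite Cmod_div by (apply Cmod_gt_0; lra).
  apply Rmult_le_compat_l; [exact hg | apply Rinv_le_contravar; lra].
Qed.

Lemma jump_0 wp wm : 0 < Im wp < y0 -> - y0 < Im wm < 0 ->
  (hperiod hfun wp - hperiod hfun wm = - (2 * PI * Ci) * (res 1 + res 2))%C.
Proof.
  intros hp hm. assert (hy := sf_y0 _ _ _ _ _ sf t ht). assert (hx := sf_x12 _ _ _ _ _ sf t ht).
  set (x1 := sd_x P 1 t) in *. set (x2 := sd_x P 2 t) in *.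
  set (p1 := (RtoC x1 + Ci * RtoC 0)%C). set (p2 := (RtoC x2 + Ci * RtoC 0)%C).
  assert (E1 : zpt P 1 t = p1) by (unfold zpt, p1, x1; ring).
  assert (E2 : zpt P 2 t = p2) by (unfold zpt, p2, x2; ring).
  assert (ne : p1 <> p2).
  { intros e. apply (f_equal Re) in e. unfold p1, p2, Re in e; simpl in e. lra. }
  destruct (Im_zpt t) as [e0 [e1 [e2 [e3 e4]]]]. destruct Re_zpt as [_ [r1 [r2 _]]].
  fold x1 in r1. fold x2 in r2.
  (* The unit window is centred at the midpoint of the two poles; since they are less than 1 apart,
     both lie strictly inside it. *)
  apply (hperiod_jump_at 0 x1 x2 ((x1 + x2 - 1) / 2) (- y0) y0); auto; try lra.
  - intros z hz. apply regular_Im. lra.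
  - intros z hz. apply regular_Im. lra.
  - intros z hz hz2 n1 n2. destruct (Im_shift_z0 t z) as [f1 f2].
    apply regular_intro; [| lattice_strip].
    intros k hk. assert (E := Im_sub z (zpt P k t)). assert (E' := Re_sub z (zpt P k t)).
    destruct k as [| [| [| [| [| k]]]]]; try lia.
    + lattice_strip.
    + rewrite r1 in E'. destruct (Rlt_dec (Re z) x1).
      * apply (not_lattice_column (-1)). rewrite plus_IZR; lra.
      * apply (not_lattice_column 0). rewrite plus_IZR; lra.
    + rewrite r2 in E'. destruct (Rlt_dec (Re z) x2).
      * apply (not_lattice_column (-1)). rewrite plus_IZR; lra.
      * apply (not_lattice_column 0). rewrite plus_IZR; lra.
    + rewrite e3 in E. lattice_strip.
    + rewrite e4 in E. lattice_strip.
  - fold p1 p2. destruct (zero_residue 1 ltac:(lia)) as [B [r [hB [hr h]]]]. rewrite E1 in h.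
    apply (bounded_other_pole hfun _ _ p1 p2 B r (fun z => Im z <> 0)); auto.
  - fold p1 p2. destruct (zero_residue 2 ltac:(lia)) as [B [r [hB [hr h]]]]. rewrite E2 in h.
    destruct (bounded_other_pole hfun (res 2) (res 1) p2 p1 B r (fun z => Im z <> 0))
      as [B' [r' [hB' [hr' h']]]]; auto.
    exists B', r'. split; [exact hB' |]. split; [exact hr' |]. intros z z1 z2 z3.
    replace (hfun z - res 1 / (z - p1) - res 2 / (z - p2))%C
      with (hfun z - res 2 / (z - p2) - res 1 / (z - p1))%C by ring. now apply h'.
Qed.

(** [z_4] has height [- m], and the pole met at height [m] is [z_4 + omega2]. The quasi-period
    changes [hfun] by a constant only, so the residue is carried over unchanged. *)
Lemma jump_m wp wm : m < Im wp < 2 * m - y0 -> y0 < Im wm < m ->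
  (hperiod hfun wp - hperiod hfun wm = - (2 * PI * Ci) * (res 3 + res 4))%C.
Proof.
  intros hp hm. assert (hy := sf_y0 _ _ _ _ _ sf t ht). assert (hx := sf_x34 _ _ _ _ _ sf t ht).
  set (x3 := sd_x P 3 t) in *. set (x4 := sd_x P 4 t) in *.
  set (p3 := (RtoC x3 + Ci * RtoC m)%C). set (p4 := (RtoC x4 + Ci * RtoC m)%C).
  assert (E3 : zpt P 3 t = p3) by (unfold zpt, p3, x3; ring).
  assert (E4 : zpt P 4 t = (p4 - omega2 P t)%C) by (unfold zpt, p4, x4, omega2; ring).
  assert (ne : p3 <> p4).
  { intros e. apply (f_equal Re) in e. unfold p3, p4, Re in e; simpl in e. lra. }
  destruct (Im_zpt t) as [e0 [e1 [e2 [e3 e4]]]]. destruct Re_zpt as [_ [_ [_ [r3 r4]]]].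
  fold x3 in r3. fold x4 in r4.
  assert (Iw : forall z, Im (z - omega2 P t) = Im z - 2 * m)
    by (intros z; unfold omega2, Im; simpl; ring).
  apply (hperiod_jump_at m x3 x4 ((x3 + x4 - 1) / 2) y0 (2 * m - y0)); auto; try lra.
  - intros z hz. apply regular_Im. lra.
  - intros z hz. apply regular_Im. lra.
  - intros z hz hz2 n1 n2. destruct (Im_shift_z0 t z) as [f1 f2].
    apply regular_intro; [| lattice_strip].
    intros k hk. assert (E := Im_sub z (zpt P k t)). assert (E' := Re_sub z (zpt P k t)).
    destruct k as [| [| [| [| [| k]]]]]; try lia.
    + lattice_strip.
    + rewrite e1 in E. lattice_strip.
    + rewrite e2 in E. lattice_strip.
    + rewrite r3 in E'. destruct (Rlt_dec (Re z) x3).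
      * apply (not_lattice_column (-1)). rewrite plus_IZR; lra.
      * apply (not_lattice_column 0). rewrite plus_IZR; lra.
    + rewrite r4 in E'. destruct (Rlt_dec (Re z) x4).
      * apply (not_lattice_column (-1)). rewrite plus_IZR; lra.
      * apply (not_lattice_column 0). rewrite plus_IZR; lra.
  - fold p3 p4. destruct (zero_residue 3 ltac:(lia)) as [B [r [hB [hr h]]]]. rewrite E3 in h.
    apply (bounded_other_pole hfun _ _ p3 p4 B r (fun z => Im z <> m)); auto.
  - fold p3 p4. destruct (zero_residue 4 ltac:(lia)) as [B [r [hB [hr h]]]]. rewrite E4 in h.
    set (c := (2 * RtoC mp * Ci)%C).
    (* Within this radius and off the line of height [m], both [z] and [z - omega2] lie in regular
       strips, where the quasi-period relation applies. *)
    set (r' := Rmin r (m - y0)).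
    assert (hr' : 0 < r') by (apply Rmin_glb_lt; lra).
    assert (q1 : r' <= r) by apply Rmin_l. assert (q2 : r' <= m - y0) by apply Rmin_r.
    assert (hc := Cmod_ge_0 c).
    destruct (bounded_other_pole hfun (res 4) (res 3) p4 p3 (B + Cmod c) r' (fun z => Im z <> m))
      as [B2 [r2 [hB2 [hr2 h2]]]]; auto; try lra.
    + intros z hz hzr hzi.
      assert (I4 : Im p4 = m) by (unfold p4, Im; simpl; ring).
      assert (hIm : Rabs (Im z - m) < m - y0).
      { rewrite <- I4, <- Im_sub. eapply Rle_lt_trans; [apply im_le_Cmod | lra]. }
      apply Rabs_lt_between in hIm.
      assert (g1 : regular z).
      { apply regular_Im. destruct (Rlt_dec (Im z) m); lra. }
      assert (g2 : regular (z - omega2 P t)).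
      { apply regular_Im. rewrite Iw. destruct (Rlt_dec (Im z) m); lra. }
      assert (Q := hfun_quasi_period (z - omega2 P t) (proj1 g2)).
      replace (z - omega2 P t + omega2 P t)%C with z in Q by ring.
      rewrite (Q (proj1 g1) (proj2 g2)). fold c.
      specialize (h (z - omega2 P t)%C).
      replace (z - omega2 P t - (p4 - omega2 P t))%C with (z - p4)%C in h by ring.
      replace (hfun (z - omega2 P t) - c - res 4 / (z - p4))%C
        with ((hfun (z - omega2 P t) - res 4 / (z - p4)) - c)%C by ring.
      eapply Rle_trans; [apply Cmod_minus_le |]. apply Rplus_le_compat_r, h; [| lra].
      intros e. apply hz. replace z with ((z - omega2 P t) + omega2 P t)%C by ring.
      rewrite e. ring.
    + exists B2, r2. split; [exact hB2 |]. split; [exact hr2 |]. intros z z1 z2 z3.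
      replace (hfun z - res 3 / (z - p3) - res 4 / (z - p4))%C
        with (hfun z - res 4 / (z - p4) - res 3 / (z - p3))%C by ring. now apply h2.
Qed.

Lemma hperiod_quasi w : - m < Im w < - y0 ->
  hperiod hfun (w + omega2 P t)%C = (hperiod hfun w - 2 * RtoC mp * Ci)%C.
Proof.
  intros hw. assert (hy := sf_y0 _ _ _ _ _ sf t ht).
  assert (Ir : forall x, Im (w + RtoC x) = Im w) by (intros; apply im_add_real).
  assert (Iw : forall z, Im (z + omega2 P t) = Im z + 2 * m)
    by (intros z; unfold omega2, Im; simpl; ring).
  assert (Reg : forall x, regular (w + RtoC x)%C) by (intros x; apply regular_Im; rewrite Ir; lra).
  assert (I1 : is_RInt (V := C_R_NormedModule) (fun x => hfun (w + RtoC x)%C) 0 1 (hperiod hfun w)).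
  { apply is_RInt_CRInt; [lra |]. intros x _.
    apply (rcont_comp hfun (fun x => (w + RtoC x)%C)).
    - destruct (hfun_cstrict _ (Reg x)) as [a ha]. exact (cstrict_ccont _ _ _ ha).
    - apply (rderiv_rcont _ _ 1), rderiv_affine. }
  assert (I2 := is_RInt_const (V := C_R_NormedModule) 0 1 (2 * RtoC mp * Ci)%C).
  rewrite scal_C_R in I2. replace (RtoC (1 - 0) * (2 * RtoC mp * Ci))%C with (2 * RtoC mp * Ci)%C in I2
    by (rewrite Rminus_0_r; ring).
  assert (I3 := is_RInt_Cminus _ _ _ _ _ _ I1 I2).
  apply (is_RInt_unique (V := C_R_CompleteNormedModule) (fun x => hfun (w + omega2 P t + RtoC x)%C)).
  refine (is_RInt_ext (V := C_R_NormedModule) _ _ _ _ _ _ I3).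
  intros x _. symmetry.
  replace (w + omega2 P t + RtoC x)%C with (w + RtoC x + omega2 P t)%C by ring.
  assert (Reg2 : regular (w + RtoC x + omega2 P t)%C) by (apply regular_Im; rewrite Iw, Ir; lra).
  exact (hfun_quasi_period _ (proj1 (Reg x)) (proj1 Reg2) (proj2 (Reg x))).
Qed.

Theorem module_derivative : RtoC mp = (RtoC PI * (res 1 + res 2 + (res 3 + res 4)))%C.
Proof.
  assert (hy := sf_y0 _ _ _ _ _ sf t ht).
  assert (Ii : forall y, Im (Ci * RtoC y) = y) by (intros; unfold Im; simpl; ring).
  (* Midpoints of four successive regular strips; [w1 + omega2] is the midpoint of the fifth. Going
     from [w1] to it crosses the heights [- y0], [0], [y0] and [m], once each. *)
  set (w1 := (Ci * RtoC (- (m + y0) / 2))%C). set (w2 := (Ci * RtoC (- y0 / 2))%C).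
  set (w3 := (Ci * RtoC (y0 / 2))%C). set (w4 := (Ci * RtoC ((m + y0) / 2))%C).
  assert (I1 : Im w1 = - (m + y0) / 2) by apply Ii. assert (I2 : Im w2 = - y0 / 2) by apply Ii.
  assert (I3 : Im w3 = y0 / 2) by apply Ii. assert (I4 : Im w4 = (m + y0) / 2) by apply Ii.
  assert (I5 : Im (w1 + omega2 P t) = (3 * m - y0) / 2).
  { replace (Im (w1 + omega2 P t)) with (Im w1 + 2 * m) by (unfold omega2, Im; simpl; ring).
    rewrite I1. field. }
  assert (J1 := no_jump_minus_y0 w2 w1 ltac:(lra) ltac:(lra)).
  assert (J2 := jump_0 w3 w2 ltac:(lra) ltac:(lra)).
  assert (J3 := no_jump_y0 w4 w3 ltac:(lra) ltac:(lra)).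
  assert (J4 := jump_m (w1 + omega2 P t) w4 ltac:(lra) ltac:(lra)).
  rewrite hperiod_quasi in J4 by lra. rewrite J3 in J4. rewrite J1 in J2.
  assert (S : (- (2 * RtoC mp * Ci) = - (2 * PI * Ci) * (res 1 + res 2 + (res 3 + res 4)))%C).
  { replace (- (2 * PI * Ci) * (res 1 + res 2 + (res 3 + res 4)))%C
      with (- (2 * PI * Ci) * (res 1 + res 2) + - (2 * PI * Ci) * (res 3 + res 4))%C by ring.
    rewrite <- J2, <- J4. ring. }
  assert (n : Ci <> 0%C).
  { intros e. apply (f_equal Im) in e. unfold Im in e; simpl in e. lra. }
  replace (RtoC mp) with (- (- (2 * RtoC mp * Ci)) / (2 * Ci))%C by (field; exact n).
  rewrite S. field. exact n.
Qed.

End FixedTime.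

End Family.

(** * The conformal module *)

(** The neighbourhoods of the uniform structure are squares and those of [Cmod] are discs, which
    accounts for the factor [sqrt 2]. *)
Lemma locally_Cmod (z : C) (Q : C -> Prop) :
  locally (T := C_UniformSpace) z Q <->
  exists d, 0 < d /\ forall y, Cmod (y - z) < d -> Q y.
Proof.
  split.
  - intros [[d hd] h]. exists d. split; [exact hd |]. intros y hy. apply h.
    now apply C_NormedModule_mixin_compat1.
  - intros [d [hd h]].
    exists (mkposreal (d / sqrt 2) (Rdiv_lt_0_compat _ _ hd Rlt_sqrt2_0)).
    intros y hy. apply h. apply C_NormedModule_mixin_compat2 in hy. simpl in hy.
    replace (sqrt 2 * (d / sqrt 2)) with d in hy
      by (field; apply Rgt_not_eq, Rlt_sqrt2_0).
    exact hy.
Qed.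

Lemma cderiv_comp F G w a b : cderiv F (G w) a -> cderiv G w b ->
  cderiv (fun v => F (G v)) w (a * b).
Proof.
  intros hF hG e he.
  assert (pa := Cmod_ge_0 a). assert (pb := Cmod_ge_0 b).
  set (K := 1 + Cmod a + Cmod b). assert (hK : 1 <= K) by (unfold K; lra).
  set (q := Rmin 1 (e / (2 * K))).
  assert (hq : 0 < q) by (apply Rmin_glb_lt; [lra | apply Rdiv_lt_0_compat; lra]).
  assert (q1 : q <= 1) by apply Rmin_l.
  assert (qK : q * K <= e / 2).
  { apply Rle_trans with (e / (2 * K) * K); [| apply Req_le; field; lra].
    apply Rmult_le_compat_r; [lra | apply Rmin_r]. }
  destruct (hF q hq) as [d [hd h]]. destruct (hG q hq) as [d' [hd' h']].
  assert (hdK : 0 < d / K) by (apply Rdiv_lt_0_compat; lra).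
  exists (Rmin d' (d / K)). split; [now apply Rmin_glb_lt |].
  pose_rmin.
  intros v hv. specialize (h' v ltac:(lra)).
  assert (p := Cmod_ge_0 (v - w)).
  assert (L : Cmod (G v - G w) <= K * Cmod (v - w)).
  { replace (G v - G w)%C with ((G v - G w - b * (v - w)) + b * (v - w))%C by ring.
    eapply Rle_trans; [apply Cmod_triangle |]. rewrite Cmod_mult. unfold K. nra. }
  assert (L2 : Cmod (G v - G w) < d).
  { eapply Rle_lt_trans; [exact L |].
    apply Rlt_le_trans with (K * (d / K)); [apply Rmult_lt_compat_l; lra | apply Req_le; field; lra]. }
  specialize (h (G v) L2).
  replace (F (G v) - F (G w) - a * b * (v - w))%C
    with ((F (G v) - F (G w) - a * (G v - G w)) + a * (G v - G w - b * (v - w)))%C by ring.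
  eapply Rle_trans; [apply Cmod_triangle |]. rewrite Cmod_mult.
  assert (q * Cmod (G v - G w) <= q * (K * Cmod (v - w))) by (apply Rmult_le_compat_l; lra).
  assert (Cmod a * Cmod (G v - G w - b * (v - w)) <= Cmod a * (q * Cmod (v - w)))
    by (apply Rmult_le_compat_l; lra).
  assert (q * K * Cmod (v - w) <= e / 2 * Cmod (v - w)) by (apply Rmult_le_compat_r; lra).
  assert (Cmod a * q <= K * q) by (apply Rmult_le_compat_r; unfold K; lra).
  nra.
Qed.

(** * Logarithms and the covering of an annulus by a strip *)

Definition clog (w : C) : C := (ln (Cmod w), atan (Im w / Re w)).

Lemma Cexp_clog w : 0 < Re w -> Cexp (clog w) = w.
Proof.
  intros h. destruct w as [x y]. unfold clog, Cexp, Re, Im in *. cbn [fst snd] in *.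
  assert (hp : 0 < x ^ 2 + y ^ 2) by (apply Rplus_lt_le_0_compat; [now apply pow_lt | apply pow2_ge_0]).
  assert (hs : 0 < sqrt (x ^ 2 + y ^ 2)) by now apply sqrt_lt_R0.
  assert (hm : Cmod (x, y) = sqrt (x ^ 2 + y ^ 2)) by reflexivity.
  rewrite exp_ln by (rewrite hm; exact hs). rewrite cos_atan, sin_atan, hm.
  replace (1 + Rsqr (y / x)) with ((x ^ 2 + y ^ 2) / x ^ 2) by (unfold Rsqr; field; lra).
  rewrite sqrt_div_alt by now apply pow_lt.
  rewrite sqrt_pow2 by lra. f_equal; field; lra.
Qed.

Lemma clog_1 : clog 1 = 0%C.
Proof.
  unfold clog. rewrite Cmod_1, ln_1. unfold Re, Im; simpl.
  replace (0 / 1) with 0 by field. now rewrite atan_0.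
Qed.

Lemma Rabs_atan_le x : Rabs (atan x) <= Rabs x.
Proof.
  assert (A : forall y, 0 <= y -> Rabs (atan y) <= y).
  { intros y hy. rewrite Rabs_right; [now apply atan_le_id |].
    rewrite <- atan_0. destruct hy as [h | <-]; [left; now apply atan_increasing | lra]. }
  destruct (Rle_dec 0 x) as [h | h].
  - rewrite (Rabs_right x) by lra. now apply A.
  - rewrite <- Rabs_Ropp, <- atan_opp, (Rabs_left x) by lra. apply A. lra.
Qed.

(** Of the constant 4, one half bounds the logarithm of the modulus and the other half the
    argument. *)
Lemma clog_lip : exists d, 0 < d <= / 2 /\ forall w, Cmod (w - 1) < d -> Cmod (clog w) <= 4 * Cmod (w - 1).
Proof.
  assert (D : is_derive ln 1 1) by (auto_derive; [lra | field]).
  destruct (proj1 (is_derive_eps _ _ _) D 1 Rlt_0_1) as [d [hd h]].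
  exists (Rmin d (/ 2)). split. { split; [apply Rmin_glb_lt; lra | apply Rmin_r]. }
  pose_rmin.
  intros w hw.
  eapply Rle_trans; [apply Cmod_le_Re_Im |].
  change (Re (clog w)) with (ln (Cmod w)). change (Im (clog w)) with (atan (Im w / Re w)).
  assert (T1 := Cmod_triangle_sub w 1). assert (T2 := Cmod_triangle_sub 1 w).
  rewrite (Cmod_sym 1 w) in T2. rewrite Cmod_1 in *.
  assert (A : Rabs (Cmod w - 1) <= Cmod (w - 1)) by (apply Rabs_le; lra).
  specialize (h (Cmod w) ltac:(lra)). rewrite ln_1 in h.
  assert (B : Rabs (ln (Cmod w)) <= 2 * Cmod (w - 1)).
  { replace (ln (Cmod w)) with ((ln (Cmod w) - 0 - 1 * (Cmod w - 1)) + (Cmod w - 1)) by ring.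
    eapply Rle_trans; [apply Rabs_triang | lra]. }
  assert (hre := re_le_Cmod (w - 1)). assert (him := im_le_Cmod (w - 1)).
  replace (Re (w - 1)) with (Re w - 1) in hre by (unfold Re; simpl; ring).
  replace (Im (w - 1)) with (Im w) in him by (unfold Im; simpl; ring).
  assert (hx : / 2 <= Re w) by (apply Rabs_le_between in hre; lra).
  assert (E : Rabs (atan (Im w / Re w)) <= 2 * Cmod (w - 1)).
  { eapply Rle_trans; [apply Rabs_atan_le |].
    unfold Rdiv. rewrite Rabs_mult, (Rabs_right (/ Re w))
      by (apply Rle_ge, Rlt_le, Rinv_0_lt_compat; lra).
    assert (/ Re w <= 2) by (rewrite <- (Rinv_inv 2); apply Rinv_le_contravar; lra).
    assert (0 < / Re w) by (apply Rinv_0_lt_compat; lra).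
    generalize (Rabs_pos (Im w)). nra. }
  lra.
Qed.

Lemma Re_pos_near_1 w : Cmod (w - 1) < / 2 -> 0 < Re w.
Proof.
  intros h. assert (hre := re_le_Cmod (w - 1)).
  replace (Re (w - 1)) with (Re w - 1) in hre by (unfold Re; simpl; ring).
  apply Rabs_le_between in hre. lra.
Qed.

(** [Cexp_log_estimate] applies once [clog w] is known to be small, which is what [clog_lip]
    provides. *)
Lemma clog_cderiv_1 : cderiv clog 1 1.
Proof.
  intros e he. destruct clog_lip as [d [hd L]].
  destruct (Cexp_log_estimate e he) as [d' [hd' h]].
  exists (Rmin d (d' / 4)). split; [apply Rmin_glb_lt; lra |].
  pose_rmin.
  intros w hw. specialize (L w ltac:(lra)). specialize (h 0%C (clog w)).
  replace (clog w - 0)%C with (clog w) in h by ring.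
  rewrite Cexp_clog, Cexp_0 in h by (apply Re_pos_near_1; lra).
  specialize (h ltac:(lra)).
  replace ((w - 1) / 1)%C with (w - 1)%C in h by field.
  rewrite clog_1. replace (clog w - 0 - 1 * (w - 1))%C with (clog w - (w - 1))%C by ring. exact h.
Qed.

Definition tpi : C := (2 * RtoC PI * Ci)%C.

Lemma tpi_neq_0 : tpi <> 0%C.
Proof.
  intros e. apply (f_equal Im) in e. unfold tpi, Im in e; simpl in e.
  generalize PI_RGT_0. lra.
Qed.

(** The covering [z -> exp (2 pi i z)] of the punctured plane, whose deck transformations are the
    integral translations [Zshift]. *)
Definition cexp1 (z : C) : C := Cexp (tpi * z).

Lemma cexp1_plus z w : cexp1 (z + w) = (cexp1 z * cexp1 w)%C.
Proof. unfold cexp1. rewrite <- Cexp_plus. f_equal. ring. Qed.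

Lemma Cmod_cexp1 z : Cmod (cexp1 z) = exp (- (2 * PI * Im z)).
Proof.
  unfold cexp1. rewrite Cmod_Cexp. f_equal. unfold tpi, Re, Im; simpl. ring.
Qed.

Lemma cexp1_Z (n : Z) : cexp1 (RtoC (IZR n)) = 1%C.
Proof.
  unfold cexp1. replace (tpi * RtoC (IZR n))%C with (Ci * RtoC (2 * (IZR n * PI)))%C
    by (unfold tpi; rewrite !RtoC_mult; ring).
  assert (hs : sin (IZR n * PI) = 0) by (apply sin_eq_0_1; now exists n).
  unfold Cexp, Re, Im; simpl.
  replace (0 * (2 * (IZR n * PI)) - 1 * 0) with 0 by ring.
  replace (0 * 0 + 1 * (2 * (IZR n * PI))) with (2 * (IZR n * PI)) by ring.
  rewrite exp_0, cos_2a_sin, sin_2a, hs. apply injective_projections; simpl; ring.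
Qed.

Lemma cexp1_eq_1 z : cexp1 z = 1%C -> exists n : Z, z = RtoC (IZR n).
Proof.
  intros h. assert (hpi := PI_RGT_0).
  assert (hm : Im z = 0).
  { assert (X := Cmod_cexp1 z). rewrite h, Cmod_1, <- exp_0 in X. apply exp_inv in X. nra. }
  assert (hc : cos (2 * (PI * Re z)) = 1).
  { assert (X := f_equal Re h). unfold cexp1, Cexp in X. unfold Re at 1 in X. cbn [fst] in X.
    replace (Re (tpi * z)) with 0 in X by (unfold tpi, Re, Im in *; simpl; rewrite hm; ring).
    replace (Im (tpi * z)) with (2 * (PI * Re z)) in X by (unfold tpi, Re, Im in *; simpl; ring).
    rewrite exp_0 in X. unfold Re in X at 2; simpl in X. lra. }
  rewrite cos_2a_sin in hc.
  assert (hs : sin (PI * Re z) = 0) by nra.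
  apply sin_eq_0_0 in hs. destruct hs as [n hn]. exists n.
  apply injective_projections; [| exact hm].
  change (fst z) with (Re z). simpl. nra.
Qed.

Lemma cexp1_surj (zt : C) : zt <> 0%C -> exists z, cexp1 z = zt.
Proof.
  intros h. destruct (Cexp_surj zt h) as [w hw]. exists (w / tpi)%C.
  unfold cexp1. rewrite <- hw. f_equal. field. apply tpi_neq_0.
Qed.

Lemma cexp1_inj z z' : cexp1 z = cexp1 z' -> Zshift z z'.
Proof.
  intros h.
  assert (n0 : cexp1 z <> 0%C) by apply Cexp_neq_0.
  assert (X : cexp1 (z' - z) = 1%C).
  { assert (Y := cexp1_plus (z' - z) z). replace (z' - z + z)%C with z' in Y by ring.
    rewrite <- h in Y.
    replace (cexp1 (z' - z)) with (cexp1 (z' - z) * cexp1 z / cexp1 z)%C by (field; exact n0).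
    rewrite <- Y. field. exact n0. }
  destruct (cexp1_eq_1 _ X) as [n hn]. exists n. rewrite <- hn. ring.
Qed.

(** An arbitrary preimage, with no continuity. This is harmless, as only 1-periodic functions are
    composed with it. *)
Definition clog1 (zt : C) : C := epsilon (inhabits (RtoC 0)) (fun z => cexp1 z = zt).

Lemma cexp1_clog1 (zt : C) : zt <> 0%C -> cexp1 (clog1 zt) = zt.
Proof. intros h. apply (epsilon_spec (inhabits (RtoC 0)) (fun z => cexp1 z = zt)), cexp1_surj, h. Qed.

Definition periodic1 (Phi : C -> Chat) : Prop := forall z z', Zshift z z' -> Phi z = Phi z'.

(** The local inverse of [cexp1] near [zt0] that takes the value [z0] there. *)
Definition branch (zt0 z0 zt : C) : C := (z0 + clog (zt / zt0) / tpi)%C.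

Lemma cexp1_branch (zt0 z0 zt : C) : zt0 <> 0%C -> cexp1 z0 = zt0 -> 0 < Re (zt / zt0) ->
  cexp1 (branch zt0 z0 zt) = zt.
Proof.
  intros h0 h hr. unfold branch. rewrite cexp1_plus, h. unfold cexp1.
  replace (tpi * (clog (zt / zt0) / tpi))%C with (clog (zt / zt0)) by (field; apply tpi_neq_0).
  rewrite Cexp_clog by exact hr. field. exact h0.
Qed.

Lemma branch_cderiv (zt0 z0 : C) : zt0 <> 0%C -> exists a, cderiv (branch zt0 z0) zt0 a.
Proof.
  intros h0. assert (T : (fun _ : R => True) 0) by easy.
  exists (/ tpi * (1 * / zt0))%C.
  assert (X : cderiv (fun v => clog (v / zt0)) zt0 (1 * / zt0)).
  { apply (cderiv_comp clog (fun v => v / zt0)%C).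
    - replace (zt0 / zt0)%C with (RtoC 1) by (field; exact h0). apply clog_cderiv_1.
    - intros e he. exists 1. split; [lra |]. intros v _.
      replace (v / zt0 - zt0 / zt0 - / zt0 * (v - zt0))%C with (RtoC 0) by (field; exact h0).
      rewrite Cmod_0. generalize (Cmod_ge_0 (v - zt0)). nra. }
  assert (Y := cderiv_comp (fun w => z0 + / tpi * w)%C (fun v => clog (v / zt0)) zt0 (/ tpi) (1 * / zt0)).
  apply (cderiv_ext _ (branch zt0 z0)) in Y; [exact Y | | | exact X].
  - intros v. unfold branch, Cdiv. ring.
  - intros e he. exists 1. split; [lra |]. intros v _.
    replace (z0 + / tpi * v - (z0 + / tpi * clog (zt0 / zt0)) - / tpi * (v - clog (zt0 / zt0)))%C
      with (RtoC 0) by ring.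
    rewrite Cmod_0. generalize (Cmod_ge_0 (v - clog (zt0 / zt0))). nra.
Qed.

Lemma ratio_near_1 (zt0 zt : C) : zt0 <> 0%C -> Cmod (zt - zt0) < Cmod zt0 / 2 -> 0 < Re (zt / zt0).
Proof.
  intros h0 h. apply Re_pos_near_1.
  replace (zt / zt0 - 1)%C with ((zt - zt0) / zt0)%C by (field; exact h0).
  assert (hm : 0 < Cmod zt0) by (apply Cmod_gt_0; exact h0).
  rewrite Cmod_div by exact h0. apply Rlt_div_l; lra.
Qed.

(** By periodicity the chosen preimage [clog1] may be replaced, near any given point, by a
    differentiable branch. *)
Lemma finite_holomorphic_clog1 (Phi : C -> Chat) (zt0 z0 : C) :
  periodic1 Phi -> zt0 <> 0%C -> cexp1 z0 = zt0 ->
  finite_holomorphic_at Phi z0 -> finite_holomorphic_at (fun zt => Phi (clog1 zt)) zt0.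
Proof.
  intros hper h0 hz hol. apply locally_Cmod in hol. destruct hol as [d [hd hol]].
  apply locally_Cmod.
  assert (hm : 0 < Cmod zt0) by (apply Cmod_gt_0; exact h0).
  destruct (branch_cderiv zt0 z0 h0) as [a ha].
  destruct (cderiv_cont _ _ _ ha (d / 2)) as [d1 [hd1 h1]]; [lra |].
  exists (Rmin d1 (Cmod zt0 / 2)). split; [apply Rmin_glb_lt; lra |].
  pose_rmin.
  intros u hu.
  assert (hb0 : branch zt0 z0 zt0 = z0).
  { unfold branch. replace (zt0 / zt0)%C with (RtoC 1) by (field; exact h0).
    rewrite clog_1. unfold Cdiv. ring. }
  assert (nu : u <> 0%C).
  { intros e. rewrite e in hu. replace (0 - zt0)%C with (- zt0)%C in hu by ring.
    rewrite Cmod_opp in hu. lra. }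
  set (zu := branch zt0 z0 u).
  assert (Ezu : cexp1 zu = u) by (apply cexp1_branch; auto; apply ratio_near_1; auto; lra).
  specialize (h1 u ltac:(lra)). rewrite hb0 in h1. fold zu in h1.
  destruct (hol zu ltac:(lra)) as [hfin [l hl]].
  assert (key : forall zt z : C, zt <> 0%C -> cexp1 z = zt -> Phi (clog1 zt) = Phi z).
  { intros zt z n e. apply hper, cexp1_inj. now rewrite cexp1_clog1, e. }
  split.
  - now rewrite (key u zu nu Ezu).
  (* The derivative of a branch is known only at its centre, so at [u] the branch is recentred at
     [u]. *)
  - destruct (branch_cderiv u zu nu) as [b hb].
    assert (hbu : branch u zu u = zu).
    { unfold branch. replace (u / u)%C with (RtoC 1) by (field; exact nu).
      rewrite clog_1. unfold Cdiv. ring. }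
    exists (l * b)%C. apply cderiv_is_derive.
    assert (mu : 0 < Cmod u) by (apply Cmod_gt_0; exact nu).
    apply (cderiv_ext_loc (fun v => fin (Phi (branch u zu v))) _ u _ (Cmod u / 2)).
    + lra.
    + intros v hv. f_equal. symmetry. apply key.
      * intros e. rewrite e in hv. replace (0 - u)%C with (- u)%C in hv by ring.
        rewrite Cmod_opp in hv. lra.
      * apply cexp1_branch; auto. now apply ratio_near_1.
    + apply (cderiv_comp (fun v => fin (Phi v)) (branch u zu)); [| exact hb].
      rewrite hbu. now apply cderiv_is_derive.
Qed.

Lemma Zperiodic (Phi : C -> Chat) : (forall z, Phi (z + 1)%C = Phi z) -> periodic1 Phi.
Proof.
  intros h.
  assert (A : forall n z, Phi (z + RtoC (INR n))%C = Phi z).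
  { induction n as [| n IH]; intros z.
    - simpl. f_equal. ring.
    - rewrite S_INR, RtoC_plus. replace (z + (INR n + 1))%C with ((z + 1) + INR n)%C by ring.
      now rewrite IH. }
  intros z z' [n ->].
  destruct (Z_le_gt_dec 0 n) as [hn | hn].
  - rewrite <- (Z2Nat.id n hn), <- INR_IZR_INZ. now rewrite A.
  - rewrite <- (A (Z.to_nat (- n)) (z + IZR n)%C).
    f_equal. rewrite INR_IZR_INZ, Z2Nat.id by lia. rewrite opp_IZR, RtoC_opp. ring.
Qed.

(** [cexp1] identifies the strip modulo integral translations with the annulus of inner radius
    [q = exp (- 2 pi m)], and [ln (/ q) / (2 pi) = m]. *)
Theorem conformal_module_of_strip (Phi : C -> Chat) (V : Chat -> Prop) (m : R) :
  0 < m -> (forall z, Phi (z + 1)%C = Phi z) ->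
  conformal_mod Zshift (hstrip m) Phi V -> is_conformal_module V m.
Proof.
  intros hm hper1 [hol [hinj hsurj]]. assert (hper := Zperiodic Phi hper1).
  assert (hpi := PI_RGT_0).
  set (q := exp (- (2 * PI * m))).
  assert (hq : 0 < q < 1).
  { split; [apply exp_pos |]. unfold q. rewrite <- exp_0. apply exp_increasing. nra. }
  assert (hann : forall z, annulus q (cexp1 z) <-> hstrip m z).
  { intros z. unfold annulus, hstrip. rewrite Cmod_cexp1. unfold q. split.
    - intros [a b]. apply exp_lt_inv in a. rewrite <- exp_0 in b. apply exp_lt_inv in b. nra.
    - intros [a b]. split; [apply exp_increasing; nra |].
      rewrite <- exp_0 . apply exp_increasing. nra. }
  assert (hnz : forall zt, annulus q zt -> zt <> 0%C).
  { intros zt [a _]. apply Cmod_gt_0. lra. }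
  assert (hst : forall zt, annulus q zt -> hstrip m (clog1 zt)).
  { intros zt h. apply hann. rewrite cexp1_clog1; auto. }
  exists q, (fun zt => Phi (clog1 zt)). split; [exact hq |]. split.
  - split; [| split].
    + intros zt h. assert (E := cexp1_clog1 zt (hnz zt h)).
      destruct (hol _ (hst zt h)) as [X | X]; [left | right].
      * exact (finite_holomorphic_clog1 Phi zt _ hper (hnz zt h) E X).
      * refine (finite_holomorphic_clog1 (fun u => hinv (Phi u)) zt _ _ (hnz zt h) E X).
        intros z z' hz. f_equal. now apply hper.
    + intros z z' hz hz'. rewrite (hinj _ _ (hst z hz) (hst z' hz')). split.
      * intros [n hn].
        rewrite <- (cexp1_clog1 z) by auto. rewrite <- (cexp1_clog1 z') by auto.
        rewrite hn, cexp1_plus, cexp1_Z. ring.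
      * intros <-. exists 0%Z. ring.
    + intros w. rewrite hsurj. split.
      * intros [z [hz hw]]. exists (cexp1 z). split; [now apply hann |].
        rewrite <- hw. apply hper, cexp1_inj. apply cexp1_clog1, Cexp_neq_0.
      * intros [zt [hz hw]]. exists (clog1 zt). auto.
  - unfold q. rewrite <- exp_Ropp, ln_exp. field. lra.
Qed.

Theorem corollary1 :
  forall (J : R -> Prop) (theta beta : R) (P : slit_data) (f : C -> R -> Chat),
  slit_family J theta beta P f ->
  forall t : R, J t ->
  is_conformal_module (slit_ext theta beta P t) (sd_m P t) /\
  exists (dm : R) (dA : nat -> C),
    is_derive_on (V := R_NormedModule) J (sd_m P) t dm /\
    (forall k, (1 <= k <= 4)%nat ->
       is_derive_on (V := C_R_NormedModule) J (slit_A P f k) t (dA k)) /\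
    RtoC dm = (RtoC PI * sum_n_m (fun k => dA k / slit_D P f k t) 1 4)%C.
Proof.
  intros J theta beta P f sf t ht. split.
  - apply (conformal_module_of_strip (fun v => f v t)).
    + exact (sf_m _ _ _ _ _ sf t ht).
    + intros z. exact (sf_period1 _ _ _ _ _ sf t z ht).
    + exact (sf_conformal _ _ _ _ _ sf t ht).
  - destruct (m_pderiv J theta beta P f sf t ht) as [mp hm].
    destruct (time_derivatives J theta beta P f sf t ht) as [ga [gb [ft [hgab hft]]]].
    (* The derivative of [A_k] is the partial time derivative of [f] at [z_k]. *)
    exists mp, (fun k => ft (zpt P k t)). split; [| split].
    + now apply is_derive_on_pderiv_R.
    + intros k hk. apply is_derive_on_pderiv; [exact ht |].
      exact (slit_A_pderiv J theta beta P f sf t ht ft hft k hk).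
    + rewrite (module_derivative J theta beta P f sf t ht ga gb ft hgab hft mp hm).
      f_equal. unfold res.
      do 3 rewrite sum_n_Sm by lia. rewrite sum_n_n.
      unfold plus; simpl. ring.
Qed.
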